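(* Let $N\in\mathbb{N}$. For every $k\in\mathbb{N}$ (with $k\geq 1$) one has the equality $$(-1)^k\,\mathrm{div}_k\left(|x|^{2k-N}\,\nabla^k\log|x|\right)=-\ell_N^k\,\omega_{N-1}\,\delta_0$$ in the sense of distributions on $\mathbb{R}^N$.
   Context: $\nabla^k v(x)$ denotes the tensor of all $N^k$ partial derivatives $\frac{\partial^k v}{\partial x_{i_1}\cdots\partial x_{i_k}}(x)$, $i_1,\ldots,i_k\in\{1,\ldots,N\}$, and $|\nabla^k v|(x)$ is its Euclidean norm in $\mathbb{R}^{N^k}$. In the statement $\nabla^k\log|x|$ is the pointwise derivative on $\mathbb{R}^N\setminus\{0\}$, so that $|x|^{2k-N}\nabla^k\log|x|$ is a locally integrable tensor field on $\mathbb{R}^N$. For a tensor $T=(T_{i_1,\ldots,i_k})$ with $N^k$ components, $\mathrm{div}_k(T)=\sum_{i_1,\ldots,i_k\in\{1,\ldots,N\}}\frac{\partial^kT_{i_1,\ldots,i_k}}{\partial x_{i_1}\cdots\partial x_{i_k}}$. $\ell_N^k$ is the positive constant (depending only on $N,k$) such that $\big|\nabla^k\log|x|\big|^2=\ell_N^k|x|^{-2k}$ for all $x\in\mathbb{R}^N\setminus\{0\}$ (such a constant exists). $\omega_{N-1}=2\pi^{N/2}/\Gamma(N/2)$ is the surface measure of the unit sphere in $\mathbb{R}^N$. $\delta_0$ is the Dirac mass at the origin. *)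

(* Defs.v *)
From HB Require Import structures.
From mathcomp Require Import all_boot all_order all_algebra.
From mathcomp Require Import all_classical all_reals all_analysis.

Set Implicit Arguments.
Unset Strict Implicit.
Unset Printing Implicit Defensive.

Import Order.TTheory GRing.Theory Num.Theory.
Import numFieldNormedType.Exports.

Local Open Scope classical_set_scope.
Local Open Scope ring_scope.

(* R^n is 'rV[R]_n; its topology and derivatives are the library's (the sup
   norm is equivalent to the Euclidean one).  Measurable sets: the product
   sigma-algebra, generated by the coordinate functions. *)

Definition rV_display (n : nat) : measure_display.
Proof. exact default_measure_display. Qed.

Section rV_measurable.
Context {R : realType} {n : nat}.

Definition rV_measurable : set (set 'rV[R]_n) :=
  g_sigma_preimage (fun (i : 'I_n) (x : 'rV[R]_n) => (x 0 i : measurableTypeR R)).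

Let rV_measurable0 : rV_measurable set0.
Proof. exact: sigma_algebra0. Qed.

Let rV_measurableC A : rV_measurable A -> rV_measurable (~` A).
Proof. exact: sigma_algebraC. Qed.

Let rV_measurable_bigcup (F : _^nat) : (forall i, rV_measurable (F i)) ->
  rV_measurable (\bigcup_i (F i)).
Proof. exact: sigma_algebra_bigcup. Qed.

HB.instance Definition _ := @isMeasurable.Build (rV_display n)
  'rV[R]_n rV_measurable rV_measurable0 rV_measurableC rV_measurable_bigcup.

End rV_measurable.

Definition rV_cons {R : realType} {n : nat} (p : measurableTypeR R * 'rV[R]_n) :
  'rV[R]_n.+1 := row_mx (p.1 : R)%:M p.2 : 'rV[R]_(1 + n).

Section rV_cons_measurable.
Context {R : realType} {n : nat}.

Lemma measurable_coord (i : 'I_n) :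
  measurable_fun [set: 'rV[R]_n] (fun x => x 0 i : measurableTypeR R).
Proof.
move=> _ Y mY; rewrite setTI; apply: sub_sigma_algebra => /=.
rewrite -bigcup_seq/=; exists i => /=; first by rewrite mem_index_enum.
by exists Y => //; rewrite setTI.
Qed.

Lemma rV_cons0 (p : measurableTypeR R * 'rV[R]_n) : rV_cons p 0 ord0 = p.1.
Proof.
rewrite /rV_cons (_ : ord0 = lshift n (ord0 : 'I_1)); last exact/val_inj.
by rewrite (@row_mxEl R 1 1 n) mxE eqxx mulr1n.
Qed.

Lemma rV_consS (p : measurableTypeR R * 'rV[R]_n) (i : 'I_n) :
  rV_cons p 0 (lift ord0 i) = p.2 0 i.
Proof.
rewrite /rV_cons (_ : lift ord0 i = rshift 1 i); last exact/val_inj.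
by rewrite (@row_mxEr R 1 1 n).
Qed.

Lemma measurable_rV_cons :
  measurable_fun setT (@rV_cons R n).
Proof.
move=> _ Y mY; rewrite setTI.
suff : rV_measurable `<=` [set A | measurable ((@rV_cons R n) @^-1` A)] by exact.
apply: smallest_sub => /=.
  split => /=.
  - by rewrite preimage_set0.
  - by move=> A mA; rewrite setTD preimage_setC; exact: measurableC.
  - by move=> F mF; rewrite preimage_bigcup; exact: bigcupT_measurable.
rewrite -bigcup_seq => A [i _ [B mB <-]] /=; rewrite setTI -comp_preimage.
case: (unliftP ord0 i) => [j|] ->.
- rewrite (_ : _ \o _ = (fun x : 'rV[R]_n => x 0 j : measurableTypeR R) \o snd).
    have := measurableT_comp (measurable_coord j) (@measurable_snd _ _ (measurableTypeR R) 'rV[R]_n).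
    by move=> /(_ measurableT B mB); rewrite setTI.
  by apply/funext => p /=; rewrite rV_consS.
- rewrite (_ : _ \o _ = fst).
    have := @measurable_fst _ _ (measurableTypeR R) 'rV[R]_n.
    by move=> /(_ measurableT B mB); rewrite setTI.
  by apply/funext => p /=; rewrite rV_cons0.
Qed.

End rV_cons_measurable.

Section rV_uncons.
Context {R : realType} {n : nat}.

Definition rV_uncons (x : 'rV[R]_n.+1) : measurableTypeR R * 'rV[R]_n :=
  (x 0 ord0, \row_i x 0 (lift ord0 i)).

Lemma rV_consK : cancel (@rV_cons R n) rV_uncons.
Proof.
move=> [a v]; rewrite /rV_uncons rV_cons0; congr pair.
by apply/rowP => i; rewrite mxE rV_consS.
Qed.

Let measurable_tail :
  measurable_fun setT (fun x : 'rV[R]_n.+1 => \row_i x 0 (lift ord0 i) : 'rV[R]_n).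
Proof.
move=> _ Y mY; rewrite setTI.
set f := fun x : 'rV[R]_n.+1 => _.
suff : @rV_measurable R n `<=` [set A | measurable (f @^-1` A)] by exact.
apply: smallest_sub => /=.
  split => /=.
  - by rewrite preimage_set0.
  - by move=> A mA; rewrite setTD preimage_setC; exact: measurableC.
  - by move=> F mF; rewrite preimage_bigcup; exact: bigcupT_measurable.
rewrite -bigcup_seq => A [i _ [B mB <-]] /=; rewrite setTI -comp_preimage.
rewrite (_ : _ \o f = fun x : 'rV[R]_n.+1 => x 0 (lift ord0 i)); last first.
  by apply/funext => x /=; rewrite mxE.
by have := @measurable_coord R n.+1 (lift ord0 i) measurableT B mB; rewrite setTI.
Qed.

Lemma measurable_rV_uncons : measurable_fun setT rV_uncons.
Proof.
by apply: measurable_fun_pair; [exact: measurable_coord|exact: measurable_tail].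
Qed.

End rV_uncons.

Section lebesgue_measure_rV_step.
Local Open Scope ereal_scope.
Context {R : realType} {n : nat}.
Variable m : {sigma_finite_measure set 'rV[R]_n -> \bar R}.

Definition rV_product_measure : set 'rV[R]_n.+1 -> \bar R :=
  pushforward (@lebesgue_measure R \x m) rV_cons.

Let measurable_preimage_rV_cons (A : set 'rV[R]_n.+1) :
  measurable A -> measurable (rV_cons @^-1` A).
Proof. by move=> mA; rewrite -[X in measurable X]setTI; exact: measurable_rV_cons. Qed.

Let rV_product_measure0 : rV_product_measure set0 = 0.
Proof. by rewrite /rV_product_measure /pushforward preimage_set0 measure0. Qed.

Let rV_product_measure_ge0 A : 0 <= rV_product_measure A.
Proof. exact: (measure_ge0 (@lebesgue_measure R \x m)). Qed.

Let rV_product_measure_semi_sigma_additive :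
  semi_sigma_additive rV_product_measure.
Proof.
move=> F mF tF mUF; rewrite /rV_product_measure /pushforward preimage_bigcup.
apply: measure_semi_sigma_additive.
- by move=> i; exact: measurable_preimage_rV_cons.
- apply/trivIsetP => /= i j _ _ ij; rewrite -preimage_setI.
  by move/trivIsetP : tF => /(_ _ _ _ _ ij) ->//; rewrite preimage_set0.
- by rewrite -preimage_bigcup; exact: measurable_preimage_rV_cons.
Qed.

HB.instance Definition _ := isMeasure.Build _ _ _ rV_product_measure
  rV_product_measure0 rV_product_measure_ge0
  rV_product_measure_semi_sigma_additive.

Let rV_product_measure_sigma_finite : sigma_finite setT rV_product_measure.
Proof.
have /sigma_finiteP[F [TF ndF Foo]] := sigma_finiteT (@lebesgue_measure R).
have /sigma_finiteP[G [TG ndG Goo]] := sigma_finiteT m.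
exists (fun i => rV_uncons @^-1` (F i `*` G i)).
  rewrite -preimage_bigcup (_ : \bigcup_i _ = setT) ?preimage_setT//.
  apply/seteqP; split=> // -[x y] _.
  have : setT x by [].
  rewrite TF => -[i _ Fix]; have : setT y by [].
  rewrite TG => -[j _ Gjy]; exists (maxn i j) => //; split => /=.
  - by move: x Fix; exact/subsetPset/ndF/leq_maxl.
  - by move: y Gjy; exact/subsetPset/ndG/leq_maxr.
move=> i; have [mF Fi] := Foo i; have [mG Gi] := Goo i; split.
  rewrite -[X in measurable X]setTI; apply: measurable_rV_uncons => //.
  exact: measurableX.
rewrite /rV_product_measure /pushforward -comp_preimage.
rewrite (_ : rV_uncons \o _ = id) ?preimage_id; last first.
  by apply/funext => x; exact: rV_consK.
by rewrite product_measure1E// lte_mul_pinfty// ge0_fin_numE.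
Qed.

HB.instance Definition _ := Measure_isSigmaFinite.Build _ _ _
  rV_product_measure rV_product_measure_sigma_finite.

End lebesgue_measure_rV_step.

Fixpoint lebesgue_measure_rV {R : realType} (n : nat) :
    {sigma_finite_measure set 'rV[R]_n -> \bar R} :=
  if n is n'.+1 return {sigma_finite_measure set 'rV[R]_n -> \bar R}
  then rV_product_measure (lebesgue_measure_rV n')
  else \d_(0 : 'rV[R]_0).

Section differential_calculus.
Context {R : realType} {N : nat}.
Implicit Types (f : 'rV[R]_N -> R) (x : 'rV[R]_N).

Definition partial (i : 'I_N) f : 'rV[R]_N -> R :=
  'D_(delta_mx 0 i : 'rV[R]_N) f.

Definition partials (s : seq 'I_N) f : 'rV[R]_N -> R := foldr partial f s.

Definition smooth f := forall s : seq 'I_N,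
  continuous (partials s f) /\
  forall (i : 'I_N) x, derivable (partials s f) x (delta_mx 0 i).

Definition test_function f :=
  smooth f /\ compact (closure [set x | f x != 0]).

Definition enorm x : R := Num.sqrt (\sum_i x 0 i ^+ 2).

Definition locally_integrable_rV f := forall K : set 'rV[R]_N,
  compact K -> (lebesgue_measure_rV N).-integrable K (EFin \o f).

End differential_calculus.

Definition tensor (R : realType) (N k : nat) := k.-tuple 'I_N -> R.

Definition tensor_norm (R : realType) (N k : nat) (T : tensor R N k) : R :=
  Num.sqrt (\sum_I T I ^+ 2).

Definition nabla (R : realType) (N k : nat) (f : 'rV[R]_N -> R)
  (x : 'rV[R]_N) : tensor R N k := fun I => partials I f x.
Arguments nabla {R N} k f x I.

(* A distribution is represented by the functional it induces; only its values
   on test functions matter, cf. eq_distribution. *)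
Section distributions.
Context {R : realType} {N : nat}.

Definition distribution := ('rV[R]_N -> R) -> R.

Definition eq_distribution (S S' : distribution) :=
  forall phi, test_function phi -> S phi = S' phi.

Definition distribution_of (f : 'rV[R]_N -> R) : distribution :=
  fun phi => \int[lebesgue_measure_rV N]_x (f x * phi x).

Definition distribution_scale (a : R) (S : distribution) : distribution :=
  fun phi => a * S phi.

Definition distribution_partial (i : 'I_N) (S : distribution) : distribution :=
  fun phi => - S (partial i phi).

Definition distribution_partials (s : seq 'I_N) (S : distribution) :=
  foldr distribution_partial S s.

Definition distribution_div k (T : 'rV[R]_N -> tensor R N k) : distribution :=
  fun phi => \sum_(I : k.-tuple 'I_N)
    distribution_partials I (distribution_of (fun x => T x I)) phi.

Definition delta0 : distribution := fun phi => phi 0.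

End distributions.

Section constants.
Context (R : realType).

Definition log_enorm (N : nat) (x : 'rV[R]_N) : R := ln (enorm x).

(* xget returns 0 when there is no such l; 0 itself is excluded by the set. *)
Definition ell (N k : nat) : R := xget 0
  [set l : R | 0 < l /\ forall x : 'rV[R]_N, x != 0 ->
    tensor_norm (nabla k (@log_enorm N) x) ^+ 2 = l * enorm x ^- (2 * k)].

Definition Gamma (s : R) : R :=
  \int[@lebesgue_measure R]_(t in `]0, +oo[) (t `^ (s - 1) * expR (- t)).

(* omega N is the area of the unit sphere of R^N, usually written with the
   index N - 1. *)
Definition omega (N : nat) : R := 2 * pi `^ (N%:R / 2) / Gamma (N%:R / 2).

End constants.

(* Main.v *)
(* Let E = sum_i x_i d_i be the Euler operator, E' f = - sum_i d_i (x_i f) its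
   adjoint and u = log|x|.  By Bochner's identity, polarised and iterated, the
   operators
     g |-> |x|^(2k) sum_I d_I u d_I g,   g |-> (-1)^k sum_I d_I (|x|^(2k) g d_I u)
   act on radial functions g as 2^-k p(E) and 2^-k p(E'), with one and the same
   integer polynomial p = sum_j p_j X^j, p_0 = 0.  As E u = 1, taking g = u in the
   first one gives ell = 2^-k p_1.  In the second one, g = (eps + |x|^2)^(-N/2) is a
   smooth approximation of |x|^-N with E' g = - rho_eps, where
   rho_eps = N eps (eps + |x|^2)^(-N/2 - 1) has mass omega_(N-1) for every eps and
   concentrates at the origin.  Hence, against a test function phi, the term of
   degree j >= 1 of 2^-k p(E') g tends to - 2^-k p_j omega_(N-1) (E^(j-1) phi)(0),
   which is zero for j >= 2. *)

From HB Require Import structures.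
From mathcomp Require Import all_boot all_order all_algebra.
From mathcomp Require Import all_classical all_reals all_analysis.
From mathcomp Require Import measurable_realfun ring lra.
Require Import Defs.

Set Implicit Arguments.
Unset Strict Implicit.
Unset Printing Implicit Defensive.

Import Order.TTheory GRing.Theory Num.Theory.
Import numFieldNormedType.Exports.
Local Open Scope classical_set_scope.
Local Open Scope ring_scope.

(** * Iterated gradients of radial functions *)

(** For fixed u the two operators are formal adjoints of each other, and so are E and E'; this is
    why a single p serves both. The divergence side is nevertheless derived algebraically, by
    transposing Bochner's identity and running the same induction, so that no integral is involved
    at that stage. The induction does not close on the logarithm: it calls for Delta u = (N - 2)
    |x|^-2, hence for all the powers |x|^(-2m), a family stable under the Laplacian. Spherical
    coordinates are avoided too. The mass of rho_eps comes from Gaussian integrals, (eps +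
    |x|^2)^(-N/2 - 1) being written as an integral of exponentials, and the local integrability of
    |x|^(1 - N) from a comparison with a weighted sum of kernels rho_eps, whose masses are then
    known. *)

Section operator_polynomials.
Context {A : zmodType}.
Implicit Types (p q : {poly int}) (g : A).

(** Integer coefficients make sense in any abelian group; the halves that Bochner's identity
    produces are cleared by powers of 2 instead. *)
Definition opoly (e : A -> A) p g : A := \sum_(i < size p) iter i e g *~ p`_i.

Lemma opolyE e p g n : (size p <= n)%N ->
  opoly e p g = \sum_(i < n) iter i e g *~ p`_i.
Proof.
move=> pn; rewrite /opoly (big_ord_widen n (fun i => iter i e g *~ p`_i))//.
rewrite big_mkcond; apply: eq_bigr => i _; case: ltnP => // ip.
by rewrite nth_default// mulr0z.
Qed.

Lemma opoly0 e g : opoly e 0 g = 0.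
Proof. by rewrite /opoly size_poly0 big_ord0. Qed.

Lemma opolyC e c g : opoly e c%:P g = g *~ c.
Proof. by rewrite (@opolyE _ _ _ 1) ?size_polyC_leq1// big_ord1 coefC. Qed.

Lemma opoly1 e g : opoly e 1 g = g.
Proof. by rewrite -polyC1 opolyC. Qed.

Lemma opolyD e p q g : opoly e (p + q) g = opoly e p g + opoly e q g.
Proof.
set n := maxn (size p) (size q).
rewrite !(@opolyE _ _ _ n) ?leq_maxl ?leq_maxr ?size_polyD// -big_split/=.
by apply: eq_bigr => i _; rewrite coefD mulrzDr.
Qed.

Lemma opolyN e p g : opoly e (- p) g = - opoly e p g.
Proof.
rewrite /opoly size_polyN -sumrN; apply: eq_bigr => i _.
by rewrite coefN mulrNz.
Qed.

Lemma opolyZ e c p g : opoly e (c *: p) g = opoly e p g *~ c.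
Proof.
rewrite (@opolyE _ _ _ (size p)) ?size_scale_leq// /opoly mulrz_suml.
by apply: eq_bigr => i _; rewrite coefZ mulrC mulrzA.
Qed.

Lemma opolyMX e p g : opoly e (p * 'X) g = opoly e p (e g).
Proof.
rewrite (@opolyE _ _ _ (size p).+1); last first.
  by rewrite (leq_trans (size_polyMleq _ _))// size_polyX addn2.
rewrite big_ord_recl coefMX mulr0z add0r; apply: eq_bigr => i _.
by rewrite coefMX/= -iterS iterSr.
Qed.

Lemma opolyX e g : opoly e 'X g = e g.
Proof. by rewrite -['X]mul1r opolyMX opoly1. Qed.

Lemma opoly_closed e (P : A -> Prop) : P 0 ->
    (forall f g, P f -> P g -> P (f - g)) -> (forall f, P f -> P (e f)) ->
  forall p g, P g -> P (opoly e p g).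
Proof.
move=> P0 PB Pe p g Pg.
have PN f : P f -> P (- f) by move=> Pf; rewrite -sub0r; apply: PB.
have PD f h : P f -> P h -> P (f + h).
  by move=> Pf Ph; rewrite -[h]opprK; apply: PB => //; apply: PN.
have PMn f n : P f -> P (f *+ n).
  by move=> Pf; elim: n => [|n IH]; rewrite ?mulr0n// mulrS; apply: PD.
have PMz f c : P f -> P (f *~ c).
  move=> Pf; case: c => n; first by rewrite -pmulrn; exact: PMn.
  by rewrite NegzE mulrNz -pmulrn; apply: PN; exact: PMn.
rewrite /opoly; elim/big_ind: _ => // i _; apply: PMz.
by elim: (i : nat) => //= j; apply: Pe.
Qed.

Variable e : {additive A -> A}.

Lemma opoly_is_additive p : zmod_morphism (opoly e p).
Proof.
move=> f g; rewrite /opoly -sumrB; apply: eq_bigr => i _.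
rewrite -mulrzBl; congr (_ *~ _).
by elim: (i : nat) => //= j ->; rewrite raddfB.
Qed.

HB.instance Definition _ p :=
  GRing.isZmodMorphism.Build A A (opoly e p) (opoly_is_additive p).

Lemma opolyM p q g : opoly e (p * q) g = opoly e p (opoly e q g).
Proof.
elim/poly_ind: q g => [|q c IH] g; first by rewrite mulr0 !opoly0 raddf0.
rewrite mulrDr !opolyD mulrA !opolyMX IH raddfD/=; congr (_ + _).
by rewrite mulrC mul_polyC opolyC raddfMz/= opolyZ.
Qed.

End operator_polynomials.

(* Moving the factor [a] to the left turns [e] into [q(e)]. *)
Lemma opolyMl (A : nzRingType) (e : {additive A -> A}) (a : A) q :
  (forall g, e (a * g) = a * opoly e q g) ->
  forall p g, opoly e p (a * g) = a * opoly e (p \Po q) g.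
Proof.
move=> ea p g; elim/poly_ind: p g => [|p c IH] g.
  by rewrite comp_poly0 !opoly0 mulr0.
rewrite comp_polyD comp_polyM comp_polyX comp_polyC !opolyD opolyMX opolyM ea IH.
by rewrite mulrDr !opolyC mulrzAr.
Qed.

(** * Bochner's identity in a ring with commuting derivations *)

Section differential_ring.
Context {A : comNzRingType} {n : nat}.
Variables (d : 'I_n -> {additive A -> A}) (x : 'I_n -> A).
Hypothesis dM : forall i f g, d i (f * g) = d i f * g + f * d i g.
Hypothesis dC : forall i j f, d i (d j f) = d j (d i f).
Hypothesis dx : forall i j, d i (x j) = (i == j)%:R.
Implicit Types f g h u : A.

Definition sqnorm : A := \sum_i x i ^+ 2.
Definition laplacian f : A := \sum_i d i (d i f).
Definition euler f : A := \sum_i x i * d i f.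
Definition euler_adj f : A := - \sum_i d i (x i * f).

Local Notation s := sqnorm.
Local Notation E := euler.
Local Notation th := euler_adj.

Lemma laplacian_is_additive : zmod_morphism laplacian.
Proof. by move=> f g; rewrite -sumrB; apply: eq_bigr => i _; rewrite !raddfB. Qed.
HB.instance Definition _ :=
  GRing.isZmodMorphism.Build A A laplacian laplacian_is_additive.

Lemma euler_is_additive : zmod_morphism euler.
Proof.
by move=> f g; rewrite -sumrB; apply: eq_bigr => i _; rewrite raddfB mulrBr.
Qed.
HB.instance Definition _ := GRing.isZmodMorphism.Build A A euler euler_is_additive.

Lemma euler_adj_is_additive : zmod_morphism euler_adj.
Proof.
move=> f g; rewrite -opprD -sumrB; congr (- _).
by apply: eq_bigr => i _; rewrite mulrBr raddfB.
Qed.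
HB.instance Definition _ :=
  GRing.isZmodMorphism.Build A A euler_adj euler_adj_is_additive.

Lemma euler_adjE f : th f = - (n%:R * f + E f).
Proof.
congr (- _); rewrite mulr_natl -[in X in X + _](card_ord n) -sumr_const -big_split/=.
by apply: eq_bigr => i _; rewrite dM dx eqxx mul1r.
Qed.

Lemma d1 i : d i 1 = 0.
Proof.
have /eqP := dM i 1 1; rewrite !mul1r mulr1.
by rewrite -[X in X == _]addr0 (inj_eq (addrI _)) eq_sym => /eqP.
Qed.

Lemma d_nat i m : d i m%:R = 0.
Proof. by rewrite raddfMn/= d1 mul0rn. Qed.

Lemma d_sqnorm i : d i s = 2 * x i.
Proof.
rewrite raddf_sum/= (bigD1 i)//= big1 ?addr0 => [|j ji].
  by rewrite expr2 dM dx eqxx mul1r mulr1; ring.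
by rewrite expr2 dM dx eq_sym (negPf ji) mul0r mulr0 addr0.
Qed.

Lemma eulerM f g : E (f * g) = E f * g + f * E g.
Proof.
rewrite /euler mulr_suml mulr_sumr -big_split/=; apply: eq_bigr => i _.
by rewrite dM; ring.
Qed.

Lemma euler1 : E 1 = 0.
Proof. by rewrite /euler big1// => i _; rewrite d1 mulr0. Qed.

Lemma euler_nat m : E m%:R = 0.
Proof. by rewrite /euler big1// => i _; rewrite d_nat mulr0. Qed.

Lemma eulerD f g : E (f + g) = E f + E g. Proof. exact: raddfD. Qed.

Lemma euler_adjB f g : th (f - g) = th f - th g. Proof. exact: raddfB. Qed.

Lemma euler_adjN f : th (- f) = - th f. Proof. exact: raddfN. Qed.

Lemma euler_natl m f : E (m%:R * f) = m%:R * E f.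
Proof. by rewrite eulerM euler_nat mul0r add0r. Qed.

Lemma euler_adj_natl m f : th (m%:R * f) = m%:R * th f.
Proof. by rewrite !euler_adjE euler_natl; ring. Qed.

Lemma euler_sqnorm : E s = 2 * s.
Proof.
rewrite /euler [in RHS]/sqnorm mulr_sumr; apply: eq_bigr => i _.
by rewrite d_sqnorm; ring.
Qed.

Lemma d_euler i f : d i (E f) = E (d i f) + d i f.
Proof.
rewrite /euler raddf_sum/=.
under eq_bigr => j _ do rewrite dM dx dC.
rewrite big_split/= addrC; congr (_ + _).
rewrite (bigD1 i)//= eqxx mul1r big1 ?addr0// => j ji.
by rewrite eq_sym (negPf ji) mul0r.
Qed.

(* In a ring of functions on [R^n \ {0}] this says that the gradient of [g] is
   radial, i.e. that [g] only depends on the norm. *)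
Definition radial g := forall i, s * d i g = x i * E g.

Lemma radialB f g : radial f -> radial g -> radial (f - g).
Proof. by move=> rf rg i; rewrite !raddfB/= !mulrBr rf rg. Qed.

Lemma radial0 : radial 0.
Proof. by move=> i; rewrite !raddf0 !mulr0. Qed.

Lemma radialD f g : radial f -> radial g -> radial (f + g).
Proof. by move=> rf rg i; rewrite !raddfD/= !mulrDr rf rg. Qed.

Lemma radialN f : radial f -> radial (- f).
Proof. by move=> rf i; rewrite !raddfN/= !mulrN rf. Qed.

Lemma radialM f g : radial f -> radial g -> radial (f * g).
Proof.
move=> rf rg i; rewrite eulerM dM.
transitivity ((s * d i f) * g + f * (s * d i g)); first by ring.
by rewrite rf rg; ring.
Qed.

Lemma radial_nat m : radial m%:R.
Proof. by move=> i; rewrite d_nat euler_nat !mulr0. Qed.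

Lemma radial1 : radial 1. Proof. exact: (radial_nat 1). Qed.

Lemma radialX f m : radial f -> radial (f ^+ m).
Proof.
move=> rf; elim: m => [|m IH]; first by rewrite expr0; exact: radial1.
by rewrite exprS; exact: radialM.
Qed.

Lemma radial_sqnorm : radial s.
Proof. by move=> i; rewrite d_sqnorm euler_sqnorm; ring. Qed.

(** Apply E to the relation that makes [f] radial. As E s = 2 s and E x_i = x_i, the surplus terms
    cancel by that same relation once d_i is commuted past E. *)
Lemma radial_euler f : radial f -> radial (E f).
Proof.
move=> rf i; rewrite d_euler.
have Es : E (s * d i f) = 2 * s * d i f + s * E (d i f).
  by rewrite eulerM euler_sqnorm.
have Ex : E (x i) = x i.
  rewrite /euler (bigD1 i)//= dx eqxx mulr1 big1 ?addr0// => j ji.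
  by rewrite dx (negPf ji) mulr0.
have : E (s * d i f) = E (x i * E f) by rewrite rf.
rewrite Es eulerM Ex => H.
have -> : s * (E (d i f) + d i f) =
  2 * s * d i f + s * E (d i f) - s * d i f by ring.
by rewrite H rf; ring.
Qed.

Lemma radial_euler_adj f : radial f -> radial (th f).
Proof.
move=> rf; rewrite euler_adjE; apply/radialN/radialD; last exact: radial_euler.
by apply: radialM => //; exact: radial_nat.
Qed.

(** This is |x|^2 Delta = (r d_r)^2 + (n - 2) r d_r with r d_r = E. The radial relation of index i
    is differentiated along the same x_i, and the results are summed. *)
Lemma radial_laplacian f : radial f ->
  s * laplacian f = E (E f) + (n%:R - 2) * E f.
Proof.
move=> rf.
have H i : s * d i (d i f) = x i * d i (E f) + E f - 2 * (x i * d i f).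
  have := congr1 (d i) (rf i); rewrite !dM d_sqnorm dx eqxx mul1r => H.
  have -> : s * d i (d i f) = (2 * x i * d i f + s * d i (d i f)) -
    2 * (x i * d i f) by ring.
  by rewrite H; ring.
rewrite /laplacian mulr_sumr (eq_bigr _ (fun i _ => H i)) sumrB big_split/=.
rewrite sumr_const card_ord -mulr_sumr -/(E f) -/(E (E f)) -mulr_natl; ring.
Qed.

Lemma laplacianM f g :
  laplacian (f * g) = laplacian f * g + f * laplacian g + 2 * \sum_i d i f * d i g.
Proof.
rewrite /laplacian mulr_suml !mulr_sumr -!big_split/=; apply: eq_bigr => i _.
by rewrite dM raddfD/= !dM; ring.
Qed.

Lemma d_laplacian i f : d i (laplacian f) = laplacian (d i f).
Proof.
rewrite /laplacian raddf_sum/=; apply: eq_bigr => j _.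
by rewrite (dC i j) (dC i j f).
Qed.

(** Peeling off one index at a time gives an induction over all pairs of functions; [grad_pairingE]
    and [grad_adjE] return to sums over multi-indices. For fixed [u], the map [grad_adj k _ u] below
    is the formal adjoint of [grad_pairing k u]. *)
Fixpoint grad_pairing k f g : A :=
  if k is k'.+1 then \sum_i grad_pairing k' (d i f) (d i g) else f * g.

Fixpoint grad_adj k f u : A :=
  if k is k'.+1 then - \sum_i d i (grad_adj k' f (d i u)) else f * u.

Lemma grad_pairingMz k c f g :
  grad_pairing k (f *~ c) g = grad_pairing k f g *~ c.
Proof.
elim: k f g => [|k IH] f g /=; first by rewrite mulrzAl.
by rewrite mulrz_suml; apply: eq_bigr => i _; rewrite raddfMz/= IH.
Qed.

Lemma grad_adj_additive k f : zmod_morphism (grad_adj k f).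
Proof.
elim: k f => [|k IH] f g h /=; first exact: mulrBr.
rewrite -opprD -sumrB; congr (- _); apply: eq_bigr => i _.
by rewrite raddfB/= IH raddfB.
Qed.
HB.instance Definition _ k f :=
  GRing.isZmodMorphism.Build A A (grad_adj k f) (@grad_adj_additive k f).

(* Bochner's identity, polarised. *)
Lemma grad_pairingS k f g : 2 * grad_pairing k.+1 f g =
  laplacian (grad_pairing k f g) - grad_pairing k (laplacian f) g
  - grad_pairing k f (laplacian g).
Proof.
elim: k f g => [|k IH] f g; first by rewrite /= laplacianM; ring.
rewrite [grad_pairing _ _ _]/= mulr_sumr (eq_bigr _ (fun i _ => IH _ _)).
rewrite !sumrB -raddf_sum/=.
by congr (_ - _ - _); apply: eq_bigr => i _; rewrite d_laplacian.
Qed.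

(** The transpose of [grad_pairingS]: the Laplacian is self-adjoint, so the outer one moves onto the
    coefficient [f] and the one acting on the free argument becomes the outer one. *)
Lemma grad_adjS k f u : 2 * grad_adj k.+1 f u =
  grad_adj k (laplacian f) u - grad_adj k f (laplacian u)
  - laplacian (grad_adj k f u).
Proof.
elim: k f u => [|k IH] f u.
  have H : \sum_i d i (f * d i u) = \sum_i d i f * d i u + f * laplacian u.
    rewrite /laplacian mulr_sumr -big_split/=; apply: eq_bigr => i _.
    exact: dM.
  rewrite /= laplacianM H.
  by ring.
rewrite [grad_adj _ _ _]/= mulrN mulr_sumr.
have H i : 2 * d i (grad_adj k.+1 f (d i u)) =
    d i (grad_adj k (laplacian f) (d i u))
    - d i (grad_adj k f (d i (laplacian u))) - laplacian (d i (grad_adj k f (d i u))).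
  by rewrite mulr_natl -raddfMn/= -mulr_natl IH !raddfB/= !d_laplacian.
have -> : laplacian (- \sum_i d i (grad_adj k f (d i u))) =
    - \sum_i laplacian (d i (grad_adj k f (d i u))).
  have lN f' : laplacian (- f') = - laplacian f' by exact: raddfN.
  have lS (F : 'I_n -> A) : laplacian (\sum_i F i) = \sum_i laplacian (F i).
    exact: raddf_sum.
  by rewrite lN lS.
rewrite (eq_bigr _ (fun i _ => H i)) !sumrB/=.
by ring.
Qed.

Local Notation L := laplacian.
Variable v : A.
Hypothesis vs : v * s = 1.
Implicit Types w : A.

Lemma sqnormXK m f : v ^+ m * (s ^+ m * f) = f.
Proof. by rewrite mulrA -exprMn vs expr1n mul1r. Qed.

Lemma sqnormVXK m f : s ^+ m * (v ^+ m * f) = f.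
Proof. by rewrite mulrA -exprMn mulrC [s * v]mulrC vs expr1n mulr1. Qed.

Lemma d_sqnormV i : d i v = - 2 * x i * v ^+ 2.
Proof.
have := congr1 (d i) vs; rewrite dM d_sqnorm d1.
move/(congr1 ( *%R v)); rewrite mulr0 mulrDr [v * (_ * s)]mulrCA vs mulr1.
by move/eqP; rewrite addr_eq0 => /eqP ->; ring.
Qed.

Lemma radial_sqnormV : radial v.
Proof.
move=> i; rewrite d_sqnormV /euler.
transitivity (x i * (\sum_j x j ^+ 2 * (- 2 * v ^+ 2))).
  by rewrite -mulr_suml -/s; ring.
by congr (_ * _); apply: eq_bigr => j _; rewrite d_sqnormV; ring.
Qed.

Lemma euler_sqnormV : E v = - 2 * v.
Proof.
rewrite /euler.
transitivity (\sum_j x j ^+ 2 * (- 2 * v ^+ 2)).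
  by apply: eq_bigr => j _; rewrite d_sqnormV; ring.
rewrite -mulr_suml -/s; transitivity (v * s * (- 2 * v)); first by ring.
by rewrite vs mul1r.
Qed.

Lemma euler_sqnormVXM m f : E (v ^+ m * f) = v ^+ m * (E f - (2 * m)%:R * f).
Proof.
rewrite eulerM; suff -> : E (v ^+ m) = - (2 * m)%:R * v ^+ m by ring.
elim: m {f} => [|m IH]; first by rewrite euler1 mulr0n oppr0 mul0r.
by rewrite exprS eulerM IH euler_sqnormV; ring.
Qed.

Lemma euler_sqnormXM m f : E (s ^+ m * f) = s ^+ m * (E f + (2 * m)%:R * f).
Proof.
rewrite eulerM; suff -> : E (s ^+ m) = (2 * m)%:R * s ^+ m by ring.
elim: m {f} => [|m IH]; first by rewrite euler1 mulr0n mul0r.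
by rewrite exprS eulerM IH euler_sqnorm; ring.
Qed.

Lemma laplacian_radial f : radial f -> L f = v * (E (E f) + (n%:R - 2) * E f).
Proof.
by move=> rf; rewrite -(radial_laplacian rf) mulrA vs mul1r.
Qed.

(* [lam 'X] is the symbol of [|x|^2 laplacian] on radial functions, as a
   polynomial in the Euler operator. *)
Definition lam (q : {poly int}) : {poly int} := q * (q + (n%:Z - 2)%:P).

Lemma opoly_lam (e : {additive A -> A}) c g :
  opoly e (lam ('X - c%:P)) g =
  e (e g) - e g *~ (2 * c) + e g *~ (n%:Z - 2) + g *~ (c * (c - (n%:Z - 2))).
Proof.
have -> : lam ('X - c%:P) =
    'X * 'X - (2 * c) *: 'X + (n%:Z - 2) *: 'X + (c * (c - (n%:Z - 2)))%:P.
  by rewrite /lam -!mul_polyC; ring.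
by rewrite !opolyD opolyN !opolyZ opolyMX !opolyX opolyC.
Qed.

Lemma opoly_lamX (e : {additive A -> A}) g :
  opoly e (lam 'X) g = e (e g) + (n%:R - 2) * e g.
Proof.
have -> : lam 'X = lam ('X - 0%:P) by rewrite subr0.
by rewrite opoly_lam; ring.
Qed.

Definition radially_represents k m w (p : {poly int}) := forall g, radial g ->
  2 ^+ k * s ^+ m * grad_pairing k w g = opoly E p g /\
  2 ^+ k * grad_adj k (s ^+ m * g) w = opoly th p g.

(** The three terms are those of Bochner's identity. Conjugation by |x|^(-2m) turns E into E - 2m,
    hence the shift inside [lam]; for radial g one has Delta g = |x|^-2 lam(E) g, and pulling |x|^-2
    out of p(E) leaves p(E - 2). On the adjoint side, E = - n - E' turns the same symbols into the
    same polynomials in E', composed in the opposite order. *)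
Lemma radially_representsS k m w p p' :
  radially_represents k m w p -> radially_represents k m.+1 (L w) p' ->
  radially_represents k.+1 m.+1 w
    (lam ('X - (2 * m)%:Z%:P) * p - p' - lam 'X * (p \Po ('X - 2%:Z%:P))).
Proof.
move=> Hp Hp' g rg.
have rE := radial_euler.
have LMn (a : A) j : L (2 ^+ j * a) = 2 ^+ j * L a.
  by rewrite -natrX !mulr_natl raddfMn.
rewrite !exprS; split.
- have -> : 2 * 2 ^+ k * (s * s ^+ m) * grad_pairing k.+1 w g =
    2 ^+ k * (s * s ^+ m) * (2 * grad_pairing k.+1 w g) by ring.
  rewrite grad_pairingS !opolyD !opolyN [lam 'X * _]mulrC.
  rewrite [opoly _ (lam _ * _) _]opolyM [opoly _ (_ * lam _) _]opolyM.
  rewrite !mulrBr; congr (_ - _ - _).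
  + have [Hg _] := Hp g rg; rewrite -Hg; set b := grad_pairing k w g.
    (* Division by 2 is not possible in [A], so radiality is shown for the multiple that equals
       |x|^(-2m) p(E) g. *)
    have rb : radial (2 ^+ k * b).
      rewrite -(sqnormXK m (_ * b)); apply: radialM.
        exact/radialX/radial_sqnormV.
      rewrite mulrCA mulrA Hg; apply: (@opoly_closed _ _ radial) => //.
      * exact: radial0.
      * exact: radialB.
    have -> : 2 ^+ k * (s * s ^+ m) * L b = s ^+ m * (s * L (2 ^+ k * b)).
      by rewrite LMn; ring.
    rewrite (radial_laplacian rb) opoly_lam/=.
    have -> : 2 ^+ k * s ^+ m * b = s ^+ m * (2 ^+ k * b) by ring.
    rewrite !euler_sqnormXM.
    by rewrite eulerD euler_natl; ring.
  + have [<- _] := Hp' g rg; by rewrite exprS.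
  + rewrite (laplacian_radial rg) opoly_lamX/=.
    set h := E (E g) + _.
    have rh : radial h.
      apply: radialD; first by apply/rE/rE.
      apply: radialM; last exact: rE.
      by apply: radialB; exact: radial_nat.
    have [Hvh _] := Hp (v * h) (radialM radial_sqnormV rh).
    have Ev f : E (v * f) = v * opoly E ('X - 2%:Z%:P) f.
      rewrite opolyD opolyN opolyX opolyC -[v]expr1 euler_sqnormVXM; ring.
    have -> : 2 ^+ k * (s * s ^+ m) * grad_pairing k w (v * h) =
        s * (2 ^+ k * s ^+ m * grad_pairing k w (v * h)) by ring.
    by rewrite Hvh (opolyMl Ev) mulrA [s * v]mulrC vs mul1r.
- have -> : 2 * 2 ^+ k * grad_adj k.+1 (s * s ^+ m * g) w =
    2 ^+ k * (2 * grad_adj k.+1 (s * s ^+ m * g) w) by ring.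
  rewrite grad_adjS !opolyD !opolyN.
  rewrite [opoly _ (lam _ * _) _]opolyM [opoly _ (lam _ * _) _]opolyM.
  rewrite !mulrBr.
  have Eth f : E f = - (n%:R * f) - th f by rewrite euler_adjE; ring.
  have radialth f : radial f -> radial (th f) by exact: radial_euler_adj.
  have -> : L (s * s ^+ m * g) =
      s ^+ m * opoly th (lam ('X - (2 * m)%:Z%:P)) g.
    rewrite laplacian_radial; last first.
      apply: radialM => //; apply: radialM; first exact: radial_sqnorm.
      exact/radialX/radial_sqnorm.
    rewrite -exprS !euler_sqnormXM [_ * (s ^+ _ * _)]mulrCA -mulrDr exprS.
    rewrite -mulrA [LHS]mulrA vs mul1r; congr (_ * _); rewrite opoly_lam/=.
    rewrite eulerD euler_natl !Eth !(euler_adjB, euler_adjN, euler_adj_natl).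
    by ring.
  have Esth f : th (s * f) = s * opoly th ('X - 2%:Z%:P) f.
    rewrite opolyD opolyN opolyX opolyC !euler_adjE -[s]expr1 euler_sqnormXM/=.
    by ring.
  have rs := radial_sqnorm.
  have rop q f : radial f -> radial (opoly th q f).
    by move=> rf; apply: (@opoly_closed _ _ radial) => //;
      [exact: radial0|exact: radialB].
  congr (_ - _ - _).
  - by have [_ ->] := Hp _ (rop (lam ('X - (2 * m)%:Z%:P)) _ rg); rewrite -!opolyM mulrC.
  - by have [_ <-] := Hp' g rg; rewrite exprS.
  - rewrite -LMn.
    have [_] := Hp _ (radialM rs rg).
    rewrite mulrCA mulrA => ->; rewrite (opolyMl Esth).
    have Es f : E (s * f) = s * (E f + 2 * f).
      by rewrite eulerM euler_sqnorm; ring.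
    rewrite laplacian_radial; last exact/radialM/rop.
    rewrite opoly_lamX/= !Es [_ * (s * _)]mulrCA -mulrDr mulrA vs mul1r.
    rewrite eulerD euler_natl !Eth !(euler_adjB, euler_adjN, euler_adj_natl).
    by ring.
Qed.

(** Since Delta |x|^(-2m) = 2m (2m + 2 - n) |x|^(-2m - 2), the Laplacian stays within the powers of
    |x|^-2, and the induction on [k] runs for all [m] at once. *)
Lemma radially_representsX k m : exists p,
  radially_represents k (k + m) (v ^+ m) p.
Proof.
elim: k m => [|k IH] m.
  exists 1 => g rg; rewrite !add0n !opoly1 !expr0 !mul1r /=.
  by split; [exact: sqnormVXK|rewrite mulrC; exact: sqnormXK].
have [p Hp] := IH m; have [p' Hp'] := IH m.+1.
have Lv : L (v ^+ m) = v ^+ m.+1 *~ (2 * m%:Z * (2 * m%:Z + 2 - n%:Z)).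
  rewrite laplacian_radial; last exact/radialX/radial_sqnormV.
  have Ev c : E (c%:R * v ^+ m) = - (2 * m)%:R * (c%:R * v ^+ m).
    by rewrite mulrC euler_sqnormVXM euler_nat; ring.
  have := Ev 1%N; rewrite mul1r => ->.
  by rewrite mulNr raddfN/= Ev exprS; ring.
eexists; rewrite addSn; apply: radially_representsS; first exact: Hp.
move=> g rg; have [H1 H2] := Hp' g rg.
rewrite Lv grad_pairingMz raddfMz/= mulrzAr mulrzAr -addnS H1 H2.
by rewrite -!opolyZ; split; reflexivity.
Qed.

Variable u : A.
Hypothesis du : forall i, d i u = x i * v.

Lemma euler_log : E u = 1.
Proof.
rewrite /euler -[RHS]vs mulrC mulr_suml; apply: eq_bigr => i _.
by rewrite du expr2 mulrA.
Qed.

Lemma radial_log : radial u.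
Proof. by move=> i; rewrite euler_log du mulrC -mulrA vs. Qed.

(** The induction starts at [k = 1] with [p = 2 X], because multiplication by u is not a polynomial
    in E. Each step feeds in the representation for Delta u, an integer multiple of |x|^-2. *)
Lemma radially_represents_log k : (0 < k)%N ->
  exists p, radially_represents k k u p.
Proof.
case: k => // k _; elim: k => [|k [p Hp]].
  exists (2 *: 'X) => g rg; rewrite !opolyZ !opolyX !expr1/=; split.
    have -> : \sum_i d i u * d i g = v * E g.
      by rewrite /euler mulr_sumr; apply: eq_bigr => i _; rewrite du; ring.
    by rewrite -mulrA [s * _]mulrA [s * v]mulrC vs; ring.
  have -> : - \sum_i d i (s * g * d i u) = th g.
    congr (- _); apply: eq_bigr => i _; congr (d i _).
    transitivity (v * s * (x i * g)); first by rewrite du; ring.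
    by rewrite vs mul1r.
  by ring.
have [p' Hp'] := radially_representsX k.+1 1.
eexists; apply: radially_representsS; first exact: Hp.
move=> g rg; have [] := Hp' g rg; rewrite addn1 expr1.
have -> : L u = v *~ (n%:Z - 2).
  by rewrite (laplacian_radial radial_log) euler_log euler1; ring.
rewrite grad_pairingMz raddfMz/= !mulrzAr => -> ->.
by rewrite -!opolyZ; split; reflexivity.
Qed.

Lemma grad_pairing_k1 k f : (0 < k)%N -> grad_pairing k f 1 = 0.
Proof.
case: k => // k _; rewrite /=; apply: big1 => i _; rewrite d1.
elim: k (d i f) => [|k IH] g /=; first by rewrite mulr0.
by apply: big1 => j _; rewrite raddf0 IH.
Qed.

Lemma opoly_euler1 p : opoly E p 1 = (p`_0)%:~R.
Proof.
rewrite (@opolyE _ _ _ _ (size p).+1) ?leqnSn// big_ord_recl big1 ?addr0//.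
move=> i _; rewrite (_ : iter _ _ _ = 0) ?mul0rz//.
by rewrite lift0 iterSr euler1; elim: (i : nat) => //= j ->; rewrite raddf0.
Qed.

Lemma opoly_euler_log p : opoly E p u = u *~ p`_0 + (p`_1)%:~R.
Proof.
have iterE j : iter j.+2 E u = 0.
  rewrite !iterSr euler_log euler1.
  by elim: j => //= j ->; rewrite raddf0.
rewrite (@opolyE _ _ _ _ (size p).+2); last exact/leqW/leqW.
rewrite 2!big_ord_recl big1 => [|i _]; last by rewrite !lift0 iterE mul0rz.
by rewrite /= addr0 euler_log.
Qed.

Definition dseq (I : seq 'I_n) f : A := foldr (fun i => d i : A -> A) f I.

Lemma dseqC i I f : dseq I (d i f) = d i (dseq I f).
Proof. by elim: I => //= j I ->; rewrite dC. Qed.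

Lemma big_tuple0 (T : finType) (F : 0.-tuple T -> A) :
  \sum_(t : 0.-tuple T) F t = F [tuple].
Proof.
rewrite (bigD1 [tuple])//= big1 ?addr0// => t /eqP[].
exact: tuple0.
Qed.

Lemma big_tupleS (T : finType) k (F : k.+1.-tuple T -> A) :
  \sum_(t : k.+1.-tuple T) F t = \sum_i \sum_(t : k.-tuple T) F [tuple of i :: t].
Proof.
rewrite pair_big/= (reindex (fun z : T * k.-tuple T => [tuple of z.1 :: z.2]))//.
exists (fun t : k.+1.-tuple T => (thead t, [tuple of behead t])) => [[i t] _|t _].
  by congr pair; apply/val_inj.
by rewrite -tuple_eta.
Qed.

Lemma grad_pairingE k f g :
  grad_pairing k f g = \sum_(I : k.-tuple 'I_n) dseq I f * dseq I g.
Proof.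
elim: k f g => [|k IH] f g /=; first by rewrite big_tuple0.
rewrite big_tupleS; apply: eq_bigr => i _; rewrite IH.
by apply: eq_bigr => I _; rewrite !dseqC.
Qed.

Lemma grad_adjE k f g :
  grad_adj k f g = (-1) ^+ k * \sum_(I : k.-tuple 'I_n) dseq I (f * dseq I g).
Proof.
elim: k f g => [|k IH] f g /=; first by rewrite big_tuple0 mul1r.
rewrite big_tupleS exprS mulN1r mulNr; congr (- _).
rewrite mulr_sumr; apply: eq_bigr => i _; rewrite IH.
have -> : d i ((-1) ^+ k * \sum_(I : k.-tuple 'I_n) dseq I (f * dseq I (d i g))) =
    (-1) ^+ k * d i (\sum_(I : k.-tuple 'I_n) dseq I (f * dseq I (d i g))).
  by rewrite -signr_odd; case: (odd k); rewrite ?mulN1r ?mul1r ?raddfN.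
by rewrite raddf_sum/=; under eq_bigr do rewrite dseqC.
Qed.

(** Testing on [g = 1], all of whose derivatives vanish, isolates p_0. It is only shown to vanish in
    [A], into which the integers need not embed. *)
Lemma radial_log_expansion k : (0 < k)%N -> exists p : {poly int},
  [/\ (p`_0)%:~R = 0 :> A,
      2 ^+ k * s ^+ k * \sum_(I : k.-tuple 'I_n) dseq I u ^+ 2 = (p`_1)%:~R &
      forall g, radial g -> 2 ^+ k *
        ((-1) ^+ k * \sum_(I : k.-tuple 'I_n) dseq I (s ^+ k * g * dseq I u)) =
        opoly th p g].
Proof.
move=> k0; have [p Hp] := radially_represents_log k0; exists p.
have p0 : (p`_0)%:~R = 0 :> A.
  have [] := Hp 1 radial1.
  by rewrite grad_pairing_k1// mulr0 opoly_euler1 => ->.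
split=> // [|g rg].
  have [] := Hp u radial_log.
  rewrite grad_pairingE opoly_euler_log -mulrzr p0 mulr0 add0r => <- _.
  by under eq_bigr do rewrite expr2.
by have [_ <-] := Hp g rg; rewrite grad_adjE.
Qed.

End differential_ring.

(** * Smooth functions *)

Section smooth_on.
Context {R : realType} {N : nat}.
Implicit Types (f g : 'rV[R]_N -> R) (U : set 'rV[R]_N) (x a : 'rV[R]_N).
Local Notation e i := (delta_mx 0 i : 'rV[R]_N).

Record smooth_on U f : Prop := SmoothOn {
  smooth_onP : forall (s : seq 'I_N) x, U x ->
    {for x, continuous (partials s f)} /\
    forall i, derivable (partials s f) x (e i) }.

Lemma smooth_onT f : smooth f <-> smooth_on setT f.
Proof.
split=> [sf|[sf] s].
  constructor=> s x _; have [cf df] := sf s.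
  by split=> [|i]; [exact: cf|exact: df].
by split=> [x|i x]; have [] := sf s x I.
Qed.

Lemma smooth_on_continuous U f x : smooth_on U f -> U x ->
  {for x, continuous f}.
Proof. by case=> sf Ux; have [? _] := sf [::] x Ux. Qed.

Lemma smooth_on_derivable U f x i : smooth_on U f -> U x -> derivable f x (e i).
Proof. by case=> sf Ux; have [_] := sf [::] x Ux; apply. Qed.

(** Smoothness as a greatest fixed point: a property stable under partial derivatives propagates
    along every sequence of indices. *)
Lemma smooth_on_coind U (Q : ('rV[R]_N -> R) -> Prop) :
  (forall f, Q f -> (forall x, U x ->
     {for x, continuous f} /\ forall i, derivable f x (e i)) /\
     forall i, Q (partial i f)) ->
  forall f, Q f -> smooth_on U f.
Proof.
move=> HQ f Qf; constructor=> s; have : Q (partials s f).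
  by elim: s => //= i s IH; have [_] := HQ _ IH; apply.
by move/HQ => [+ _] x Ux; apply.
Qed.

Lemma smooth_on_subset U V f : U `<=` V -> smooth_on V f -> smooth_on U f.
Proof. by move=> UV [sf]; constructor=> s x /UV; exact: sf. Qed.

Lemma smooth_on_partial U f i : smooth_on U f -> smooth_on U (partial i f).
Proof.
case=> sf; constructor=> s x Ux; have := sf (rcons s i) x Ux.
by rewrite /partials foldr_rcons.
Qed.

Lemma smooth_on_partials U f s : smooth_on U f -> smooth_on U (partials s f).
Proof.
move=> sf; elim: s => [|i s IH]; first exact: sf.
exact: (smooth_on_partial i IH).
Qed.

Lemma eq_on_partial U f g i x : open U -> {in U, f =1 g} -> U x ->
  partial i f x = partial i g x.
Proof.
move=> oU fg Ux; apply: near_eq_derive.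
by have := open_nbhs_nbhs (conj oU Ux); apply: filterS => y Uy; apply/fg/mem_set.
Qed.

Lemma eq_on_partials U f g s x : open U -> {in U, f =1 g} -> U x ->
  partials s f x = partials s g x.
Proof.
move=> oU fg; elim: s x => [|i s IH] x Ux /=; first exact/fg/mem_set.
by apply: (eq_on_partial i oU _ Ux) => y /set_mem; exact: IH.
Qed.

(** The algebra spanned by [B] and the constants, modulo equality on [U], so that a derivative may
    be given by a formula valid on [U] only. *)
Inductive generated U (B : ('rV[R]_N -> R) -> Prop) : ('rV[R]_N -> R) -> Prop :=
| gen_base f : B f -> generated U B f
| gen_cst c : generated U B (cst c)
| genD f g : generated U B f -> generated U B g -> generated U B (f \+ g)
| genM f g : generated U B f -> generated U B g -> generated U B (f \* g)
| gen_eq f g : {in U, f =1 g} -> generated U B f -> generated U B g.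

(** By the Leibniz rule, [generated U B] is itself the property stable under derivatives; only the
    members of [B] have to be examined. *)
Lemma smooth_on_generated U B : open U ->
  (forall f, B f -> (forall x, U x ->
     {for x, continuous f} /\ forall i, derivable f x (e i)) /\
     forall i, generated U B (partial i f)) ->
  forall f, generated U B f -> smooth_on U f.
Proof.
move=> oU HB; apply: smooth_on_coind => f.
elim=> {f} [f /HB //|c|f g Gf [cf pf] Gg [cg pg]|f g Gf [cf pf] Gg [cg pg]|].
- split=> [x _|i]; first by split=> [|i]; [exact: cst_continuous|].
  rewrite (_ : partial i (cst c) = cst 0); first exact: gen_cst.
  by apply/funext => x; exact: derive_cst.
- split=> [x Ux|i].
    have [? df] := cf x Ux; have [? dg] := cg x Ux.
    by split=> [|i]; [exact: continuousD|exact: derivableD].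
  apply: (@gen_eq _ _ (partial i f \+ partial i g)); last exact: genD.
  move=> x /set_mem Ux; have [_ df] := cf x Ux; have [_ dg] := cg x Ux.
  by rewrite /partial deriveD.
- split=> [x Ux|i].
    have [? df] := cf x Ux; have [? dg] := cg x Ux.
    by split=> [|i]; [exact: continuousM|exact: derivableM].
  apply: (@gen_eq _ _ (f \* partial i g \+ g \* partial i f)); last first.
    by apply: genD; exact: genM.
  move=> x /set_mem Ux; have [_ df] := cf x Ux; have [_ dg] := cg x Ux.
  by rewrite /partial deriveM.
- move=> f g fg Gf [cf pf].
  have nfg x : U x -> \forall y \near x, f y = g y.
    move=> Ux; have := open_nbhs_nbhs (conj oU Ux).
    by apply: filterS => y Uy; apply/fg/mem_set.
  split=> [x Ux|i].
    have [cfx dfx] := cf x Ux; split=> [|i].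
      have fgx : f x = g x by apply/fg/mem_set.
      have gf : g @ x `=>` f @ x.
        exact: (@near_eq_cvg _ _ (nbhs x) _ f g (nfg x Ux)).
      suff : g @ x --> g x by [].
      by rewrite -fgx; exact: cvg_trans gf cfx.
    exact: near_eq_derivable (nfg _ Ux) (dfx i).
  apply: gen_eq (pf i) => x /set_mem Ux; exact: (eq_on_partial i oU fg Ux).
Qed.

Lemma smooth_on_gen U f : open U -> generated U (smooth_on U) f -> smooth_on U f.
Proof.
move=> oU; apply: smooth_on_generated => // {}f sf; split=> [x Ux|i].
  by case: sf => /(_ [::]); apply.
exact/gen_base/smooth_on_partial.
Qed.

Lemma smooth_onD U f g : open U -> smooth_on U f -> smooth_on U g ->
  smooth_on U (f \+ g).
Proof. by move=> oU sf sg; apply: smooth_on_gen => //; apply: genD; exact: gen_base. Qed.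

Lemma smooth_onM U f g : open U -> smooth_on U f -> smooth_on U g ->
  smooth_on U (f \* g).
Proof. by move=> oU sf sg; apply: smooth_on_gen => //; apply: genM; exact: gen_base. Qed.

Lemma smooth_on_cst U c : open U -> smooth_on U (cst c).
Proof. by move=> oU; apply: smooth_on_gen => //; exact: gen_cst. Qed.

Lemma smooth_on_eq U f g : open U -> {in U, f =1 g} -> smooth_on U f ->
  smooth_on U g.
Proof. by move=> oU fg sf; apply: smooth_on_gen => //; apply: gen_eq fg (gen_base _ _). Qed.

Lemma smooth_onN U f : open U -> smooth_on U f -> smooth_on U (\- f).
Proof.
move=> oU sf; apply: (@smooth_on_eq _ (cst (-1) \* f)) => //.
  by move=> x _ /=; rewrite mulN1r.
by apply: smooth_onM => //; exact: smooth_on_cst.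
Qed.

Lemma smooth_on_sum U (J : Type) (r : seq J) (P : pred J) (F : J -> 'rV[R]_N -> R) :
  open U -> (forall j, smooth_on U (F j)) ->
  smooth_on U (fun x => \sum_(j <- r | P j) F j x).
Proof.
move=> oU sF; elim: r => [|j r IH].
  by apply: (@smooth_on_eq _ (cst 0)) => [//|x _|]; rewrite ?big_nil//; exact: smooth_on_cst.
apply: (@smooth_on_eq _ ((if P j then F j else cst 0) \+ (fun x => \sum_(j <- r | P j) F j x))) => //.
  by move=> x _ /=; rewrite big_cons; case: ifP => // _; rewrite add0r.
by apply: smooth_onD => //; case: ifP => // _; exact: smooth_on_cst.
Qed.

Lemma partialM U f g i x : smooth_on U f -> smooth_on U g -> U x ->
  partial i (f \* g) x = f x * partial i g x + g x * partial i f x.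
Proof.
move=> sf sg Ux; rewrite /partial deriveM//; exact: smooth_on_derivable Ux.
Qed.

Lemma partialD U f g i x : smooth_on U f -> smooth_on U g -> U x ->
  partial i (f \+ g) x = partial i f x + partial i g x.
Proof.
move=> sf sg Ux; rewrite /partial deriveD//; exact: smooth_on_derivable Ux.
Qed.

Lemma partial_sum U (J : Type) (r : seq J) (P : pred J)
    (F : J -> 'rV[R]_N -> R) i x : open U -> (forall j, smooth_on U (F j)) -> U x ->
  partial i (fun y => \sum_(j <- r | P j) F j y) x =
  \sum_(j <- r | P j) partial i (F j) x.
Proof.
move=> oU sF Ux; elim: r => [|j r IH].
  rewrite big_nil (_ : (fun y => _) = cst 0); first exact: derive_cst.
  by apply/funext => y; rewrite big_nil.
have -> : (fun y => \sum_(k <- j :: r | P k) F k y) =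
    (if P j then F j else cst 0) \+ (fun y => \sum_(k <- r | P k) F k y).
  by apply/funext => y /=; rewrite big_cons; case: ifP => // _; rewrite add0r.
rewrite (partialD i _ (smooth_on_sum _ _ oU sF) Ux); last first.
  by case: ifP => // _; exact: smooth_on_cst.
rewrite IH big_cons; case: ifP => // _.
by rewrite [partial i (cst 0) x](derive_cst (0 : R)) add0r.
Qed.

Lemma partialN U f i x : smooth_on U f -> U x ->
  partial i (\- f) x = - partial i f x.
Proof. by move=> sf Ux; rewrite /partial deriveN//; exact: smooth_on_derivable Ux. Qed.

Lemma is_derive_coord i x v : is_derive x v (fun y : 'rV[R]_N => y 0 i) (v 0 i).
Proof.
have lin : linear (fun y : 'rV[R]_N => y 0 i : R) by move=> k u w; rewrite !mxE.
pose linM := GRing.isLinear.Build _ _ _ _ _ lin.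
pose f : {linear 'rV[R]_N -> R} := HB.pack (fun y : 'rV[R]_N => y 0 i : R) linM.
have cf : continuous f by exact: coord_continuous.
apply: (@DeriveDef _ _ _ _ _ f).
  exact/diff_derivable/linear_differentiable.
by rewrite deriveE ?diff_lin//; exact: linear_differentiable.
Qed.

Lemma smooth_on_coord U i : open U -> smooth_on U (fun x => x 0 i).
Proof.
move=> oU; apply: (@smooth_on_generated _ [set f | f = (fun x => x 0 i)]) => //.
  move=> _ ->; split=> [x Ux|j].
    split=> [|j]; first exact: coord_continuous.
    by have [] := is_derive_coord i x (e j).
  rewrite (_ : partial _ _ = cst (e j 0 i)); first exact: gen_cst.
  by apply/funext => x; have [_] := is_derive_coord i x (e j).
exact: gen_base.
Qed.

Lemma partial_coord i j x : partial i (fun x => x 0 j) x = (i == j)%:R.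
Proof.
by have [_] := is_derive_coord j x (e i); rewrite mxE eqxx eq_sym.
Qed.

(** The two difference quotients are the same function of the increment. This reduces directional
    derivatives to calculus in one variable. *)
Lemma is_derive_lineP f a (v : 'rV[R]_N) (h df : R) :
  is_derive h 1 (fun t : R => f (a + t *: v)) df <->
  is_derive (a + h *: v) v f df.
Proof.
set g := fun t : R => f _.
have H : (fun t : R => t^-1 *: ((f \o shift (a + h *: v)) (t *: v) - f (a + h *: v)))
       = (fun t : R => t^-1 *: ((g \o shift h) (t *: 1) - g h)).
  apply/funext => t; rewrite /g /=; congr (_ *: (f _ - _)).
  by rewrite -[t *: 1]/(t * 1) mulr1 scalerDl addrCA.
by split=> -[]; rewrite /derivable /derive ?H => ? ?; split; rewrite /derivable /derive ?H.
Qed.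

Lemma is_derive_line f a (v : 'rV[R]_N) (h : R) : derivable f (a + h *: v) v ->
  is_derive h 1 (fun t : R => f (a + t *: v)) ('D_v f (a + h *: v)).
Proof. by move=> df; apply/is_derive_lineP; exact: derivableP. Qed.

(** Only derivability of [f] along [v] is available, not differentiability; the chain rule in one
    variable is therefore applied on the line through [x] with direction [v]. *)
Lemma is_derive_comp (phi : R -> R) f x (v : 'rV[R]_N) (dphi df : R) :
  is_derive (f x) 1 phi dphi -> is_derive x v f df ->
  is_derive x v (phi \o f) (dphi * df).
Proof.
move=> Dphi Df; pose g (t : R) := f (x + t *: v).
have Dg : is_derive (0 : R) 1 g df.
  by apply/is_derive_lineP; rewrite scale0r addr0.
have Dphi' : is_derive (g 0) 1 phi dphi by rewrite /g scale0r addr0.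
have D := is_derive1_comp Dphi' Dg.
have /(@is_derive_lineP (phi \o f) x v 0) := D.
by rewrite scale0r addr0.
Qed.

(** Meant for solutions of polynomial differential systems: for v = |x|^-2, for instance, d_i v = -
    2 x_i v^2 is a polynomial in v and the coordinates. *)
Lemma smooth_on_atom U f : open U ->
  (forall x, U x -> {for x, continuous f}) ->
  (forall x i, U x -> derivable f x (e i)) ->
  (forall i, generated U (fun g => g = f \/ smooth_on U g) (partial i f)) ->
  smooth_on U f.
Proof.
move=> oU cf df pf.
apply: (@smooth_on_generated _ (fun g => g = f \/ smooth_on U g)) => //; last first.
  by apply: gen_base; left.
move=> g [->|sg]; first by split=> [x Ux|//]; split=> [|i]; [exact: cf|exact: df].
split=> [x Ux|i].
  by split=> [|i]; [exact: smooth_on_continuous Ux|exact: smooth_on_derivable Ux].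
by apply: gen_base; right; exact: smooth_on_partial.
Qed.

(* The second difference of [f] on a small square, computed by the mean value
   theorem in one order. *)
Lemma second_difference U f i j x (r t : R) : smooth_on U f ->
  ball x r `<=` U -> 0 < t -> 2 * t < r ->
  exists2 y, ball x r y & f (x + t *: e j + t *: e i) - f (x + t *: e i)
    - (f (x + t *: e j) - f x) = t ^+ 2 * partial j (partial i f) y.
Proof.
move=> sf xU t0 tr.
have norm_e k : `|e k| <= 1.
  rewrite [`|_|]mx_normrE; apply/bigmax_leP; split=> // -[a b] _ /=.
  by rewrite mxE; case: (_ && _); rewrite ?normr1 ?normr0.
have inball p q : 0 <= p <= t -> 0 <= q <= t -> ball x r (x + q *: e j + p *: e i).
  move=> /andP[p0 pt] /andP[q0 qt].
  rewrite -ball_normE /= -addrA opprD addrA subrr sub0r normrN.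
  rewrite (le_lt_trans (ler_normD _ _))// !normrZ !ger0_norm//.
  rewrite (le_lt_trans _ tr)// mulr2n mulrDl mul1r lerD//.
    by rewrite (le_trans _ qt)// ler_piMr.
  by rewrite (le_trans _ pt)// ler_piMr.
have t00 : 0 <= (0 : R) <= t by rewrite lexx ltW.
have tt : 0 <= t <= t by rewrite lexx ltW.
pose G (h : R) := f (x + t *: e j + h *: e i) - f (x + h *: e i).
pose dG (h : R) := partial i f (x + t *: e j + h *: e i) - partial i f (x + h *: e i).
have GdG h : 0 <= h <= t -> is_derive h 1 G (dG h).
  move=> h0t; apply: is_deriveB; apply: is_derive_line.
    exact: (smooth_on_derivable sf (xU _ (inball _ _ h0t tt))).
  apply: (smooth_on_derivable sf); apply: xU.
  by have := inball h 0 h0t t00; rewrite scale0r addr0.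
have [c cI Gc] : exists2 c, c \in `]0, t[ & G t - G 0 = dG c * (t - 0).
  apply: (MVT t0) => [h hI|]; first by apply: GdG; rewrite !ltW ?(itvP hI).
  apply: derivable_within_continuous => h hI.
  by have [] := GdG h; rewrite ?(itvP hI).
have c0t : 0 <= c <= t by rewrite !ltW// (itvP cI).
pose H (q : R) := partial i f (x + c *: e i + q *: e j).
have HdH q : 0 <= q <= t -> is_derive q 1 H (partial j (partial i f) (x + c *: e i + q *: e j)).
  move=> q0t; apply: is_derive_line.
  apply: (smooth_on_derivable (smooth_on_partial i sf)).
  by apply: xU; rewrite addrAC; exact: inball.
have [d dI Hd] : exists2 d, d \in `]0, t[ &
    H t - H 0 = partial j (partial i f) (x + c *: e i + d *: e j) * (t - 0).
  apply: (MVT t0) => [h hI|]; first by apply: HdH; rewrite !ltW ?(itvP hI).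
  apply: derivable_within_continuous => h hI.
  by have [] := HdH h; rewrite ?(itvP hI).
exists (x + c *: e i + d *: e j).
  by rewrite addrAC; apply: inball => //; rewrite !ltW// (itvP dI).
move: Gc Hd; rewrite /G /H !scale0r !addr0 !subr0 => -> Hd.
by rewrite /dG addrAC Hd; ring.
Qed.

(** The second difference is symmetric in the two directions, so the two mixed derivatives agree
    when taken at two suitable points close to [x]; their continuity brings both points to [x]. *)
Lemma partialC U f i j x : open U -> smooth_on U f -> U x ->
  partial i (partial j f) x = partial j (partial i f) x.
Proof.
move=> oU sf Ux; apply/eqP; rewrite -subr_eq0 -normr_le0; apply/ler_addgt0Pl => eps eps0.
rewrite addr0.
have e20 : 0 < eps / 2 by rewrite divr_gt0.
have cont k l : \forall y \near x, `|partial k (partial l f) x - partial k (partial l f) y| < eps / 2.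
  have [+ _] := smooth_onP sf [:: k; l] Ux.
  by move=> /cvgrPdist_lt; apply.
pose D k l := [set y | `|partial k (partial l f) x - partial k (partial l f) y| < eps / 2].
have : nbhs x (U `&` (D i j `&` D j i)).
  apply: filterI; first exact: open_nbhs_nbhs.
  by apply: filterI; exact: cont.
move=> /nbhs_ballP[r r0 Hr].
have xU : ball x r `<=` U by move=> y /Hr[].
have t0 : 0 < r / 4 by rewrite divr_gt0.
have tr : 2 * (r / 4) < r by lra.
have [y1 /Hr[_ [_ H1]] E1] := second_difference i j sf xU t0 tr.
have [y2 /Hr[_ [H2 _]] E2] := second_difference j i sf xU t0 tr.
have t2 : (r / 4) ^+ 2 != 0 by rewrite expf_neq0// gt_eqF.
have swap (a b c d : R) : a - b - (c - d) = a - c - (b - d) by ring.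
have close (a b p q : R) : a = b -> `|p - b| < eps / 2 -> `|q - a| < eps / 2 ->
    `|p - q| <= eps.
  move=> -> pb qb; rewrite [leRHS](splitr eps) (le_trans (ler_distD b _ _))//.
  by rewrite lerD ?ltW// distrC.
apply: close _ H2 H1; apply: (mulfI t2).
refine (etrans (esym E1) (etrans (swap _ _ _ _) (etrans _ E2))).
by congr (_ - _ - _); congr f; exact: addrAC.
Qed.

Definition eulerf f x : R := \sum_i x 0 i * partial i f x.

Definition euler_adjf f x : R := - \sum_i partial i (fun y => y 0 i * f y) x.

End smooth_on.

(** * The ring of smooth functions on the punctured space *)

Section punctured_smooth_ring.
Context {R : realType} {n : nat}.
Local Notation V := 'rV[R]_n.+1.
Implicit Types (f g : V -> R) (x : V).

Definition punctured : set V := [set x | x != 0].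

Lemma open_punctured : open punctured.
Proof.
rewrite (_ : punctured = ~` [set 0]).
  exact/closed_openC/accessible_closed_set1/hausdorff_accessible/norm_hausdorff.
by apply/seteqP; split=> x /= /eqP.
Qed.

(* Smooth functions on [R^n \ {0}], normalised at the origin so that equality
   is equality of functions. *)
Record pfun := PFun { pfun_val :> V -> R;
  pfun_smooth : smooth_on punctured pfun_val; pfun_0 : pfun_val 0 = 0 }.

HB.instance Definition _ := gen_eqMixin pfun.
HB.instance Definition _ := gen_choiceMixin pfun.

Lemma pfunP (a b : pfun) : (forall x, x != 0 -> a x = b x) -> a = b.
Proof.
case: a b => [f sf f0] [g sg g0] /= fg.
have {}fg : f = g.
  by apply/funext => x; have [->|/fg//] := eqVneq x 0; rewrite f0.
by subst g; congr PFun; exact: Prop_irrelevance.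
Qed.

Definition puncture f x : R := if x == 0 then 0 else f x.

Lemma puncture_eq f : {in punctured, f =1 puncture f}.
Proof. by move=> x /set_mem /= x0; rewrite /puncture (negPf x0). Qed.

Lemma punctureE f x : x != 0 -> puncture f x = f x.
Proof. by move=> x0; rewrite /puncture (negPf x0). Qed.

Lemma smooth_puncture f : smooth_on punctured f -> smooth_on punctured (puncture f).
Proof. exact: (smooth_on_eq open_punctured (@puncture_eq f)). Qed.

Lemma puncture_0 f : puncture f 0 = 0.
Proof. by rewrite /puncture eqxx. Qed.

Definition pfun_of f (sf : smooth_on punctured f) : pfun :=
  PFun (smooth_puncture sf) (puncture_0 f).

Definition pfun_zero : pfun := pfun_of (smooth_on_cst 0 open_punctured).
Definition pfun_one : pfun := pfun_of (smooth_on_cst 1 open_punctured).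
Definition pfun_add (a b : pfun) : pfun :=
  pfun_of (smooth_onD open_punctured (pfun_smooth a) (pfun_smooth b)).
Definition pfun_mul (a b : pfun) : pfun :=
  pfun_of (smooth_onM open_punctured (pfun_smooth a) (pfun_smooth b)).
Definition pfun_opp (a : pfun) : pfun :=
  pfun_of (smooth_onN open_punctured (pfun_smooth a)).
Definition pfun_partial (i : 'I_n.+1) (a : pfun) : pfun :=
  pfun_of (smooth_on_partial i (pfun_smooth a)).

Let addA : associative pfun_add.
Proof. by move=> a b c; apply: pfunP => x x0 /=; rewrite !(punctureE _ x0)/= !(punctureE _ x0)/= addrA. Qed.
Let addC : commutative pfun_add.
Proof. by move=> a b; apply: pfunP => x x0 /=; rewrite !(punctureE _ x0)/= addrC. Qed.
Let add0 : left_id pfun_zero pfun_add.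
Proof. by move=> a; apply: pfunP => x x0 /=; rewrite !(punctureE _ x0)/= !(punctureE _ x0)/= add0r. Qed.
Let addN : left_inverse pfun_zero pfun_opp pfun_add.
Proof. by move=> a; apply: pfunP => x x0 /=; rewrite !(punctureE _ x0)/= !(punctureE _ x0)/= addNr. Qed.

HB.instance Definition _ := GRing.isZmodule.Build pfun addA addC add0 addN.

Let mulA : associative pfun_mul.
Proof. by move=> a b c; apply: pfunP => x x0 /=; rewrite !(punctureE _ x0)/= !(punctureE _ x0)/= mulrA. Qed.
Let mulC : commutative pfun_mul.
Proof. by move=> a b; apply: pfunP => x x0 /=; rewrite !(punctureE _ x0)/= mulrC. Qed.
Let mul1 : left_id pfun_one pfun_mul.
Proof. by move=> a; apply: pfunP => x x0 /=; rewrite !(punctureE _ x0)/= !(punctureE _ x0)/= mul1r. Qed.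
Let mulD : left_distributive pfun_mul pfun_add.
Proof. by move=> a b c; apply: pfunP => x x0 /=; rewrite !(punctureE _ x0)/= !(punctureE _ x0)/= mulrDl. Qed.
(** The vector of ones belongs to the punctured space; this is where the dimension has to be
    positive, hence the form [n.+1]. *)
Let one_neq0 : pfun_one != 0.
Proof.
apply/eqP => /(congr1 (fun a : pfun => a (const_mx 1))) /=.
rewrite !punctureE//=; first exact/eqP/oner_neq0.
all: by apply/eqP => /matrixP /(_ 0 0); rewrite !mxE; exact/eqP/oner_neq0.
Qed.

HB.instance Definition _ :=
  GRing.Zmodule_isComNzRing.Build pfun mulA mulC mul1 mulD one_neq0.

Lemma pfunD (a b : pfun) x : (a + b : pfun) x = a x + b x.
Proof.
by have [->|x0] := eqVneq x 0; [rewrite !pfun_0 addr0|exact: punctureE].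
Qed.

Lemma pfunM (a b : pfun) x : (a * b : pfun) x = a x * b x.
Proof.
by have [->|x0] := eqVneq x 0; [rewrite !pfun_0 mulr0|exact: punctureE].
Qed.

Lemma pfunN (a : pfun) x : (- a : pfun) x = - a x.
Proof.
by have [->|x0] := eqVneq x 0; [rewrite !pfun_0 oppr0|exact: punctureE].
Qed.

Lemma pfun1 x : x != 0 -> (1 : pfun) x = 1.
Proof. exact: punctureE. Qed.

Lemma pfun_zeroE x : (0 : pfun) x = 0.
Proof. by have [->|x0] := eqVneq x 0; [exact: pfun_0|exact: punctureE]. Qed.

Lemma pfun_partial_additive i : zmod_morphism (pfun_partial i).
Proof.
move=> a b; apply: pfunP => x x0; rewrite pfunD pfunN /= !(punctureE _ x0).
have E : {in punctured, (a - b : pfun) =1 (a \+ \- b)}.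
  by move=> y _; rewrite pfunD pfunN.
rewrite (eq_on_partial i open_punctured E x0).
rewrite (partialD _ (pfun_smooth a) (smooth_onN open_punctured (pfun_smooth b)) x0).
by rewrite (partialN _ (pfun_smooth b)).
Qed.

HB.instance Definition _ i := GRing.isZmodMorphism.Build pfun pfun
  (pfun_partial i) (pfun_partial_additive i).

Lemma pfun_partialM i (a b : pfun) :
  pfun_partial i (a * b) = pfun_partial i a * b + a * pfun_partial i b.
Proof.
apply: pfunP => x x0; rewrite pfunD !pfunM /= !(punctureE _ x0).
have E : {in punctured, (a * b : pfun) =1 (a \* b)} by move=> y _; rewrite pfunM.
rewrite (eq_on_partial i open_punctured E x0).
rewrite (partialM _ (pfun_smooth a) (pfun_smooth b) x0) addrC.
by rewrite [b x * _]mulrC.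
Qed.

Lemma pfun_partialC i j (a : pfun) :
  pfun_partial i (pfun_partial j a) = pfun_partial j (pfun_partial i a).
Proof.
have E k x : x != 0 -> pfun_partial k a x = partial k a x by exact: punctureE.
have EE k l x : x != 0 ->
    pfun_partial k (pfun_partial l a) x = partial k (partial l a) x.
  move=> x0; apply: etrans (punctureE _ x0) _.
  by apply: (eq_on_partial k open_punctured _ x0) => y /set_mem; exact: E.
apply: pfunP => x x0; refine (etrans (EE i j x x0) (etrans _ (esym (EE j i x x0)))).
exact: (@partialC _ _ punctured a i j x open_punctured (pfun_smooth a) x0).
Qed.

Lemma pfun_partialE i (a : pfun) x : x != 0 -> pfun_partial i a x = partial i a x.
Proof. exact: punctureE. Qed.

Lemma dseqE s (a : pfun) x : x != 0 ->
  dseq (fun i => pfun_partial i) s a x = partials s a x.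
Proof.
elim: s x => [//|i s IH] x x0 /=; rewrite (punctureE _ x0).
by apply: (eq_on_partial i open_punctured _ x0) => y /set_mem; exact: IH.
Qed.

End punctured_smooth_ring.

(** * The Euclidean norm and its smooth approximations *)

Section euclidean_norm.
Context {R : realType} {N : nat}.
Implicit Types x : 'rV[R]_N.

Definition enorm2 x : R := \sum_i x 0 i ^+ 2.

Lemma enorm2_ge0 x : 0 <= enorm2 x.
Proof. by apply: sumr_ge0 => i _; exact: sqr_ge0. Qed.

Lemma enorm2_gt0 x : x != 0 -> 0 < enorm2 x.
Proof.
move=> x0; rewrite lt_neqAle enorm2_ge0 andbT eq_sym.
apply: contra x0 => /eqP s0; apply/eqP/rowP => i; rewrite mxE; apply/eqP.
rewrite -sqrf_eq0; apply/eqP.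
by apply: (psumr_eq0P _ s0) => // j _; exact: sqr_ge0.
Qed.

Lemma enorm2_0 : enorm2 0 = 0.
Proof. by apply: big1 => i _; rewrite mxE expr0n. Qed.

Lemma sqr_enorm x : enorm x ^+ 2 = enorm2 x.
Proof. by rewrite sqr_sqrtr// enorm2_ge0. Qed.

Lemma enorm_ge0 x : 0 <= enorm x. Proof. exact: sqrtr_ge0. Qed.

Lemma enorm_gt0 x : x != 0 -> 0 < enorm x.
Proof. by move=> x0; rewrite sqrtr_gt0 enorm2_gt0. Qed.

Lemma coord_le_enorm x i : `|x 0 i| <= enorm x.
Proof.
rewrite -sqrtr_sqr ler_wsqrtr// (bigD1 i)//= lerDl.
by apply: sumr_ge0 => j _; exact: sqr_ge0.
Qed.

Lemma smooth_on_sqr_coord U j : open U ->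
  smooth_on U (fun x : 'rV[R]_N => x 0 j ^+ 2).
Proof.
move=> oU; apply: (smooth_on_eq oU) (smooth_onM oU (smooth_on_coord j oU) (smooth_on_coord j oU)).
by move=> x _.
Qed.

Lemma partial_sqr_coord i j x :
  partial i (fun x : 'rV[R]_N => x 0 j ^+ 2) x = 2 * x 0 j * (i == j)%:R.
Proof.
have sj := @smooth_on_coord R N setT j openT.
have := partialM i sj sj (I : setT x).
rewrite partial_coord -mulr2n -mulrA mulr_natl => <-.
by congr (partial i _ x); apply/funext.
Qed.

Lemma smooth_on_enorm2 U : open U -> smooth_on U enorm2.
Proof.
by move=> oU; apply: smooth_on_sum => // i; exact: smooth_on_sqr_coord.
Qed.

Lemma partial_enorm2 i x : partial i enorm2 x = 2 * x 0 i.
Proof.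
rewrite /enorm2 (@partial_sum _ _ setT _ _ _ (fun j x => x 0 j ^+ 2)) ?inE//.
- rewrite (bigD1 i)//= big1 ?addr0 => [|j ji].
    by rewrite partial_sqr_coord eqxx mulr1.
  by rewrite partial_sqr_coord eq_sym (negPf ji) mulr0.
- exact: openT.
- by move=> j; exact: smooth_on_sqr_coord openT.
Qed.

Lemma continuous_enorm2 : continuous enorm2.
Proof. by move=> x; apply: (smooth_on_continuous (smooth_on_enorm2 openT)). Qed.

Lemma continuous_enorm : continuous (@enorm R N).
Proof.
move=> x; apply: (@continuous_comp _ _ _ enorm2 Num.sqrt).
  exact: continuous_enorm2.
exact: sqrt_continuous.
Qed.

Definition inorm2 x : R := (enorm2 x)^-1.

(** Natural powers of this function stand for the half-integer powers of eps + |x|^2, so that no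
    real exponent is ever differentiated. *)
Definition inorm (eps : R) x : R := (Num.sqrt (eps + enorm2 x))^-1.

Lemma is_derive_enorm2 i x : is_derive x (delta_mx 0 i : 'rV[R]_N) enorm2 (2 * x 0 i).
Proof.
rewrite -partial_enorm2; apply: derivableP.
exact: (smooth_on_derivable (smooth_on_enorm2 openT)).
Qed.

Lemma is_derive_sqrtV (r : R) : 0 < r ->
  is_derive r 1 (fun t : R => (Num.sqrt t)^-1) (- 2^-1 * (Num.sqrt r)^-1 ^+ 3).
Proof.
move=> r0; have s0 : Num.sqrt r != 0 by rewrite gt_eqF// sqrtr_gt0.
apply: (is_derive_eq (is_deriveV s0 (is_derive1_sqrt r0))).
by rewrite -[_ *: _]/(_ * _) invfM; field.
Qed.

Section inorm.
Variable eps : R.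
Hypothesis eps0 : 0 < eps.

Let pos x : 0 < eps + enorm2 x. Proof. by rewrite ltr_wpDr// enorm2_ge0. Qed.

Lemma is_derive_inorm i x : is_derive x (delta_mx 0 i : 'rV[R]_N) (inorm eps)
  (- x 0 i * inorm eps x ^+ 3).
Proof.
have D : is_derive x (delta_mx 0 i : 'rV[R]_N) (fun y => eps + enorm2 y) (2 * x 0 i).
  rewrite -[2 * _]add0r.
  exact: (is_deriveD (is_derive_cst eps x _) (is_derive_enorm2 i x)).
apply: (is_derive_eq (is_derive_comp (is_derive_sqrtV (pos x)) D)).
rewrite -/(inorm eps x).
by field.
Qed.

Lemma partial_inorm i x : partial i (inorm eps) x = - x 0 i * inorm eps x ^+ 3.
Proof. by have [] := is_derive_inorm i x. Qed.

Lemma smooth_on_inorm U : open U -> smooth_on U (inorm eps).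
Proof.
move=> oU; apply: smooth_on_atom => // [x _|x i _|i].
- apply: (@continuousV _ _ (fun y => Num.sqrt (eps + enorm2 y))).
    by rewrite gt_eqF// sqrtr_gt0.
  apply: (@continuous_comp _ _ _ (fun y => eps + enorm2 y) Num.sqrt); last exact: sqrt_continuous.
  apply: (@continuousD _ _ _ (cst eps) enorm2); first exact: cst_continuous.
  exact: continuous_enorm2.
- by have [] := is_derive_inorm i x.
- set B := (fun g => g = inorm eps \/ smooth_on U g).
  have G : generated U B (inorm eps) by apply: gen_base; left.
  have Gs g : smooth_on U g -> generated U B g by move=> sg; apply: gen_base; right.
  apply: (gen_eq _ (genM (genM (genM G G) G) (Gs _ (smooth_onN oU (smooth_on_coord i oU))))).
  by move=> x _ /=; rewrite partial_inorm; ring.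
Qed.

End inorm.
End euclidean_norm.

(** * Smoothness of log|x| and |x|^-2 off the origin *)

Section log_norm.
Context {R : realType} {n : nat}.
Local Notation V := 'rV[R]_n.+1.
Local Notation U := (@punctured R n).

Lemma is_derive_inorm2 i (x : V) : x != 0 ->
  is_derive x (delta_mx 0 i : V) inorm2 (- 2 * x 0 i * inorm2 x ^+ 2).
Proof.
move=> x0; have s0 : enorm2 x != 0 by rewrite gt_eqF// enorm2_gt0.
have Dv := is_deriveV (s0 : id (enorm2 x) != 0) (is_derive_id (enorm2 x) 1).
apply: (is_derive_eq (is_derive_comp Dv (is_derive_enorm2 i x))).
by rewrite -[_ *: _]/(_ * _) /inorm2; field.
Qed.

Lemma partial_inorm2 i (x : V) : x != 0 ->
  partial i inorm2 x = - 2 * x 0 i * inorm2 x ^+ 2.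
Proof. by move=> x0; have [_] := is_derive_inorm2 i x0. Qed.

Lemma smooth_on_inorm2 : smooth_on U inorm2.
Proof.
have oU := @open_punctured R n.
apply: smooth_on_atom => // [x /= x0|x i Ux|i].
- apply: (@continuousV _ _ enorm2); first by rewrite gt_eqF// enorm2_gt0.
  exact: continuous_enorm2.
- by have [] := is_derive_inorm2 i Ux.
- set B := (fun g => g = inorm2 \/ smooth_on U g).
  have G : generated U B (inorm2) by apply: gen_base; left.
  have Gs g : smooth_on U g -> generated U B g by move=> sg; apply: gen_base; right.
  apply: (gen_eq _ (genM (genM G G) (genM (gen_cst _ _ (- 2)) (Gs _ (smooth_on_coord i oU))))).
  by move=> x /set_mem Ux /=; rewrite partial_inorm2//; ring.
Qed.

Lemma is_derive_log i (x : V) : x != 0 ->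
  is_derive x (delta_mx 0 i : V) (@log_enorm R n.+1) (x 0 i * inorm2 x).
Proof.
move=> x0; have s0 : 0 < enorm2 x by rewrite enorm2_gt0.
have r0 : 0 < Num.sqrt (enorm2 x) by rewrite sqrtr_gt0.
have D := is_derive1_comp (is_derive1_ln r0) (is_derive1_sqrt s0).
apply: (is_derive_eq (is_derive_comp D (is_derive_enorm2 i x))).
rewrite /inorm2 -[in RHS](sqr_sqrtr (ltW s0)); field.
by rewrite gt_eqF.
Qed.

Lemma partial_log i (x : V) : x != 0 ->
  partial i (@log_enorm R n.+1) x = x 0 i * inorm2 x.
Proof. by move=> x0; have [_] := is_derive_log i x0. Qed.

Lemma smooth_on_log : smooth_on U (@log_enorm R n.+1).
Proof.
have oU := @open_punctured R n.
apply: smooth_on_atom => // [x /= x0|x i /= x0|i].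
- have cln : {for enorm x, continuous (@ln R)}.
    by apply: continuous_ln; exact: enorm_gt0.
  exact: (continuous_comp (@continuous_enorm R n.+1 x) cln).
- by have [] := is_derive_log i x0.
- have G := smooth_onM oU (smooth_on_coord i oU) smooth_on_inorm2.
  apply: (gen_eq _ (@gen_base _ _ _ _ _ (or_intror G))).
  by move=> x /set_mem /= x0; rewrite partial_log.
Qed.

End log_norm.

(** * Transfer of the expansion from the ring to functions *)

Section pointwise_expansion.
Context {R : realType} {n : nat}.
Local Notation V := 'rV[R]_n.+1.
Local Notation U := (@punctured R n).
Local Notation A := (@pfun R n).
Local Notation log := (@log_enorm R n.+1).
Implicit Types (f g : V -> R) (x : V) (a : A).

(** At the origin every member of the ring, the unit included, takes the value 0; evaluation is a
    ring morphism only at other points, so the proof of [x != 0] is an argument. *)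
Definition pfun_eval x (x0 : x != 0) a : R := a x.

Lemma pfun_eval_additive x (x0 : x != 0) : zmod_morphism (pfun_eval x0).
Proof. by move=> a b; rewrite /pfun_eval pfunD pfunN. Qed.

Lemma pfun_eval_multiplicative x (x0 : x != 0) : monoid_morphism (pfun_eval x0).
Proof. by split=> [|a b]; [exact: pfun1|exact: pfunM]. Qed.

HB.instance Definition _ x (x0 : x != 0) := GRing.isZmodMorphism.Build _ _
  (pfun_eval x0) (pfun_eval_additive x0).
HB.instance Definition _ x (x0 : x != 0) := GRing.isMonoidMorphism.Build _ _
  (pfun_eval x0) (pfun_eval_multiplicative x0).

Local Notation d := (fun i => pfun_partial i : {additive A -> A}).
Definition pfun_coord i : A := pfun_of (smooth_on_coord i (@open_punctured R n)).
Local Notation X := pfun_coord.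

Lemma pfun_ofE f (sf : smooth_on U f) x : x != 0 -> pfun_of sf x = f x.
Proof. exact: punctureE. Qed.

Lemma pfun_coordE i x : x != 0 -> X i x = x 0 i.
Proof. exact: punctureE. Qed.

Lemma pfun_partial_of f (sf : smooth_on U f) i x : x != 0 ->
  pfun_partial i (pfun_of sf) x = partial i f x.
Proof.
move=> x0; apply: etrans (punctureE _ x0) _.
apply: (eq_on_partial i (@open_punctured R n) _ x0) => y /set_mem y0.
exact: pfun_ofE.
Qed.

Lemma pfun_partial_coord i j : pfun_partial i (X j) = (i == j)%:R.
Proof.
apply: pfunP => x x0; rewrite (pfun_partial_of _ _ x0) partial_coord.
by case: eqP => _; rewrite ?pfun1 ?pfun_zeroE.
Qed.

Lemma pfun_sqnormE x : x != 0 -> sqnorm X x = enorm2 x.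
Proof.
move=> x0; rewrite -[LHS]/(pfun_eval x0 _) rmorph_sum; apply: eq_bigr => i _.
by rewrite rmorphXn/= /pfun_eval (punctureE _ x0).
Qed.

Lemma pfun_inorm2K : pfun_of (@smooth_on_inorm2 R n) * sqnorm X = 1.
Proof.
apply: pfunP => x x0; rewrite pfunM pfun_ofE// pfun_sqnormE// pfun1//.
by rewrite mulVf// gt_eqF// enorm2_gt0.
Qed.

Lemma pfun_partial_log i :
  pfun_partial i (pfun_of (@smooth_on_log R n)) =
  X i * pfun_of (@smooth_on_inorm2 R n).
Proof.
apply: pfunP => x x0; rewrite (pfun_partial_of _ _ x0) partial_log//.
by rewrite pfunM (pfun_coordE _ x0) (pfun_ofE _ x0).
Qed.

Lemma pfun_euler_adj a f : {in U, a =1 f} ->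
  {in U, euler_adj d X a =1 euler_adjf f}.
Proof.
move=> af x /set_mem x0.
rewrite -[LHS]/(pfun_eval x0 _) rmorphN rmorph_sum; congr (- _).
apply: eq_bigr => i _; apply: etrans (pfun_partialE _ _ x0) _.
apply: (eq_on_partial i (@open_punctured R n) _ x0) => y /set_mem y0.
by rewrite pfunM (pfun_coordE _ y0) af// inE.
Qed.

Lemma pfun_iter_euler_adj a f i : {in U, a =1 f} ->
  {in U, iter i (euler_adj d X) a =1 iter i euler_adjf f}.
Proof. by move=> af; elim: i => //= i IH; exact: pfun_euler_adj. Qed.

(** The identities of the ring are evaluated at nonzero points. As the integers embed in the reals,
    a single evaluation turns p_0 = 0 into an equality of integers. *)
Lemma log_expansion k : (0 < k)%N -> exists p : {poly int},
  [/\ p`_0 = 0,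
    forall x, x != 0 -> 2 ^+ k * enorm2 x ^+ k *
      (\sum_(I : k.-tuple 'I_n.+1) partials I log x ^+ 2) = (p`_1)%:~R &
    forall g x, smooth_on U g ->
      (forall i x, x != 0 -> enorm2 x * partial i g x = x 0 i * eulerf g x) ->
      x != 0 ->
      2 ^+ k * ((-1) ^+ k * \sum_(I : k.-tuple 'I_n.+1)
        partials I (fun y => enorm2 y ^+ k * g y * partials I log y) x) =
      \sum_(i < size p) iter i euler_adjf g x *~ p`_i].
Proof.
move=> k0.
have [p [p0 p1 pg]] := radial_log_expansion (@pfun_partialM R n) (@pfun_partialC R n)
  pfun_partial_coord pfun_inorm2K pfun_partial_log k0.
have e0 : const_mx 1 != 0 :> V.
  by apply/eqP => /matrixP /(_ 0 0); rewrite !mxE; exact/eqP/oner_neq0.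
have E (P Q : Prop) : P -> Q -> P /\ Q by [].
exists p; split=> [|x x0|g x sg rg x0].
- have := congr1 (pfun_eval e0) p0; rewrite rmorph0 rmorph_int.
  by move/eqP; rewrite intr_eq0 => /eqP.
- have := congr1 (pfun_eval x0) p1; rewrite rmorph_int => <-.
  rewrite !rmorphM !rmorphXn rmorph_nat.
  congr (_ * _ ^+ _ * _); first exact: esym (pfun_sqnormE x0).
  rewrite rmorph_sum; apply: eq_bigr => I _; rewrite rmorphXn; congr (_ ^+ 2).
  apply: etrans _ (esym (dseqE _ _ x0)).
  by apply: (eq_on_partials I (@open_punctured R n) _ x0) => y /set_mem y0; rewrite pfun_ofE.
- pose G := pfun_of sg.
  have Gg : {in U, G =1 g} by move=> y /set_mem y0; rewrite pfun_ofE.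
  have radG : radial d X G.
    move=> i; apply: pfunP => y y0; rewrite !pfunM pfun_sqnormE//.
    rewrite (pfun_partial_of _ _ y0) rg// (pfun_coordE _ y0); congr (_ * _).
    rewrite -[RHS]/(pfun_eval y0 _) rmorph_sum; apply: eq_bigr => j _.
    rewrite rmorphM; congr (_ * _); first exact: esym (pfun_coordE _ y0).
    exact: esym (pfun_partial_of _ _ y0).
  have := congr1 (pfun_eval x0) (pg G radG).
  rewrite !rmorphM !rmorphXn rmorph_nat rmorphN1 !rmorph_sum => H.
  transitivity (\sum_(i < size p) pfun_eval x0 (iter i (euler_adj d X) G *~ p`_i)).
    rewrite -H; congr (_ * (_ * _)); apply: eq_bigr => I _.
    apply: etrans _ (esym (dseqE _ _ x0)).
    apply: (eq_on_partials I (@open_punctured R n) _ x0) => y /set_mem y0.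
    rewrite !pfunM -[sqnorm X ^+ k]/(sqnorm X ^+ k).
    have -> : (sqnorm X ^+ k : A) y = enorm2 y ^+ k.
      rewrite -[LHS]/(pfun_eval y0 _) rmorphXn; congr (_ ^+ _).
      exact: pfun_sqnormE.
    rewrite pfun_ofE//; congr (_ * _).
    apply: etrans _ (esym (dseqE _ _ y0)).
    apply: (eq_on_partials I (@open_punctured R n) _ y0) => w /set_mem w0.
    by rewrite pfun_ofE.
  apply: eq_bigr => i _; rewrite raddfMz/=; congr (_ *~ _).
  by apply: pfun_iter_euler_adj => //; rewrite inE.
Qed.

End pointwise_expansion.

(** * Lebesgue integrals on R^n *)

Section rV_borel.
Context {R : realType} {N : nat}.
Implicit Types (O : set 'rV[R]_N) (x : 'rV[R]_N).

Lemma rV_ballE x (r : R) : 0 < r ->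
  ball x r = [set y | forall i, `|x 0 i - y 0 i| < r].
Proof.
move=> r0; apply/seteqP; split=> y; rewrite -ball_normE /=.
  rewrite [`|_|]mx_normrE => /bigmax_ltP[_ +] i => /(_ (0, i)) /=.
  by rewrite !mxE; apply.
move=> H; rewrite [`|_|]mx_normrE; apply/bigmax_ltP; split=> // -[a i] _ /=.
by rewrite !mxE (ord1 a).
Qed.

Lemma measurable_rV_ball x (r : R) : 0 < r -> measurable (ball x r).
Proof.
move=> r0; have -> : ball x r = \bigcap_(i in [set: 'I_N])
    ((fun y : 'rV[R]_N => y 0 i : measurableTypeR R) @^-1` ball (x 0 i) r).
  rewrite rV_ballE//; apply/seteqP; split=> y /=.
    by move=> H i _; rewrite /= -ball_normE /=.
  by move=> H i; have := H i I; rewrite /= -ball_normE.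
apply: fin_bigcap_measurable => // i _; rewrite -[X in measurable X]setTI.
apply: measurable_coord => //; rewrite ball_itv; exact: measurable_itv.
Qed.

(** Balls of the sup norm are finite intersections of preimages under coordinates, and those with
    rational centre and radius 1/(m + 1) contained in [O] form a countable cover of it. *)
Lemma open_measurable_rV O : open O -> measurable O.
Proof.
move=> oO.
pose Q (q : 'rV[rat]_N * nat) : 'rV[R]_N := map_mx ratr q.1.
pose F q := if `[< ball (Q q) q.2.+1%:R^-1 `<=` O >] then ball (Q q) q.2.+1%:R^-1 else set0.
rewrite (_ : O = \bigcup_q F q).
  apply: countable_bigcupT_measurable; first exact: countableP.
  move=> q; rewrite /F; case: ifP => _; last exact: measurable0.
  by apply: measurable_rV_ball; rewrite invr_gt0.
apply/seteqP; split=> [x Ox|x [q _]]; last first.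
  by rewrite /F; case: asboolP => // BO /BO.
have /nbhs_ballP[r /= r0 rO] := open_nbhs_nbhs (conj oO Ox).
have [m mr] : exists m, m.+1%:R^-1 < r / 2.
  have r20 : 0 < r / 2 by rewrite divr_gt0.
  by have [m] := ltr_add_invr r20; rewrite add0r => mr; exists m.
have qi i : {q : rat | `|x 0 i - ratr q| < m.+1%:R^-1}.
  apply: cid; have : x 0 i - m.+1%:R^-1 < x 0 i + m.+1%:R^-1.
    by rewrite ltrD2l gtrN// invr_gt0.
  move=> /rat_in_itvoo[q]; rewrite in_itv/= => /andP[q1 q2]; exists q.
  by rewrite distrC ltr_distl q1 q2.
exists (\row_i sval (qi i), m) => //; rewrite /F; case: asboolP => [_|]; last first.
  case=> y; rewrite rV_ballE ?invr_gt0//= => H; apply: rO.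
  rewrite rV_ballE//= => i; have := H i; have := svalP (qi i); rewrite !mxE.
  move=> H1 H2; rewrite (le_lt_trans (ler_distD (ratr (sval (qi i))) _ _))//.
  by rewrite [ltRHS](splitr r) ltrD// (lt_trans _ mr).
rewrite rV_ballE ?invr_gt0//= => i; rewrite !mxE distrC.
exact: svalP (qi i).
Qed.

Lemma continuous_measurable_rV (f : 'rV[R]_N -> R) :
  continuous f -> measurable_fun setT f.
Proof.
move=> /continuousP cf; apply: (measurability _ (RGenOpens.measurableE R)).
move=> _ [_ [a [b ->] <-]]; rewrite setTI; apply: open_measurable_rV.
exact/cf/interval_open.
Qed.

End rV_borel.

(** * Fubini's theorem and products over the coordinates *)

Section rV_fubini.
Local Open Scope ereal_scope.
Context {R : realType} {n : nat}.
Local Notation mu := (@lebesgue_measure R).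
Local Notation muV := (lebesgue_measure_rV n : {sigma_finite_measure set 'rV[R]_n -> \bar R}).

Lemma ge0_integral_rVS (f : 'rV[R]_n.+1 -> \bar R) :
  measurable_fun setT f -> (forall x, 0 <= f x) ->
  \int[lebesgue_measure_rV n.+1]_x f x =
  \int[mu]_t \int[muV]_y f (rV_cons (t, y)).
Proof.
move=> mf f0.
rewrite [LHS](ge0_integral_pushforward (@measurable_rV_cons R n) (mu \x muV))//.
rewrite preimage_setT fubini_tonelli1//=.
by apply: measurableT_comp => //; exact: measurable_rV_cons.
Qed.

Lemma integrable_rVS (f : 'rV[R]_n.+1 -> \bar R) : measurable_fun setT f ->
  (lebesgue_measure_rV n.+1).-integrable setT f ->
  (mu \x muV).-integrable setT (f \o rV_cons).
Proof.
move=> mf /integrableP[_ foo]; apply/integrableP; split.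
  by apply: measurableT_comp => //; exact: measurable_rV_cons.
apply: le_lt_trans foo; rewrite le_eqVlt; apply/orP; left; apply/eqP.
rewrite [RHS](ge0_integral_pushforward (@measurable_rV_cons R n) (mu \x muV))//.
exact: measurableT_comp.
Qed.

Lemma integral_rVS (f : 'rV[R]_n.+1 -> \bar R) : measurable_fun setT f ->
  (lebesgue_measure_rV n.+1).-integrable setT f ->
  \int[lebesgue_measure_rV n.+1]_x f x =
  \int[mu]_t \int[muV]_y f (rV_cons (t, y)).
Proof.
move=> mf intf; have intf' := integrable_rVS mf intf.
rewrite [LHS](integral_pushforward (@measurable_rV_cons R n) (mu := mu \x muV))//.
by rewrite preimage_setT -integral12_prod_meas1.
Qed.

Lemma integral_rVS_sym (f : 'rV[R]_n.+1 -> \bar R) : measurable_fun setT f ->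
  (lebesgue_measure_rV n.+1).-integrable setT f ->
  \int[lebesgue_measure_rV n.+1]_x f x =
  \int[muV]_y \int[mu]_t f (rV_cons (t, y)).
Proof.
move=> mf intf; have intf' := integrable_rVS mf intf.
rewrite [LHS](integral_pushforward (@measurable_rV_cons R n) (mu := mu \x muV))//.
by rewrite preimage_setT -integral21_prod_meas1.
Qed.

End rV_fubini.

Section rV_product.
Local Open Scope ereal_scope.
Context {R : realType}.
Local Notation mu := (@lebesgue_measure R).

Lemma measurable_prod_coord n (g : R -> R) : measurable_fun setT g ->
  measurable_fun setT (fun x : 'rV[R]_n => (\prod_i g (x 0%R i))%R).
Proof.
move=> mg; apply: measurable_prod => i _.
by apply: (measurableT_comp mg); exact: measurable_coord.
Qed.

(** Used for Gaussians, for the indicator of a box and for that of a point. In dimension 0 the empty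
    product is integrated against a Dirac mass. *)
Lemma integral_prod_coord n (g : R -> R) : measurable_fun setT g ->
  (forall t, (0 <= g t)%R) ->
  \int[lebesgue_measure_rV n]_x (\prod_i g (x 0%R i))%:E =
  (\int[mu]_t (g t)%:E) ^+ n.
Proof.
move=> mg g0; have mP k := @measurable_prod_coord k g mg.
elim: n => [|n IH].
  rewrite [LHS]integral_dirac//; last by apply/measurable_EFinP; exact: mP.
  by rewrite diracT big_ord0 mul1e.
rewrite ge0_integral_rVS; last 2 first.
- by apply/measurable_EFinP; exact: mP.
- by move=> x; rewrite lee_fin; apply: prodr_ge0 => i _.
transitivity (\int[mu]_t ((g t)%:E * (\int[mu]_t (g t)%:E) ^+ n)).
  apply: eq_integral => t _; rewrite -IH -ge0_integralZl//.
  - apply: eq_integral => y _; rewrite big_ord_recl rV_cons0 -EFinM.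
    by congr (_ * _)%:E; apply: eq_bigr => i _; rewrite rV_consS.
  - by apply/measurable_EFinP; exact: mP.
  - by move=> y _; rewrite lee_fin; apply: prodr_ge0 => i _.
  - by rewrite lee_fin.
rewrite ge0_integralZr//.
- by rewrite expeS.
- exact/measurable_EFinP.
- by move=> t _; rewrite lee_fin.
- by apply: expe_ge0; apply: integral_ge0 => t _; rewrite lee_fin.
Qed.

End rV_product.

(** * Integrals in one variable *)

Section line_integrals.
Local Open Scope ereal_scope.
Context {R : realType}.
Local Notation mu := (@lebesgue_measure R).

Lemma is_derive_mull (c x : R) : is_derive x (1%R : R) (fun t : R => c * t)%R c.
Proof.
have := is_deriveZ c (is_derive_id x (1%R : R)).
by move/is_derive_eq; apply; rewrite -[_ *: _]/(c * 1)%R mulr1.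
Qed.

Lemma ge0_integral_scale (c : R) (G : R -> R) : (0 < c)%R -> continuous G ->
  (forall x, 0 <= G x)%R ->
  \int[mu]_x (G (c * x)%R)%:E = c^-1%:E * \int[mu]_x (G x)%:E.
Proof.
move=> c0 cG G0; pose F (x : R) := (c * x)%R.
have DF (x : R) := is_derive_mull c x.
have F' : F^`()%classic = cst c.
  by apply/funext => x; rewrite derive1E; have [_ ->] := DF x.
rewrite [in RHS](@increasing_ge0_integration_by_substitutionT _ F G)//.
- rewrite -ge0_integralZl//; first last.
  + by rewrite lee_fin invr_ge0 ltW.
  + by move=> x _; rewrite lee_fin F'; apply: mulr_ge0; [exact: G0|exact: ltW].
  + apply/measurable_EFinP; apply: continuous_measurable_fun; rewrite F' => x.
    apply: continuousM; last exact: cst_continuous.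
    apply: continuous_comp; last exact: cG.
    exact: mulrl_continuous.
  apply: eq_integral => x _; rewrite -EFinM F'; congr EFin.
  rewrite -[RHS]/(c^-1 * (G (c * x) * c))%R mulrCA mulVf ?mulr1//.
  by rewrite gt_eqF.
- by move=> x y xy; rewrite /F ltr_pM2l.
- by rewrite F'; exact: cst_continuous.
- by rewrite F'; exact: is_cvg_cst.
- by rewrite F'; exact: is_cvg_cst.
- by apply: gt0_cvgMrNy => //; exact: cvg_id.
- by apply: gt0_cvgMry => //; exact: cvg_id.
Qed.

Lemma integral_gauss_scale (t : R) : (0 < t)%R ->
  \int[mu]_x (expR (- (t * x ^+ 2)))%:E = (Num.sqrt pi / Num.sqrt t)%:E.
Proof.
move=> t0; have st0 : (0 < Num.sqrt t)%R by rewrite sqrtr_gt0.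
have := ge0_integral_scale st0 (@continuous_gauss_fun R) (@gauss_fun_ge0 R).
rewrite integralT_gauss -EFinM mulrC => <-.
apply: eq_integral => x _; rewrite /gauss_fun exprMn sqr_sqrtr//.
exact: ltW.
Qed.

Lemma integral_expR_tail (b c : R) : (0 < b)%R ->
  \int[mu]_(t in `[c, +oo[) (expR (- (b * t)))%:E = (expR (- (b * c)) / b)%:E.
Proof.
move=> b0; pose F (t : R) := (- (b^-1 * expR (- (b * t))))%R.
have DF (x : R) : is_derive x (1%R : R) F (expR (- (b * x))).
  have D1 : is_derive x (1%R : R) (fun t : R => - (b * t))%R (- b)%R.
    exact: (is_deriveN (is_derive_mull b x)).
  have D := @is_derive1_comp _ expR (fun t : R => - (b * t))%R _ _ _
    (is_derive_expR (- (b * x))%R) D1.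
  have := is_deriveN (is_deriveZ b^-1%R D).
  move/is_derive_eq; apply.
  by rewrite -[_ *: _]/(_ * _)%R mulrN mulrN opprK mulrCA mulVf ?mulr1// gt_eqF.
rewrite (@ge0_continuous_FTC2y _ _ F _ 0%R).
- by rewrite -EFinB sub0r opprK mulrC.
- by move=> x _; exact: expR_ge0.
- apply: continuous_subspaceT => x; apply: continuous_comp; last exact: continuous_expR.
  by apply: continuousN; exact: mulrl_continuous.
- rewrite -oppr0; apply: cvgN; rewrite -(mulr0 b^-1%R); apply: cvgMl_tmp.
  have h : (b * t)%R @[t --> +oo%R] --> +oo%R.
    by apply: gt0_cvgMry => //; exact: cvg_id.
  exact: (cvg_comp _ _ h (@cvgr_expR R)).
- by move=> x _; have [] := DF x.
- apply: cvg_at_right_filter.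
  have [/derivable1_diffP/differentiable_continuous + _] := DF c; exact.
- by move=> x _; rewrite derive1E; have [_] := DF x.
Qed.

(** The integrand of Gamma(N/2 + 1), extended to the line for N > 0 by the value 0 of the square
    root at negative numbers. Unlike that of Gamma(N/2), it is continuous at 0 for every N, as the
    substitution t -> a t requires. *)
Definition gamma_kernel N (t : R) : R := (Num.sqrt t ^+ N * expR (- t))%R.

Lemma gamma_kernel_ge0 N t : (0 <= gamma_kernel N t)%R.
Proof. by rewrite mulr_ge0 ?expR_ge0// exprn_ge0// sqrtr_ge0. Qed.

Lemma continuous_sqrtX_expR N (a : R) :
  continuous (fun t : R => Num.sqrt t ^+ N * expR (- (a * t)))%R.
Proof.
have E : continuous (fun t : R => expR (- (a * t)))%R.
  move=> t; apply: continuous_comp; last exact: continuous_expR.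
  by apply: continuousN; exact: mulrl_continuous.
have S : continuous (fun t : R => Num.sqrt t ^+ N)%R.
  move=> t; apply: (@continuous_comp _ _ _ Num.sqrt (fun r : R => r ^+ N)%R).
    exact: sqrt_continuous.
  exact: exprn_continuous.
move=> x; exact: (continuousM (S x) (E x)).
Qed.

Lemma continuous_gamma_kernel N : continuous (gamma_kernel N).
Proof.
have := @continuous_sqrtX_expR N 1%R.
by under eq_fun do rewrite mul1r.
Qed.

Lemma integral_gamma_scale N (a : R) : (0 < a)%R ->
  \int[mu]_t (Num.sqrt t ^+ N * expR (- (a * t)))%:E =
  ((Num.sqrt a)^-1 ^+ N.+2)%:E * \int[mu]_t (gamma_kernel N t)%:E.
Proof.
move=> a0; have sa0 : (0 < Num.sqrt a)%R by rewrite sqrtr_gt0.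
have := ge0_integral_scale a0 (@continuous_gamma_kernel N) (@gamma_kernel_ge0 N).
have -> : \int[mu]_t (gamma_kernel N (a * t))%:E =
    (Num.sqrt a ^+ N)%:E * \int[mu]_t (Num.sqrt t ^+ N * expR (- (a * t)))%:E.
  rewrite -ge0_integralZl//.
  - apply: eq_integral => t _; rewrite -EFinM /gamma_kernel.
    by rewrite sqrtrM ?ltW// exprMn mulrA.
  - apply/measurable_EFinP; apply: continuous_measurable_fun => t.
    exact: continuous_sqrtX_expR.
move=> H; have := congr1 (fun z => ((Num.sqrt a)^-1 ^+ N)%:E * z) H.
rewrite muleA -EFinM -exprMn mulVf ?gt_eqF// expr1n mul1e => ->.
rewrite muleA -EFinM; congr (_%:E * _).
by rewrite -[in RHS]addn2 exprD; congr (_ * _)%R; rewrite exprVn sqr_sqrtr// ltW.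
Qed.

Lemma integral_sqrt_tail N : (0 < N)%N ->
  \int[mu]_(a in `[1%R, +oo[) ((Num.sqrt a)^-1 ^+ N.+2)%:E = (2 / N%:R)%:E :> \bar R.
Proof.
move=> N0; have Nn0 : (N%:R != 0 :> R)%R by rewrite pnatr_eq0 -lt0n.
pose F (a : R) := (- (2 / N%:R) * (Num.sqrt a)^-1 ^+ N)%R.
have DF (x : R) : (0 < x)%R -> is_derive x (1%R : R) F ((Num.sqrt x)^-1 ^+ N.+2)%R.
  move=> x0; set z := (Num.sqrt x)^-1%R.
  have Dz := is_derive_sqrtV x0; rewrite -/z in Dz.
  have Dp : is_derive z (1%R : R) (fun r : R => r ^+ N)%R (N%:R * z ^+ N.-1)%R.
    apply: DeriveDef; first exact: exprn_derivable.
    by rewrite exp_derive -[_ *: 1]/(_ * 1)%R mulr1.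
  have D := @is_derive1_comp _ (fun r : R => r ^+ N)%R (fun t : R => (Num.sqrt t)^-1)%R
    _ _ _ Dp Dz.
  have := is_deriveZ (- (2 / N%:R))%R D.
  move/is_derive_eq; apply; rewrite -[_ *: _]/(_ * _)%R.
  by case: N N0 Nn0 {F Dp D} => // M _ Mn0 /=; rewrite !exprS; field.
rewrite (@ge0_continuous_FTC2y _ _ F _ 0%R).
- by rewrite /F sqrtr1 invr1 expr1n mulr1 -EFinB sub0r opprK.
- by move=> x _; rewrite exprn_ge0// invr_ge0 sqrtr_ge0.
- apply: continuous_in_subspaceT => x; rewrite inE/= in_itv/= andbT => x1.
  have sx : Num.sqrt x != 0%R by rewrite gt_eqF// sqrtr_gt0 (lt_le_trans ltr01).
  apply: (@continuous_comp _ _ _ (fun t : R => (Num.sqrt t)^-1)%R (fun r : R => r ^+ N.+2)%R).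
    by apply: (@continuousV _ _ Num.sqrt) => //; exact: sqrt_continuous.
  exact: exprn_continuous.
- rewrite -(mulr0 (- (2 / N%:R)))%R; apply: cvgMl_tmp.
  have z0 : (Num.sqrt a)^-1%R @[a --> +oo%R] --> (0 : R)%R.
    apply/cvgr0Pnorm_lt => eps eps0; near=> a.
    have a0 : (0 < a)%R by near: a; exact: nbhs_pinfty_gt.
    rewrite ger0_norm ?invr_ge0 ?sqrtr_ge0// invf_plt ?posrE ?sqrtr_gt0//.
    rewrite -[ltLHS]ger0_norm ?invr_ge0 ?ltW// -sqrtr_sqr ltr_sqrt//.
    by near: a; apply: nbhs_pinfty_gt; rewrite num_real.
  have c0 := cvg_comp _ _ z0 (@exprn_continuous R N 0%R).
  by rewrite expr0n eqn0Ngt N0 in c0.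
- by move=> x x1; have [] := DF x (lt_trans ltr01 x1).
- apply: cvg_at_right_filter.
  have [/derivable1_diffP/differentiable_continuous + _] := DF 1%R ltr01; exact.
- move=> x; rewrite in_itv/= andbT => x1; rewrite derive1E.
  by have [_] := DF x (lt_trans ltr01 x1).
Unshelve. all: by end_near. Qed.

End line_integrals.

(** * The mass of the kernels and the constant omega *)

Section gamma_mass.
Local Open Scope ereal_scope.
Context {R : realType}.
Local Notation mu := (@lebesgue_measure R).
Local Notation J N := (\int[mu]_t (@gamma_kernel R N t)%:E).

Lemma measurable_invr : measurable_fun [set: R] (@GRing.inv R).
Proof.
(* Inversion is not continuous at 0; it is rewritten with a measurable real power, the factor x
   giving the value 0 at the origin. *)
have -> : @GRing.inv R = (fun x => x * (x ^+ 2) `^ (- 1))%R.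
  apply/funext => x; have [->|x0] := eqVneq x 0%R; first by rewrite invr0 mul0r.
  by rewrite powR_inv1 ?sqr_ge0// expr2 invfM mulVKf.
apply: measurable_funM => //.
by apply: (measurableT_comp (measurable_powR _)); exact: measurable_funX.
Qed.

Lemma integral_setT_indic d (T : measurableType d) (m : {measure set T -> \bar R})
    (D : set T) (f : T -> R) : 
  \int[m]_(x in D) (f x)%:E = \int[m]_x (\1_D x * f x)%:E.
Proof.
rewrite integral_mkcond; apply: eq_integral => x _.
rewrite patchE indicE; case: ifPn => _; first by rewrite mul1r.
by rewrite mul0r.
Qed.

Lemma sqrtX_le0 N (t : R) : (0 < N)%N -> (t <= 0)%R -> (Num.sqrt t ^+ N = 0)%R.
Proof. by move=> N0 t0; rewrite ler0_sqrtr// expr0n eqn0Ngt N0. Qed.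

Lemma powR_half_sub1 N (t : R) : (0 < t)%R ->
  (t `^ (N%:R / 2 - 1) = Num.sqrt t ^+ N / t)%R.
Proof.
move=> t0; rewrite powRD; last by apply/implyP => _; rewrite gt_eqF.
rewrite powRN powRr1 ?ltW//; congr (_ / _)%R.
by rewrite mulrC powRrM powR12_sqrt ?ltW// powR_mulrn ?sqrtr_ge0.
Qed.

(** The functional equation Gamma(N/2 + 1) = (N/2) Gamma(N/2), by Tonelli: e^-t / t is the integral
    of e^(-a t) over a >= 1, and integrating in t first leaves a^(-N/2 - 1), of integral 2/N. No
    boundary term appears at the singular endpoint, and infinite values are allowed. *)
Lemma integral_Gamma_half N : (0 < N)%N ->
  \int[mu]_(t in `]0%R, +oo[) (t `^ (N%:R / 2 - 1) * expR (- t))%:E =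
  (2 / N%:R)%:E * J N.
Proof.
move=> N0; pose D : set (measurableTypeR R) := [set` `[1%R, +oo[%R].
have mD : measurable D by exact: measurable_itv.
have m1 : measurable_fun setT (\1_D : measurableTypeR R -> R) by exact: measurable_indic.
pose f (p : measurableTypeR R * measurableTypeR R) : \bar R :=
  (\1_D p.2 * (Num.sqrt p.1 ^+ N * expR (- (p.2 * p.1))))%:E.
have f0 p : 0 <= f p.
  by rewrite lee_fin mulr_ge0// mulr_ge0 ?expR_ge0// exprn_ge0// sqrtr_ge0.
have mf : measurable_fun setT f.
  apply/measurable_EFinP; apply: measurable_funM.
    exact: (measurableT_comp m1 measurable_snd).
  apply: measurable_funM.
    apply: measurable_funX; apply: (measurableT_comp _ measurable_fst).
    by apply: continuous_measurable_fun; exact: sqrt_continuous.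
  apply: (measurableT_comp (@measurable_expR R)).
  apply: measurableT_comp => //; exact: measurable_funM.
have E1 (t : R) : \int[mu]_a f (t, a) = (\1_(`]0%R, +oo[) t * (t `^ (N%:R / 2 - 1) * expR (- t)))%:E.
  rewrite indicE; have [t0|t0] := leP t 0%R.
    rewrite integral0_eq => [|a _]; last by rewrite /f/= sqrtX_le0// mul0r mulr0.
    by rewrite memNset ?mul0r//= in_itv/= andbT; apply/negP; rewrite -leNgt.
  rewrite mem_set /=; last by rewrite in_itv/= andbT.
  rewrite mul1r; transitivity (\int[mu]_(a in D) (Num.sqrt t ^+ N * expR (- (t * a)))%:E).
    by rewrite [RHS]integral_setT_indic; apply: eq_integral => a _; rewrite /f/= [(a * t)%R]mulrC.
  under eq_integral do rewrite EFinM.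
  rewrite ge0_integralZl//.
  - rewrite integral_expR_tail// -EFinM mulr1; congr EFin.
    by rewrite powR_half_sub1//; ring.
  - apply/measurable_EFinP; apply: measurable_funTS.
    apply: (measurableT_comp (@measurable_expR R)).
    by apply: measurableT_comp => //; exact: measurable_funM.
have E2 (a : R) : \int[mu]_t f (t, a) = (\1_D a * (Num.sqrt a)^-1 ^+ N.+2)%:E * J N.
  rewrite indicE; have [/set_mem aD|aD] := boolP (a \in D); last first.
    rewrite mul0r mul0e integral0_eq// => t _.
    by rewrite /f/= indicE (negPf aD) mul0r.
  have a0 : (0 < a)%R.
    by move: aD; rewrite /D/= in_itv/= andbT; apply: lt_le_trans.
  rewrite mul1r -integral_gamma_scale//; apply: eq_integral => t _.
  by rewrite /f/= indicE mem_set// mul1r.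
have := @fubini_tonelli _ _ _ _ _ mu mu f mf f0.
under eq_integral do rewrite E1.
under [RHS]eq_integral do rewrite E2.
rewrite -integral_setT_indic => ->.
rewrite ge0_integralZr//.
- by rewrite -integral_setT_indic integral_sqrt_tail.
- apply/measurable_EFinP; apply: measurable_funM; first exact: measurable_indic.
  apply: measurable_funX; apply: (measurableT_comp measurable_invr).
  by apply: continuous_measurable_fun; exact: sqrt_continuous.
- by apply: integral_ge0 => t _; rewrite lee_fin gamma_kernel_ge0.
Qed.

(** Tonelli for t^(N/2) exp(- (eps + |x|^2) t): integrating in t gives a Gamma integral, integrating
    in x a Gaussian one, (pi / t)^(N/2), whose power of t cancels. The form of a product is kept
    because neither factor is yet known to be finite. *)
Lemma integral_inorm N (eps : R) : (0 < N)%N -> (0 < eps)%R ->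
  J N * \int[lebesgue_measure_rV N]_x (inorm eps x ^+ N.+2)%:E =
  (Num.sqrt pi ^+ N / eps)%:E.
Proof.
move=> N0 eps0.
pose f (p : measurableTypeR R * 'rV[R]_N) : \bar R :=
  (Num.sqrt p.1 ^+ N * expR (- ((eps + enorm2 p.2) * p.1)))%:E.
have f0 p : 0 <= f p.
  by rewrite lee_fin mulr_ge0 ?expR_ge0// exprn_ge0// sqrtr_ge0.
have ms : measurable_fun setT (fun t : R => Num.sqrt t ^+ N)%R.
  apply: measurable_funX.
  by apply: continuous_measurable_fun; exact: sqrt_continuous.
have me : measurable_fun setT (@enorm2 R N).
  by apply: continuous_measurable_rV; exact: continuous_enorm2.
have mf : measurable_fun setT f.
  apply/measurable_EFinP; apply: measurable_funM.
    exact: (measurableT_comp ms measurable_fst).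
  apply: (measurableT_comp (@measurable_expR R)).
  apply: measurableT_comp => //; apply: measurable_funM => //.
  apply: measurable_funD => //; exact: (measurableT_comp me measurable_snd).
have E1 (x : 'rV[R]_N) : \int[mu]_t f (t, x) = (inorm eps x ^+ N.+2)%:E * J N.
  by rewrite -integral_gamma_scale// ltr_wpDr// enorm2_ge0.
have E2 (t : R) : \int[lebesgue_measure_rV N]_x f (t, x) =
    (\1_(`]0%R, +oo[) t * (Num.sqrt pi ^+ N * expR (- (eps * t))))%:E.
  rewrite indicE; have [t0|t0] := leP t 0%R.
    rewrite integral0_eq => [|x _]; last by rewrite /f/= sqrtX_le0// mul0r.
    by rewrite memNset ?mul0r//= in_itv/= andbT; apply/negP; rewrite -leNgt.
  rewrite mem_set /=; last by rewrite in_itv/= andbT.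
  rewrite mul1r.
  transitivity (\int[lebesgue_measure_rV N]_x
      ((Num.sqrt t ^+ N * expR (- (eps * t)))%:E * (\prod_i expR (- (t * x 0%R i ^+ 2)))%:E)).
    apply: eq_integral => x _; rewrite -EFinM /f/=; congr EFin.
    rewrite -expR_sum -mulrA -expRD; congr (_ * expR _)%R.
    by rewrite sumrN -mulr_sumr -/(enorm2 x); ring.
  have mg : measurable_fun setT (fun r : R => expR (- (t * r ^+ 2)))%R.
    apply: (measurableT_comp (@measurable_expR R)).
    by apply: measurableT_comp => //; apply: measurable_funM.
  rewrite ge0_integralZl//.
  - rewrite (@integral_prod_coord _ _ (fun r => expR (- (t * r ^+ 2)))%R)//.
    rewrite integral_gauss_scale// -EFin_expe -EFinM; congr EFin.
    rewrite expr_div_n; have : (Num.sqrt t ^+ N != 0)%R.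
      by rewrite expf_neq0// gt_eqF// sqrtr_gt0.
    move: (Num.sqrt t ^+ N)%R => r r0; by field.
  - by apply/measurable_EFinP; exact: (measurable_prod_coord mg).
  - by move=> x _; rewrite lee_fin; apply: prodr_ge0 => i _; exact: expR_ge0.
have := @fubini_tonelli _ _ _ _ _ mu (lebesgue_measure_rV N) f mf f0.
under eq_integral do rewrite E2.
under [RHS]eq_integral do rewrite E1.
rewrite ge0_integralZr//.
- rewrite muleC => <-; rewrite -integral_setT_indic.
  rewrite integral_itv_obnd_cbnd; last first.
    apply/measurable_EFinP; apply: measurable_funTS; apply: measurable_funM => //.
    apply: (measurableT_comp (@measurable_expR R)).
    by apply: measurableT_comp => //; exact: measurable_funM.
  under eq_integral do rewrite EFinM.
  rewrite ge0_integralZl//.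
  + by rewrite integral_expR_tail// mulr0 oppr0 expR0 -EFinM mul1r.
  + apply/measurable_EFinP; apply: measurable_funTS.
    apply: (measurableT_comp (@measurable_expR R)).
    by apply: measurableT_comp => //; exact: measurable_funM.
- apply/measurable_EFinP; apply: measurable_funX; apply: continuous_measurable_rV.
  move=> x; exact: (smooth_on_continuous (smooth_on_inorm eps0 openT)).
- by move=> x _; rewrite lee_fin exprn_ge0// invr_ge0 sqrtr_ge0.
- by apply: integral_ge0 => t _; rewrite lee_fin gamma_kernel_ge0.
Qed.

(** Gives the finiteness of both factors in [integral_inorm] at once: an infinite factor would make
    the product 0 or infinite. *)
Lemma mule_pos_fin (a b : \bar R) (c : R) : 0 <= a -> 0 <= b -> (0 < c)%R ->
  a * b = c%:E -> exists2 r : R, (0 < r)%R & a = r%:E /\ b = (c / r)%:E.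
Proof.
move=> a0 b0 c0.
case: a a0 => [r| |//]; rewrite ?lee_fin => r0; last first.
  move: b0; rewrite le_eqVlt => /predU1P[<-|b0]; last by rewrite gt0_mulye.
  by rewrite mule0 => -[] /eqP; rewrite lt_eqF.
move: r0; rewrite le_eqVlt => /predU1P[<-|r0].
  by rewrite mul0e => -[] /eqP; rewrite lt_eqF.
case: b b0 => [m| |//] _; last by rewrite gt0_muley.
rewrite -EFinM => -[rm]; exists r => //; split=> //; congr EFin.
by rewrite -rm mulrC mulKf// gt_eqF.
Qed.

(** By [integral_inorm] the integral is N pi^(N/2) / J, where eps has cancelled, and J = (N/2)
    Gamma(N/2). *)
Lemma integral_omega N (eps : R) : (0 < N)%N -> (0 < eps)%R ->
  \int[lebesgue_measure_rV N]_x (N%:R * eps * inorm eps x ^+ N.+2)%:E =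
  (omega R N)%:E.
Proof.
move=> N0 eps0; have NR0 : (0 < N%:R :> R)%R by rewrite ltr0n.
have J0 : 0 <= J N by apply: integral_ge0 => t _; rewrite lee_fin gamma_kernel_ge0.
have z0 (x : 'rV[R]_N) : (0 <= inorm eps x ^+ N.+2)%R.
  by rewrite exprn_ge0// invr_ge0 sqrtr_ge0.
have sp0 : (0 < Num.sqrt pi :> R)%R by rewrite sqrtr_gt0 pi_gt0.
have [j j0 [Jj Mj]] := mule_pos_fin J0
  (integral_ge0 _ (fun x _ => z0 x : 0 <= (inorm eps x ^+ N.+2)%:E))
  (divr_gt0 (exprn_gt0 N sp0) eps0) (integral_inorm N0 eps0).
under eq_integral do rewrite EFinM.
rewrite ge0_integralZl//.
- rewrite Mj -EFinM /omega /Gamma /Rintegral integral_Gamma_half// Jj -EFinM/=.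
  congr EFin; rewrite [(N%:R / 2)%R]mulrC powRrM powR12_sqrt ?pi_ge0// powR_mulrn ?ltW//.
  by field; rewrite !gt_eqF.
- apply/measurable_EFinP; apply: measurable_funX; apply: continuous_measurable_rV.
  move=> x; exact: (smooth_on_continuous (smooth_on_inorm eps0 openT)).
- by move=> x _; rewrite lee_fin; exact: z0.
- by rewrite lee_fin mulr_ge0 ?ltW.
Qed.

End gamma_mass.

Section real_integrable.
Context d (T : measurableType d) (R : realType) (m : {measure set T -> \bar R}).
Implicit Types f g : T -> R.

Lemma integrableDR f g : m.-integrable setT (EFin \o f) ->
  m.-integrable setT (EFin \o g) -> m.-integrable setT (EFin \o (fun x => f x + g x)).
Proof. exact: integrableD. Qed.

Lemma integrableBR f g : m.-integrable setT (EFin \o f) ->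
  m.-integrable setT (EFin \o g) -> m.-integrable setT (EFin \o (fun x => f x - g x)).
Proof. exact: integrableB. Qed.

Lemma integrableZlR c f : m.-integrable setT (EFin \o f) ->
  m.-integrable setT (EFin \o (fun x => c * f x)).
Proof. exact: integrableZl. Qed.

Lemma integrableZrR c f : m.-integrable setT (EFin \o f) ->
  m.-integrable setT (EFin \o (fun x => f x * c)).
Proof. exact: integrableZr. Qed.

Lemma integrable_normR f : m.-integrable setT (EFin \o f) ->
  m.-integrable setT (EFin \o (fun x => `|f x|)).
Proof. exact: integrable_abse. Qed.

End real_integrable.

(** * Functions supported in a box *)

Section box_support.
Context {R : realType} {N : nat}.
Implicit Types (f g : 'rV[R]_N -> R) (x : 'rV[R]_N) (M : R).
Local Notation muN := (lebesgue_measure_rV N : {measure set 'rV[R]_N -> \bar R}).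

Definition box_supported M f := forall x, (exists i, M < `|x 0 i|) -> f x = 0.

(** The majorant is C times the product of the indicators of [-M, M] in each coordinate, whose
    integral factorises. *)
Lemma integrable_box M f C : measurable_fun setT f -> (forall x, `|f x| <= C) ->
  box_supported M f -> muN.-integrable setT (EFin \o f).
Proof.
move=> mf fC fM.
pose D : set R := [set` `[- M, M]]; pose g : R -> R := \1_D.
have mD : measurable D by exact: measurable_itv.
have mg : measurable_fun setT g by exact: measurable_indic.
have C0 : 0 <= C by apply: le_trans (fC 0); exact: normr_ge0.
have mP := @measurable_prod_coord R N g mg.
apply: (@le_integrable _ _ _ _ _ _ _ (fun x : 'rV[R]_N => (C * \prod_i g (x 0 i))%:E)) => //.
- exact/measurable_EFinP.
- move=> x _; rewrite lee_fin [leRHS]ger0_norm; last first.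
    by rewrite mulr_ge0//; apply: prodr_ge0 => i _.
  have [/existsP[i Mi]|/existsPn H] := boolP [exists i, M < `|x 0 i|].
    rewrite fM; last by exists i.
    by rewrite normr0 mulr_ge0//; apply: prodr_ge0 => j _.
  rewrite big1 ?mulr1// => i _; rewrite /g indicE mem_set//= /D /= in_itv/=.
  by rewrite -ler_norml leNgt H.
- apply/integrableP; split; first by apply/measurable_EFinP; exact: measurable_funM.
  under eq_integral => x _.
    rewrite gee0_abs; last by rewrite lee_fin mulr_ge0//; apply: prodr_ge0 => i _.
    rewrite EFinM; over.
  rewrite ge0_integralZl//; last 2 first.
  + exact/measurable_EFinP.
  + by move=> x _; rewrite lee_fin; apply: prodr_ge0 => i _.
  rewrite integral_prod_coord// /g integral_indic// setIT /D/= lebesgue_measure_itv/=.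
  by case: ifP => _; rewrite -?EFinB -EFin_expe -EFinM ltry.
Qed.

Definition compactly_supported f := continuous f /\ exists M, box_supported M f.

Lemma continuous_bounded_on_compact f (K : set 'rV[R]_N) : continuous f -> compact K ->
  exists2 C, 0 < C & forall x, K x -> `|f x| <= C.
Proof.
move=> cf cK; have : compact (f @` K).
  by apply: continuous_compact => //; exact: continuous_subspaceT.
move=> /compact_bounded[C0 [_ HC]].
exists (`|C0| + 1) => [|x Kx]; first by rewrite ltr_pwDr// normr_ge0.
by apply: HC; [rewrite ltr_pwDr// ler_norm|exists x].
Qed.

Lemma compactly_supported_bounded f : compactly_supported f ->
  exists2 C, 0 < C & forall x, `|f x| <= C.
Proof.
move=> [cf [M fM]].
have cB : compact [set v : 'rV[R]_N | forall i, [set` `[- M, M]] (v ord0 i)].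
  by apply: (@rV_compact R N (fun=> [set` `[- M, M]])) => i; exact: segment_compact.
have [C C0 HC] := continuous_bounded_on_compact cf cB.
exists C => // x.
have [/existsP[i Mi]|/existsPn H] := boolP [exists i, M < `|x 0 i|].
  by rewrite fM ?normr0 ?(ltW C0)//; exists i.
by apply: HC => i /=; rewrite in_itv/= -ler_norml leNgt H.
Qed.

Lemma compactly_supported_integrable f : compactly_supported f ->
  muN.-integrable setT (EFin \o f).
Proof.
move=> cf; have [C _ fC] := compactly_supported_bounded cf; case: cf => cf [M fM].
by apply: integrable_box fC fM; exact: continuous_measurable_rV.
Qed.

End box_support.

Section partial_slices.
Context {R : realType} {n : nat}.
Implicit Types (f : 'rV[R]_n.+1 -> R) (y : 'rV[R]_n) (t : R).
Local Notation cons t y := (rV_cons ((t : measurableTypeR R), y)).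

Lemma rV_consDl t u y :
  cons (t + u) y = cons t y + u *: (delta_mx 0 ord0 : 'rV[R]_n.+1).
Proof.
apply/rowP => i; rewrite [RHS]mxE [X in _ = _ + X]mxE [X in _ = _ + _ * X]mxE eqxx/=.
case: (unliftP ord0 i) => [j|] ->; rewrite ?rV_consS ?rV_cons0/= ?mulr1//.
by rewrite mulr0 addr0.
Qed.

Lemma rV_consDr t y j u : cons t (y + u *: (delta_mx 0 j : 'rV[R]_n)) =
  cons t y + u *: (delta_mx 0 (lift ord0 j) : 'rV[R]_n.+1).
Proof.
apply/rowP => i; rewrite [RHS]mxE [X in _ = _ + X]mxE [X in _ = _ + _ * X]mxE eqxx/=.
case: (unliftP ord0 i) => [k|] ->; rewrite ?rV_consS ?rV_cons0/=.
  by rewrite !mxE eqxx/= (inj_eq lift_inj).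
by rewrite mulr0 addr0.
Qed.

Lemma continuous_rV_consr t : continuous (fun y : 'rV[R]_n => cons t y).
Proof.
move=> y A /nbhs_ballP[e /= e0 eA]; apply/nbhs_ballP; exists e => // z yz.
apply: eA; move: yz; rewrite !rV_ballE//= => yz i.
by case: (unliftP ord0 i) => [j|] ->; rewrite ?rV_consS ?rV_cons0/= ?subrr ?normr0.
Qed.

Lemma continuous_rV_consl y : continuous (fun t => cons t y : 'rV[R]_n.+1).
Proof.
move=> t A /nbhs_ballP[e /= e0 eA]; apply/nbhs_ballP; exists e => // z tz.
apply: eA; rewrite rV_ballE//= => i.
by case: (unliftP ord0 i) => [j|] ->; rewrite ?rV_consS ?rV_cons0/= ?subrr ?normr0.
Qed.

Lemma is_derive_slicel f t y : derivable f (cons t y) (delta_mx 0 ord0) ->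
  is_derive t (1 : R) (fun u => f (cons u y)) (partial ord0 f (cons t y)).
Proof.
move=> df.
have E u : cons u y = cons 0 y + u *: (delta_mx 0 ord0 : 'rV[R]_n.+1).
  by rewrite -rV_consDl add0r.
have -> : (fun u => f (cons u y)) =
    (fun u => f (cons 0 y + u *: (delta_mx 0 ord0 : 'rV[R]_n.+1))).
  by apply/funext => u; rewrite E.
by apply/is_derive_lineP; rewrite -E; exact: derivableP.
Qed.

Lemma is_derive_slicer f t y j : derivable f (cons t y) (delta_mx 0 (lift ord0 j)) ->
  is_derive y (delta_mx 0 j : 'rV[R]_n) (fun z => f (cons t z))
    (partial (lift ord0 j) f (cons t y)).
Proof.
move=> df; rewrite -[y in is_derive y](addr0 y) -[X in _ + X](scale0r (delta_mx 0 j : 'rV[R]_n)).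
apply/is_derive_lineP.
have -> : (fun u : R => f (cons t (y + u *: (delta_mx 0 j : 'rV[R]_n)))) =
    (fun u => f (cons t y + u *: (delta_mx 0 (lift ord0 j) : 'rV[R]_n.+1))).
  by apply/funext => u; rewrite rV_consDr.
by apply/is_derive_lineP; rewrite scale0r addr0; exact: derivableP.
Qed.

End partial_slices.

(** * Integrals of partial derivatives *)

Section integration_by_parts.
Context {R : realType}.

(** The strict inequality makes the outer region open, so [f] vanishes in a neighbourhood of each of
    its points. *)
Lemma partial_outside_box N (f : 'rV[R]_N -> R) i M :
  box_supported M f -> box_supported M (partial i f).
Proof.
move=> fM x [j Mj]; rewrite /partial -[RHS](derive_cst (0 : R) x (delta_mx 0 i)).
apply: near_eq_derive.
have e0 : 0 < `|x 0 j| - M by rewrite subr_gt0.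
apply/nbhs_ballP; exists (`|x 0 j| - M) => // z; rewrite rV_ballE//= => /(_ j) xz.
apply: fM; exists j; have := lerB_dist (x 0 j) (z 0 j).
by move=> /le_lt_trans/(_ xz); lra.
Qed.

Lemma integral_line_derivative (g dg : R -> R) (M : R) :
  (forall t, is_derive t (1 : R) g (dg t)) -> continuous dg ->
  (forall t, M < `|t| -> g t = 0) -> (forall t, M < `|t| -> dg t = 0) ->
  (\int[@lebesgue_measure R]_t (dg t)%:E = 0)%E.
Proof.
(* [M] may be negative, whereas [-K, K] has to be a genuine interval containing the support. *)
move=> Dg cdg gM dgM; pose K : R := `|M| + 1.
have MK : M < K by rewrite ltr_pwDr// ler_norm.
have K0 : 0 < K by rewrite ltr_pwDr.
have cg : continuous g.
  by move=> /= t; have [/derivable1_diffP/differentiable_continuous + _] := Dg t; exact.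
transitivity (\int[@lebesgue_measure R]_(t in [set` `[- K, K]%R]) (dg t)%:E)%E.
  rewrite [RHS]integral_mkcond; apply: eq_integral => t _; rewrite patchE.
  case: ifPn => //; rewrite notin_setE/= in_itv/= -ler_norml => /negP.
  by rewrite -ltNge => Kt; rewrite dgM// (lt_trans MK).
rewrite (@continuous_FTC2 _ dg g).
- by rewrite !gM ?subee//= ?normrN gtr0_norm.
- by rewrite gtrN.
- exact: continuous_subspaceT.
- split=> [t _||]; first by have [] := Dg t.
  + by apply: cvg_at_right_filter; exact: cg.
  + by apply: cvg_at_left_filter; exact: cg.
- by move=> t _; rewrite derive1E; have [_] := Dg t.
Qed.

(** The order of integration depends on [i]: for the first coordinate the inner integral runs along
    a line and the fundamental theorem of calculus applies; for any other it runs over the remaining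
    coordinates and vanishes by induction. *)
Lemma integral_partial0 N (f : 'rV[R]_N -> R) i M C :
  (forall x, derivable f x (delta_mx 0 i)) -> continuous (partial i f) ->
  (forall x, `|partial i f x| <= C) -> box_supported M f ->
  (\int[lebesgue_measure_rV N]_x (partial i f x)%:E = 0)%E.
Proof.
elim: N f i => [f []//|N IH f i] df cf fC fM.
have pM := partial_outside_box i fM.
have mf := continuous_measurable_rV cf.
have mfE : measurable_fun setT (EFin \o partial i f) by exact/measurable_EFinP.
have intf := integrable_box mf fC pM.
case: (unliftP ord0 i) => [j ij|i0]; subst i.
- rewrite (integral_rVS mfE intf) integral0_eq// => t _.
  have D y := is_derive_slicer (df (rV_cons ((t : measurableTypeR R), y))).
  have E : partial j (fun y => f (rV_cons ((t : measurableTypeR R), y))) =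
      fun y => partial (lift ord0 j) f (rV_cons ((t : measurableTypeR R), y)).
    by apply/funext => y; have [_] := D y.
  rewrite -[RHS](IH (fun y => f (rV_cons ((t : measurableTypeR R), y))) j).
  + by rewrite E.
  + by move=> y; have [] := D y.
  + rewrite E => y; apply: continuous_comp; first exact: continuous_rV_consr.
    exact: cf.
  + by move=> y; rewrite E.
  + by move=> y [k Mk]; apply: fM; exists (lift ord0 k); rewrite rV_consS.
- rewrite (integral_rVS_sym mfE intf) integral0_eq// => y _.
  apply: (@integral_line_derivative (fun t => f (rV_cons ((t : measurableTypeR R), y))) _ M).
  + by move=> t; apply: is_derive_slicel.
  + move=> t; apply: continuous_comp; first exact: continuous_rV_consl.
    exact: cf.
  + by move=> t Mt; apply: fM; exists ord0; rewrite rV_cons0.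
  + by move=> t Mt; apply: pM; exists ord0; rewrite rV_cons0.
Qed.

End integration_by_parts.

Lemma integrable_sumR d (T : measurableType d) (R : realType)
    (m : {measure set T -> \bar R}) (J : Type) (r : seq J) (F : J -> T -> R) :
  (forall j, m.-integrable setT (EFin \o F j)) ->
  m.-integrable setT (EFin \o (fun x => \sum_(j <- r) F j x)).
Proof.
move=> iF; elim: r => [|j r IH].
  rewrite (_ : _ \o _ = cst 0%E); first exact: integrable0.
  by apply/funext => x /=; rewrite big_nil.
rewrite (_ : _ \o _ = ((EFin \o F j) \+ (EFin \o (fun x => (\sum_(j <- r) F j x)%R)))%E).
  exact: integrableD.
by apply/funext => x /=; rewrite big_cons.
Qed.

Lemma Rintegral_sumR d (T : measurableType d) (R : realType)
    (m : {measure set T -> \bar R}) (J : Type) (r : seq J) (F : J -> T -> R) :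
  (forall j, m.-integrable setT (EFin \o F j)) ->
  \int[m]_x (\sum_(j <- r) F j x) = \sum_(j <- r) \int[m]_x F j x.
Proof.
move=> iF; elim: r => [|j r IH].
  rewrite big_nil -[RHS](@Rintegral_set0 _ T R m (fun=> 0)).
  under eq_Rintegral do rewrite big_nil.
  by rewrite Rintegral_set0 /Rintegral integral0.
rewrite big_cons -IH -RintegralD//; last exact: integrable_sumR.
by apply: eq_Rintegral => x _; rewrite big_cons.
Qed.

(** * Test functions *)

Section test_functions.
Context {R : realType} {N : nat}.
Implicit Types (f phi : 'rV[R]_N -> R).
Local Notation muN := (lebesgue_measure_rV N).

(** Support in a box replaces compactness of the closure: it passes to derivatives by
    [partial_outside_box] and yields integrability by [integrable_box]. *)
Definition test phi := smooth_on setT phi /\ exists M, box_supported M phi.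

Lemma test_functionP phi : test_function phi -> test phi.
Proof.
case=> /smooth_onT sphi /compact_bounded[M0 [_ HM]]; split=> //.
exists (`|M0| + 1) => x [i xi]; apply: contrapT => /eqP px.
have /HM/(_ x) : M0 < `|M0| + 1 by rewrite ltr_pwDr// ler_norm.
have : closure [set x | phi x != 0] x by exact: subset_closure.
move=> /[swap] /[apply]; apply/negP; rewrite -ltNge (lt_le_trans xi)//.
rewrite [leRHS]mx_normrE.
exact: (le_bigmax _ (fun ij : 'I_1 * 'I_N => `|x ij.1 ij.2|) (0, i)).
Qed.

Lemma test_compactly_supported phi : test phi -> compactly_supported phi.
Proof. by case=> sp Mp; split=> // x; exact: smooth_on_continuous sp _. Qed.

Lemma smooth_continuous f : smooth_on setT f -> continuous f.
Proof. by move=> sf x; exact: smooth_on_continuous sf _. Qed.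

Lemma test_partial i phi : test phi -> test (partial i phi).
Proof.
case=> sp [M Mp]; split; first exact: smooth_on_partial.
by exists M; exact: partial_outside_box.
Qed.

Lemma test_partials I phi : test phi -> test (partials I phi).
Proof. by move=> tp; elim: I => //= i I; exact: test_partial. Qed.

Lemma testM f phi : smooth_on setT f -> test phi -> test (f \* phi).
Proof.
move=> sf [sp [M Mp]]; split; first exact: smooth_onM openT sf sp.
by exists M => x /Mp /= ->; rewrite mulr0.
Qed.

Lemma test_sum (J : Type) (r : seq J) (F : J -> 'rV[R]_N -> R) :
  (forall j, test (F j)) -> test (fun x => \sum_(j <- r) F j x).
Proof.
move=> tF; split; first by apply: smooth_on_sum; [exact: openT|move=> j; case: (tF j)].
elim: r => [|j r [M HM]]; first by exists 0 => x _; rewrite big_nil.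
have [_ [M' HM']] := tF j; exists (Num.max M M') => x [i].
rewrite gt_max => /andP[Mx M'x]; rewrite big_cons HM ?HM' ?addr0//; by exists i.
Qed.

Lemma test_eulerf phi : test phi -> test (eulerf phi).
Proof.
move=> tp; apply: test_sum => i.
by apply: testM (test_partial i tp); exact: smooth_on_coord openT.
Qed.

Lemma test_iter_eulerf i phi : test phi -> test (iter i eulerf phi).
Proof. by move=> tp; elim: i => //= i; exact: test_eulerf. Qed.

Lemma smooth_euler_adjf f : smooth_on setT f -> smooth_on setT (euler_adjf f).
Proof.
move=> sf; apply: smooth_onN openT _; apply: smooth_on_sum openT _ => i.
exact: smooth_on_partial (smooth_onM openT (smooth_on_coord i openT) sf).
Qed.

Lemma smooth_iter_euler_adjf i f : smooth_on setT f ->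
  smooth_on setT (iter i euler_adjf f).
Proof. by move=> sf; elim: i => //= i; exact: smooth_euler_adjf. Qed.

Lemma integrable_testM f phi : continuous f -> test phi ->
  muN.-integrable setT (EFin \o (f \* phi)).
Proof.
move=> cf /test_compactly_supported [cp [M Mp]].
apply: compactly_supported_integrable; split.
  by move=> x; exact: continuousM (cf x) (cp x).
by exists M => x /Mp /= ->; rewrite mulr0.
Qed.

Lemma Rintegral_by_parts f phi i : smooth_on setT f -> test phi ->
  \int[muN]_x (partial i f x * phi x) = - \int[muN]_x (f x * partial i phi x).
Proof.
move=> sf tp; have [sp _] := tp; have tfp := testM sf tp.
have [sfp [M Mfp]] := tfp.
have tpfp := test_partial i tfp.
have [C _ HC] := compactly_supported_bounded (test_compactly_supported tpfp).
have int0 : \int[muN]_x partial i (f \* phi) x = 0.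
  rewrite /Rintegral (@integral_partial0 _ _ (f \* phi) i M C)//.
  - by move=> x; exact: smooth_on_derivable sfp _.
  - exact: smooth_continuous (smooth_on_partial i sfp).
have cpf := smooth_continuous (smooth_on_partial i sf).
apply/eqP; rewrite -addr_eq0 -RintegralD//; last 2 first.
- exact: (integrable_testM cpf tp).
- exact: (integrable_testM (smooth_continuous sf) (test_partial i tp)).
rewrite -[X in _ == X]int0; apply/eqP; apply: eq_Rintegral => x _.
by rewrite (partialM i sf sp (I : setT x)) addrC [phi x * _]mulrC.
Qed.

(** Moving the outermost derivative first reverses their order. The [rev] is kept, since
    distributional derivatives produce the same one in [distribution_partialsE]. *)
Lemma Rintegral_partials I f phi : smooth_on setT f -> test phi ->
  \int[muN]_x (partials I f x * phi x) =
  (-1) ^+ size I * \int[muN]_x (f x * partials (rev I) phi x).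
Proof.
elim: I phi => [|i I IH] phi sf tp; first by rewrite mul1r.
rewrite [partials _ _]/= (Rintegral_by_parts _ (smooth_on_partials I sf) tp).
rewrite IH//; last exact: test_partial.
by rewrite exprS mulN1r mulNr rev_cons /partials foldr_rcons.
Qed.

Lemma Rintegral_euler_adjf f phi : smooth_on setT f -> test phi ->
  \int[muN]_x (euler_adjf f x * phi x) = \int[muN]_x (f x * eulerf phi x).
Proof.
move=> sf tp; pose xf i (x : 'rV[R]_N) : R := x 0 i * f x.
have sxf i : smooth_on setT (xf i) by exact: smooth_onM openT (smooth_on_coord i openT) sf.
transitivity (\sum_i - \int[muN]_x (partial i (xf i) x * phi x)).
  rewrite sumrN -Rintegral_sumR; last first.
    by move=> i; exact: (integrable_testM (smooth_continuous (smooth_on_partial i (sxf i))) tp).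
  rewrite -[RHS]mulN1r -RintegralZl//; last first.
    apply: integrable_sumR => i.
    exact: (integrable_testM (smooth_continuous (smooth_on_partial i (sxf i))) tp).
  by apply: eq_Rintegral => x _; rewrite mulN1r -mulr_suml mulNr.
transitivity (\sum_i \int[muN]_x (xf i x * partial i phi x)).
  by apply: eq_bigr => i _; rewrite (Rintegral_by_parts _ (sxf i) tp) opprK.
rewrite -Rintegral_sumR; last first.
  by move=> i; exact: (integrable_testM (smooth_continuous (sxf i)) (test_partial i tp)).
apply: eq_Rintegral => x _; rewrite /eulerf mulr_sumr; apply: eq_bigr => i _.
by rewrite /xf -mulrA mulrCA.
Qed.

Lemma Rintegral_iter_euler_adjf i f phi : smooth_on setT f -> test phi ->
  \int[muN]_x (iter i euler_adjf f x * phi x) = \int[muN]_x (f x * iter i eulerf phi x).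
Proof.
elim: i phi => [//|i IH] phi sf tp.
refine (etrans (Rintegral_euler_adjf (smooth_iter_euler_adjf i sf) tp) _).
by rewrite (IH _ sf (test_eulerf tp)) -iterSr.
Qed.

End test_functions.

(** * Regularisation of the singularity *)

Section kernel.
Context {R : realType} {N : nat}.
Hypothesis N0 : (0 < N)%N.
Implicit Types (x : 'rV[R]_N) (eps : R).
Local Notation muN := (lebesgue_measure_rV N).

(* What [euler_adjf] makes of [inorm eps ^ N], up to sign. *)
Definition kernel eps x : R := N%:R * eps * inorm eps x ^+ N.+2.

Lemma inorm_ge0 eps x : 0 <= inorm eps x.
Proof. by rewrite invr_ge0 sqrtr_ge0. Qed.

Lemma kernel_ge0 eps x : 0 <= eps -> 0 <= kernel eps x.
Proof.
move=> e0; apply: mulr_ge0; first by rewrite mulr_ge0.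
by rewrite exprn_ge0// inorm_ge0.
Qed.

Lemma smooth_on_inormX eps k U : 0 < eps -> open U ->
  smooth_on U (fun x : 'rV[R]_N => inorm eps x ^+ k).
Proof.
move=> e0 oU; elim: k => [|k IH]; first exact: smooth_on_cst.
apply: (smooth_on_eq oU) (smooth_onM oU (smooth_on_inorm e0 oU) IH).
by move=> x _; rewrite exprS.
Qed.

Lemma continuous_inormX eps k : 0 < eps -> continuous (fun x : 'rV[R]_N => inorm eps x ^+ k).
Proof. by move=> e0 x; exact: (smooth_on_continuous (smooth_on_inormX k e0 openT)). Qed.

Lemma continuous_kernel eps : 0 < eps -> continuous (kernel eps).
Proof.
move=> e0 x; apply: (@continuousM _ _ (cst (N%:R * eps)) (fun x => inorm eps x ^+ N.+2)).
  exact: cst_continuous.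
exact: continuous_inormX.
Qed.

Lemma integral_kernel eps : 0 < eps ->
  (\int[muN]_x (kernel eps x)%:E = (omega R N)%:E)%E.
Proof. exact: integral_omega. Qed.

Lemma integrable_kernel eps : 0 < eps ->
  muN.-integrable setT (EFin \o kernel eps).
Proof.
move=> e0; apply/integrableP; split.
  apply/measurable_EFinP; apply: continuous_measurable_rV; exact: continuous_kernel.
under eq_integral => x _.
  rewrite gee0_abs; last by rewrite lee_fin kernel_ge0// ltW.
  over.
by rewrite integral_kernel// ltry.
Qed.

Lemma Rintegral_kernel eps : 0 < eps -> \int[muN]_x kernel eps x = omega R N.
Proof. by move=> e0; rewrite /Rintegral integral_kernel. Qed.

Lemma omega_ge0 : 0 <= omega R N.
Proof.
rewrite -(@Rintegral_kernel 1)//; apply: Rintegral_ge0 => x _.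
exact: kernel_ge0.
Qed.

(* Away from the origin the kernels are dominated by multiples of [kernel 1]
   tending to zero with [eps]. *)
Lemma kernel_le r eps x : 0 < r -> 0 < eps -> r <= enorm2 x ->
  kernel eps x <= eps * (Num.sqrt (r / (1 + r)))^-1 ^+ N.+2 * kernel 1 x.
Proof.
move=> r0 e0 rx; set c := r / (1 + r).
have r10 : 0 < 1 + r by rewrite addr_gt0.
have c0 : 0 < c by rewrite divr_gt0.
have s0 : 0 < enorm2 x by rewrite (lt_le_trans r0).
(* Once r <= |x|^2, one has c (1 + |x|^2) <= |x|^2 <= eps + |x|^2. *)
have H : inorm eps x <= (Num.sqrt c)^-1 * inorm 1 x.
  rewrite /inorm -invfM -sqrtrM; last exact: ltW.
  rewrite lef_pV2 ?posrE ?sqrtr_gt0 ?mulr_gt0 ?addr_gt0 ?invr_gt0//.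
  rewrite ler_wsqrtr// /c mulrAC ler_pdivrMr// mulrDr mulr1 !mulrDr mulr1.
  have := mulr_ge0 (ltW e0) (ltW r10).
  nra.
apply: (@le_trans _ _ (N%:R * eps * ((Num.sqrt c)^-1 * inorm 1 x) ^+ N.+2)); last first.
  by rewrite le_eqVlt; apply/orP; left; apply/eqP; rewrite /kernel exprMn; ring.
apply: ler_wpM2l; first by rewrite mulr_ge0// ltW.
have sc0 : 0 <= (Num.sqrt c)^-1 * inorm 1 x.
  by rewrite mulr_ge0 ?inorm_ge0// invr_ge0 sqrtr_ge0.
by rewrite lerXn2r ?nnegrE ?inorm_ge0.
Qed.

(** Near the origin continuity of [psi] is weighed against the total mass; elsewhere [psi] is
    bounded and [kernel_le] makes the kernel of order eps. The two bounds are added inside one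
    integrand, so that the domain is never split. *)
Lemma kernel_approximates_delta (psi : 'rV[R]_N -> R) : compactly_supported psi ->
  (fun m => \int[muN]_x (kernel m.+1%:R^-1 x * psi x)) @ \oo --> omega R N * psi 0.
Proof.
move=> cpsi; have [C C0 HC] := compactly_supported_bounded cpsi.
have [psic [M psiM]] := cpsi.
apply/cvgrPdist_le => e e0.
(* A positive divisor, since so far omega is only known to be nonnegative. *)
pose w := omega R N + 1; have w0 : 0 < w by rewrite ltr_wpDl// omega_ge0.
pose del := e / 2 / w; have del0 : 0 < del by rewrite !divr_gt0.
have /cvgrPdist_le/(_ _ del0)/nbhs_ballP[r /= r0 Hr] := psic 0.
pose K := (Num.sqrt (r ^+ 2 / (1 + r ^+ 2)))^-1 ^+ N.+2.
have r20 : 0 < r ^+ 2 by rewrite exprn_gt0.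
have K0 : 0 <= K by rewrite exprn_ge0// invr_ge0 sqrtr_ge0.
have Q0 : 0 < 2 * C * (K + 1) * w by rewrite !mulr_gt0// ltr_wpDl.
have Q1 : 0 < e / 2 / (2 * C * (K + 1) * w) by rewrite divr_gt0// divr_gt0.
near=> m.
have : m.+1%:R^-1 <= e / 2 / (2 * C * (K + 1) * w).
  by apply: ltW; near: m; exact: (near_infty_natSinv_lt (PosNum Q1)).
set eps : R := m.+1%:R^-1 => epsQ.
have eps0 : 0 < eps by rewrite invr_gt0.
have ik := integrable_kernel eps0; have ik1 := @integrable_kernel 1 ltr01.
have ikpsi : muN.-integrable setT (EFin \o (fun x => kernel eps x * psi x)).
  apply: compactly_supported_integrable; split.
    by move=> x; exact: continuousM (@continuous_kernel _ eps0 x) (psic x).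
  by exists M => x /psiM ->; rewrite mulr0.
have ikc : muN.-integrable setT (EFin \o (fun x => kernel eps x * psi 0)).
  exact: integrableZrR.
have -> : omega R N * psi 0 = \int[muN]_x (kernel eps x * psi 0).
  by rewrite RintegralZr// Rintegral_kernel.
rewrite distrC -RintegralB//.
have idiff := integrableBR ikpsi ikc.
have idel := integrableZlR del ik.
have iK := integrableZlR (2 * C * (eps * K)) ik1.
apply: le_trans (le_normr_Rintegral _ idiff) _ => //.
have iabs := integrable_normR idiff.
apply: (@le_trans _ _ (\int[muN]_x (del * kernel eps x + 2 * C * (eps * K) * kernel 1 x))).
  apply: le_Rintegral => //; first exact: integrableDR.
  move=> x _; rewrite -mulrBr normrM ger0_norm; last exact: kernel_ge0 (ltW eps0).
  have k0 := @kernel_ge0 eps x (ltW eps0).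
  have k10 := @kernel_ge0 1 x ler01.
  have CeK : 0 <= 2 * C * (eps * K).
    by apply: mulr_ge0; apply: mulr_ge0 => //; exact: ltW.
  have [xr|xr] := ltP (enorm2 x) (r ^+ 2).
    have : `|psi x - psi 0| <= del.
      rewrite distrC; apply: Hr; rewrite rV_ballE//= => i.
      rewrite mxE sub0r normrN (le_lt_trans (coord_le_enorm x i))//.
      by rewrite -(@ltr_pXn2r _ 2) ?nnegrE ?enorm_ge0 ?ltW// sqr_enorm.
    move=> H; apply: (@le_trans _ _ (del * kernel eps x)).
      by rewrite mulrC ler_wpM2r.
    by rewrite lerDl mulr_ge0.
  have H : `|psi x - psi 0| <= 2 * C.
    by rewrite mulr2n mulrDl mul1r (le_trans (ler_normB _ _))// lerD.
  have HK := kernel_le r20 eps0 xr; rewrite -/K in HK.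
  apply: (@le_trans _ _ (2 * C * (eps * K) * kernel 1 x)); last first.
    by have d0' := ltW del0; rewrite lerDr mulr_ge0.
  by rewrite -mulrA [leLHS]mulrC; apply: ler_pM.
rewrite RintegralD// (RintegralZl del measurableT ik).
rewrite (RintegralZl (2 * C * (eps * K)) measurableT ik1) !Rintegral_kernel//.
have wr0 := omega_ge0; have w'0 : omega R N <= w by rewrite lerDl.
rewrite [leRHS](splitr e) lerD//.
  have -> : e / 2 = del * w by rewrite /del divfK// gt_eqF.
  by apply: ler_wpM2l => //; exact: ltW.
move: epsQ; rewrite ler_pdivlMr// => H; apply: le_trans H.
have -> : 2 * C * (eps * K) * omega R N = eps * (2 * C * (K * omega R N)) by ring.
have -> : eps * (2 * C * (K + 1) * w) = eps * (2 * C * ((K + 1) * w)) by ring.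
apply: ler_wpM2l; first exact: ltW.
apply: ler_wpM2l; first by have C0' := ltW C0; rewrite mulr_ge0.
by apply: ler_pM => //; rewrite lerDl.
Unshelve. all: by end_near. Qed.

End kernel.

(** * Integrability of |x|^(1 - N) *)

Section weak_singularity.
Context {R : realType} {N : nat}.
Hypothesis N0 : (0 < N)%N.
Implicit Types (x : 'rV[R]_N) (f : 'rV[R]_N -> R).
Local Notation muN := (lebesgue_measure_rV N).

(** The weights sum to 1. At |x| comparable to the scale c = b / 2^j the kernel is of order c^-N,
    and the weight, proportional to c, supplies the remaining power of |x|. *)
Definition dyadic_kernel (b : R) (j : nat) x : R :=
  (1 / (2 ^ (j + 1))%:R) * kernel ((b / 2 ^+ j) ^+ 2) x.

Lemma dyadic_kernel_ge0 b j x : 0 < b -> 0 <= dyadic_kernel b j x.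
Proof.
by move=> b0; rewrite mulr_ge0 ?divr_ge0 ?kernel_ge0 ?exprn_ge0 ?divr_ge0 ?exprn_ge0// ltW.
Qed.

Lemma dyadic_scale (b r : R) : 0 < r -> r <= b ->
  exists j, b / 2 ^+ j.+1 < r <= b / 2 ^+ j.
Proof.
move=> r0 rb; have b0 : 0 < b by apply: lt_le_trans rb.
have p0 j : 0 < 2 ^+ j :> R by rewrite exprn_gt0.
have exP : exists j, b / 2 ^+ j.+1 < r.
  exists (Num.truncn (b / r)); rewrite ltr_pdivrMr// mulrC -ltr_pdivrMr//.
  apply: (@lt_trans _ _ (Num.truncn (b / r)).+1%:R).
    by apply: truncnS_gt.
  by rewrite -natrX ltr_nat ltn_expl.
case: (ex_minnP exP) => -[|j] Hj minj; [exists 0%N|exists j.+1]; rewrite Hj/=.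
  by rewrite expr0 divr1.
by rewrite leNgt; apply/negP => /minj; rewrite ltnn.
Qed.

(* A superposition of kernels at dyadic scales, all of mass [omega], dominates
   [|x|^(1 - N)]. *)
Lemma weak_singularity_le_dyadic (b : R) x : x != 0 -> enorm x <= b ->
  exists j, enorm x * (enorm x)^-1 ^+ N <=
    2 ^+ (2 * N + 3) * b / N%:R * dyadic_kernel b j x.
Proof.
move=> x0 xb; have r0 := enorm_gt0 x0.
have b0 : 0 < b by apply: lt_le_trans xb.
have NR0 : 0 < N%:R :> R by rewrite ltr0n.
have [j /andP[]] := dyadic_scale r0 xb.
exists j; rewrite /dyadic_kernel /kernel.
set c := b / 2 ^+ j in b1 *.
have c0 : 0 < c by rewrite divr_gt0// exprn_gt0.
have c2 : c / 2 < enorm x by move: a; rewrite /c exprSr invfM mulrA.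
have -> : 1 / (2 ^ (j + 1))%:R = c / (2 * b).
  rewrite natrX exprD expr1 /c; field.
  by rewrite !gt_eqF// exprn_gt0.
clearbody c.
(* Here |x| <= c, so c^2 + |x|^2 <= 2 c^2 <= (2 c)^2. *)
have zc : (2 * c)^-1 <= inorm (c ^+ 2) x.
  have s0 : 0 < c ^+ 2 + enorm2 x by rewrite ltr_wpDr ?enorm2_ge0// exprn_gt0.
  rewrite /inorm lef_pV2 ?posrE ?sqrtr_gt0 ?mulr_gt0//.
  have c20 : 0 <= 2 * c by rewrite mulr_ge0// ltW.
  rewrite -[leRHS](ger0_norm c20) -sqrtr_sqr ler_wsqrtr//.
  have H : enorm x ^+ 2 <= c ^+ 2 by rewrite lerXn2r// nnegrE ltW.
  rewrite -sqr_enorm [leRHS]exprMn; have := sqr_ge0 c; move: H.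
  by move: (c ^+ 2) (enorm x ^+ 2) => p q pq p0; lra.
apply: (@le_trans _ _ (c * (2 / c) ^+ N)).
  apply: ler_pM => //; [exact: ltW|by rewrite exprn_ge0// invr_ge0 ltW|].
  have hc : 0 <= 2 / c by rewrite mulr_ge0// invr_ge0 ltW.
  rewrite lerXn2r ?nnegrE ?hc ?invr_ge0 ?(ltW r0)//.
  by rewrite -invf_div lef_pV2 ?posrE ?divr_gt0// ltW.
(* The constant is the quotient of c (2/c)^N by the lower bound of the weighted kernel, N c^3 (2
   c)^(-N - 2) / (2 b); the powers of c cancel. *)
apply: (@le_trans _ _ (2 ^+ (2 * N + 3) * b / N%:R *
   (c / (2 * b) * (N%:R * c ^+ 2 * (2 * c)^-1 ^+ N.+2)))); last first.
  have zz : 0 <= (2 * c)^-1 by rewrite invr_ge0 mulr_ge0// ltW.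
  apply: ler_wpM2l; first by rewrite !mulr_ge0 ?invr_ge0 ?exprn_ge0// ltW.
  apply: ler_wpM2l; first by rewrite divr_ge0 ?mulr_ge0// ltW.
  apply: ler_wpM2l; first by rewrite mulr_ge0 ?exprn_ge0// ltW.
  by rewrite lerXn2r ?nnegrE ?inorm_ge0.
rewrite le_eqVlt; apply/orP; left; apply/eqP.
have cn : c ^+ N != 0 by rewrite expf_neq0// gt_eqF.
have -> : (2 * c)^-1 ^+ N.+2 = (2 ^+ N)^-1 * (c ^+ N)^-1 * (2 * c)^-1 ^+ 2.
  by rewrite -(addn2 N) exprD; congr (_ * _); rewrite exprVn exprMn invfM.
rewrite exprD mulnC exprM expr_div_n; field.
by rewrite cn !gt_eqF// exprn_gt0.
Qed.

Lemma integral_dyadic_kernel b j : 0 < b ->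
  (\int[muN]_x (dyadic_kernel b j x)%:E = (omega R N / (2 ^ (j + 1))%:R)%:E)%E.
Proof.
move=> b0; rewrite /dyadic_kernel.
have e0 : 0 < (b / 2 ^+ j) ^+ 2 by rewrite exprn_gt0// divr_gt0// exprn_gt0.
under eq_integral do rewrite EFinM.
rewrite ge0_integralZl//.
- by rewrite integral_kernel// -EFinM div1r mulrC.
- by apply/measurable_EFinP; apply: continuous_measurable_rV; exact: continuous_kernel.
- by move=> x _; rewrite lee_fin kernel_ge0// ltW.
Qed.

Lemma measurable_dyadic_kernel b j : 0 < b ->
  measurable_fun setT (fun x => (dyadic_kernel b j x)%:E).
Proof.
move=> b0; have e0 : 0 < (b / 2 ^+ j) ^+ 2 by rewrite exprn_gt0// divr_gt0// exprn_gt0.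
apply/measurable_EFinP; apply: measurable_funM => //.
by apply: continuous_measurable_rV; exact: continuous_kernel.
Qed.

Lemma integral_dyadic_series b : 0 < b ->
  (\int[muN]_x (\sum_(0 <= j <oo) (dyadic_kernel b j x)%:E) = (omega R N)%:E)%E.
Proof.
move=> b0; rewrite integral_nneseries//; last 2 first.
- by move=> j; exact: measurable_dyadic_kernel.
- by move=> j x _; rewrite lee_fin dyadic_kernel_ge0.
under eq_eseriesr do rewrite integral_dyadic_kernel//.
have := @cvg_geometric_eseries_half R (omega R N) 0.
by move/cvg_lim => ->//; rewrite expr0 divr1.
Qed.

(** At each point [f] is bounded by a multiple of one dyadic kernel, hence by the same multiple of
    the whole series, whose integral is omega. *)
Lemma weakly_singular_integrable f (A b : R) : 0 < b -> 0 <= A ->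
  measurable_fun setT f -> (forall x, b < enorm x -> f x = 0) ->
  (forall x, x != 0 -> enorm x <= b -> `|f x| <= A * (enorm x * (enorm x)^-1 ^+ N)) ->
  muN.-integrable setT (EFin \o f).
Proof.
move=> b0 A0 mf fb fA.
pose C := 2 ^+ (2 * N + 3) * b / N%:R : R.
have C0 : 0 <= C by rewrite !mulr_ge0 ?invr_ge0// ltW.
have k00 : 0 < dyadic_kernel b 0 0.
  apply: mulr_gt0; first by rewrite divr_gt0// ltr0n.
  have e0 : 0 < (b / 2 ^+ 0) ^+ 2 by rewrite exprn_gt0// divr_gt0.
  apply: mulr_gt0; first by rewrite mulr_gt0// ltr0n.
  by rewrite exprn_gt0// invr_gt0 sqrtr_gt0 enorm2_0 addr0.
(* The second summand covers the origin, where no bound on [f] is assumed. *)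
pose B := A * C + `|f 0| / dyadic_kernel b 0 0.
have B1 : A * C <= B by rewrite lerDl; exact: divr_ge0 (normr_ge0 _) (ltW k00).
have B0 : 0 <= B by rewrite (le_trans _ B1)// mulr_ge0.
have dk0 x j : 0 <= dyadic_kernel b j x by exact: dyadic_kernel_ge0.
have fB x : exists j, `|f x| <= B * dyadic_kernel b j x.
  have [->|x0] := eqVneq x 0.
    exists 0%N; rewrite -ler_pdivrMr// lerDr mulr_ge0//.
  have [xb|bx] := leP (enorm x) b; last first.
    by exists 0%N; rewrite fb// normr0 mulr_ge0.
  have [j Hj] := weak_singularity_le_dyadic x0 xb; exists j.
  apply: le_trans (fA _ x0 xb) _; apply: (@le_trans _ _ (A * C * dyadic_kernel b j x)).
    by rewrite -mulrA ler_wpM2l.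
  by rewrite ler_wpM2r.
have ms : measurable_fun setT (fun x => \sum_(0 <= j <oo) (dyadic_kernel b j x)%:E)%E.
  apply: (@ge0_emeasurable_sum _ _ _ _ _ xpredT) => [j x _ _|j _]; first by rewrite lee_fin.
  exact: measurable_dyadic_kernel.
apply/integrableP; split; first exact/measurable_EFinP.
apply: (@le_lt_trans _ _ (\int[muN]_x (B%:E * \sum_(0 <= j <oo) (dyadic_kernel b j x)%:E))%E).
  apply: ge0_le_integral => //.
  - by apply: measurableT_comp => //; exact/measurable_EFinP.
  - exact: measurable_funeM.
  move=> x _; have [j Hj] := fB x.
  apply: (@le_trans _ _ (B%:E * (dyadic_kernel b j x)%:E)%E).
    by rewrite -EFinM lee_fin.
  apply: lee_wpmul2l; first by rewrite lee_fin.
  rewrite (@nneseriesD1 _ _ j) => // [|i _]; last by rewrite lee_fin.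
  by rewrite leeDl// nneseries_ge0// => i _ _; rewrite lee_fin.
rewrite ge0_integralZl//.
  by rewrite integral_dyadic_series// -EFinM ltry.
by move=> x _; rewrite nneseries_ge0// => j _ _; rewrite lee_fin.
Qed.

End weak_singularity.

Section weakly_singular.
Context {R : realType} {n : nat}.
Local Notation N := n.+1.
Let N0 : (0 < N)%N := ltn0Sn n.
Implicit Types (x : 'rV[R]_N) (f q phi : 'rV[R]_N -> R).
Local Notation muN := (lebesgue_measure_rV N).

(** A continuous factor [q] in place of a constant allows growth at infinity and multiplication by
    any continuous function, while remaining bounded on compact sets. *)
Definition weakly_singular f := measurable_fun setT f /\
  exists2 q : 'rV[R]_N -> R, continuous q &
    forall x, x != 0 -> `|f x| <= q x * (enorm x * (enorm x)^-1 ^+ N).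

Lemma compact_measurable_rV (K : set 'rV[R]_N) : compact K -> measurable K.
Proof.
move=> cK; rewrite -[K]setCK; apply: measurableC; apply: open_measurable_rV.
apply: closed_openC; exact: compact_closed (@norm_hausdorff _ _) cK.
Qed.

Lemma measurable_rV_point x : measurable [set x].
Proof. by apply: compact_measurable_rV; exact: compact_set1. Qed.

Lemma weakly_singular_locally_integrable f : weakly_singular f ->
  locally_integrable_rV f.
Proof.
move=> [mf [q cq fq]] K cK; have mK := compact_measurable_rV cK.
have [b b0 Kb] := continuous_bounded_on_compact (@continuous_enorm R N) cK.
have [A A0 KA] := continuous_bounded_on_compact cq cK.
apply/(integrable_mkcond _ mK).
have -> : (EFin \o f) \_ K = EFin \o (f \* \1_K).
  apply/funext => x /=; rewrite patchE indicE; case: ifPn => _; first by rewrite mulr1.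
  by rewrite mulr0.
apply: (@weakly_singular_integrable R N N0 _ A b) => //; first exact: ltW.
- by apply: measurable_funM => //; exact: measurable_indic.
- move=> x bx /=; rewrite indicE memNset ?mulr0// => /Kb.
  by rewrite ger0_norm ?enorm_ge0// leNgt bx.
move=> x x0 _ /=; have e0 : 0 <= enorm x * (enorm x)^-1 ^+ N.
  by rewrite mulr_ge0 ?exprn_ge0 ?invr_ge0 ?enorm_ge0.
rewrite indicE; have [/set_mem xK|_] := boolP (x \in K).
  rewrite mulr1; apply: le_trans (fq x x0) _; apply: ler_wpM2r => //.
  by apply: le_trans (KA x xK); exact: ler_norm.
by rewrite mulr0 normr0; apply: mulr_ge0 => //; exact: ltW.
Qed.

Lemma weakly_singularM f phi : weakly_singular f -> continuous phi ->
  weakly_singular (f \* phi).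
Proof.
move=> [mf [q cq fq]] cphi; split.
  by apply: measurable_funM => //; exact: continuous_measurable_rV.
exists (fun x => q x * `|phi x|) => [x|x x0 /=].
  apply: (@continuousM _ _ q (fun x => `|phi x|)); first exact: cq.
  apply: (@continuous_comp _ _ _ phi Num.norm); first exact: cphi.
  exact: norm_continuous.
by rewrite normrM mulrAC; apply: ler_wpM2r => //; exact: fq.
Qed.

Lemma weakly_singular_integrable_test f phi : weakly_singular f -> test phi ->
  muN.-integrable setT (EFin \o (f \* phi)).
Proof.
move=> sf tphi; have [cphi [M Mphi]] := test_compactly_supported tphi.
pose K := [set v : 'rV[R]_N | forall i, [set` `[- M, M]] (v ord0 i)].
have cK : compact K.
  by apply: (@rV_compact R N (fun=> [set` `[- M, M]])) => i; exact: segment_compact.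
have := weakly_singular_locally_integrable (weakly_singularM sf cphi) cK.
move/(integrable_mkcond _ (compact_measurable_rV cK)); congr (integrable _ _ _).
apply/funext => x; rewrite patchE; case: ifPn => // /negP xK /=.
rewrite Mphi ?mulr0//.
apply/existsP; apply: contrapT => /negP/existsPn H; apply: xK; rewrite inE => i /=.
by rewrite in_itv/= -ler_norml leNgt H.
Qed.

(** The indicator of the origin is a product of indicators of a null set of the line. Positive
    dimension matters: in dimension 0 the measure is the Dirac mass at that point. *)
Lemma lebesgue_measure_rV_point0 : muN [set 0 : 'rV[R]_N] = 0%E.
Proof.
have m0 : measurable [set 0 : 'rV[R]_N].
  exact: measurable_rV_point.
have mg : measurable_fun setT (\1_[set 0 : R] : R -> R) by exact: measurable_indic.
have g0 (t : R) : 0 <= \1_[set 0 : R] t :> R by rewrite indicE; case: (_ \in _).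
have I0 : (\int[@lebesgue_measure R]_t (\1_[set 0 : R] t)%:E = 0)%E.
  rewrite integral_indic// setIT; exact: lebesgue_measure_set1.
have := integral_indic muN measurableT (measurable_rV_point 0); rewrite setIT => <-.
transitivity (\int[muN]_x (\prod_i \1_[set 0 : R] (x 0 i))%:E)%E.
  apply: eq_integral => x _; congr EFin; rewrite indicE.
  have [/set_mem ->|x0] := boolP (x \in _).
    by rewrite big1// => i _; rewrite indicE mem_set//= mxE.
  apply/esym/eqP/prodf_eq0.
  have [/existsP[i xi]|/existsPn H0] := boolP [exists i, x 0 i != 0].
    by exists i => //; rewrite indicE memNset//; apply/eqP.
  move: x0; rewrite notin_setE => -[]; apply/rowP => i; rewrite mxE.
  by apply/eqP; have := H0 i; rewrite negbK.
by rewrite integral_prod_coord// I0 expeS mul0e.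
Qed.

Lemma ae_punctured (P : 'rV[R]_N -> Prop) : (forall x, x != 0 -> P x) ->
  {ae muN, forall x, P x}.
Proof.
move=> HP; exists [set 0]; split=> //.
- exact: measurable_rV_point.
- exact: lebesgue_measure_rV_point0.
- by move=> x /= nPx; apply: contrapT => /eqP /HP.
Qed.

Lemma eq_Rintegral_punctured f g : (forall x, x != 0 -> f x = g x) ->
  measurable_fun setT f -> measurable_fun setT g ->
  \int[muN]_x f x = \int[muN]_x g x.
Proof.
move=> fg mf mg; congr fine; apply: ae_eq_integral => //.
- exact/measurable_EFinP.
- exact/measurable_EFinP.
by apply: ae_punctured => x x0 _; congr EFin; exact: fg.
Qed.

Lemma measurable_punctured f g : (forall x, x != 0 -> f x = g x) ->
  measurable_fun setT g -> measurable_fun setT f.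
Proof.
move=> fg mg.
have -> : f = g \+ (cst (f 0 - g 0) \* \1_[set 0]).
  apply/funext => x /=; rewrite indicE.
  have [/set_mem ->|] := boolP (x \in _); first by rewrite mulr1 subrKC.
  by rewrite notin_setE => /eqP x0; rewrite mulr0 addr0 fg.
apply: measurable_funD => //; apply: measurable_funM => //.
by apply: measurable_indic; exact: measurable_rV_point.
Qed.

End weakly_singular.

(** * Derivatives of the logarithm as quotients *)

Section log_numerator.
Context {R : realType} {n : nat}.
Local Notation N := n.+1.
Local Notation V := 'rV[R]_N.
Local Notation log := (@log_enorm R N).
Local Notation U := (@punctured R n).
Implicit Types (I : seq 'I_N) (x : V).

(** For nonempty I this is |x|^(2|I|) d_I log|x|, a homogeneous polynomial of degree |I|, and the
    recursion is the quotient rule. The value at the empty sequence is a filler, log|x| not being of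
    this form. *)
Fixpoint log_numerator I : V -> R :=
  if I is i :: J then
    if J is [::] then fun x => x 0 i
    else (enorm2 \* partial i (log_numerator J)) \+
         (cst (- 2 * (size J)%:R) \* ((fun x => x 0 i) \* log_numerator J))
  else cst 0.

Lemma smooth_on_log_numerator I : smooth_on setT (log_numerator I).
Proof.
elim: I => [|i [|j J] IH]; first exact: smooth_on_cst _ openT.
  exact: smooth_on_coord i openT.
apply: smooth_onD openT (smooth_onM openT (smooth_on_enorm2 openT) (smooth_on_partial i IH)) _.
exact: smooth_onM openT (smooth_on_cst _ openT) (smooth_onM openT (smooth_on_coord i openT) IH).
Qed.

Lemma smooth_on_inorm2X k : smooth_on U (fun x => inorm2 x ^+ k).
Proof.
have oU := @open_punctured R n; elim: k => [|k IH]; first exact: smooth_on_cst.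
apply: (smooth_on_eq oU) (smooth_onM oU (@smooth_on_inorm2 R n) IH).
by move=> x _; rewrite exprS.
Qed.

Lemma partial_inorm2X i k x : x != 0 ->
  partial i (fun y => inorm2 y ^+ k) x = - 2 * k%:R * x 0 i * inorm2 x ^+ k.+1.
Proof.
move=> x0; elim: k => [|k IH].
  rewrite mulr0 !mul0r; exact: derive_cst.
have -> : (fun y : V => inorm2 y ^+ k.+1) = inorm2 \* (fun y => inorm2 y ^+ k).
  by apply/funext => y; rewrite exprS.
refine (etrans (partialM i (@smooth_on_inorm2 R n) (smooth_on_inorm2X k) x0) _).
rewrite IH partial_inorm2// -natr1 !exprS; ring.
Qed.

Lemma partials_log I x : I != [::] -> x != 0 ->
  partials I log x = log_numerator I x * inorm2 x ^+ size I.
Proof.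
elim: I x => [//|i [|j J] IH] x _ x0; first exact: partial_log.
set K := j :: J in IH *; have sP := smooth_on_log_numerator K.
have sPU : smooth_on U (log_numerator K) by exact: smooth_on_subset sP.
have sV := smooth_on_inorm2X (size K).
transitivity (partial i (log_numerator K \* (fun y => inorm2 y ^+ size K)) x).
  by apply: (eq_on_partial i (@open_punctured R n) _ x0) => y /set_mem y0; exact: IH.
refine (etrans (partialM i sPU sV x0) _).
rewrite partial_inorm2X//.
rewrite -[log_numerator (i :: K) x]/(enorm2 x * partial i (log_numerator K) x +
  - 2 * (size K)%:R * (x 0 i * log_numerator K x)).
rewrite -[size (i :: K)]/(size K).+1.
have s0 : enorm2 x * inorm2 x = 1 by rewrite divff// gt_eqF// enorm2_gt0.
move: (partial i (log_numerator K) x) (log_numerator K x) => p q.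
transitivity ((enorm2 x * inorm2 x) * inorm2 x ^+ size K * p +
  q * (- 2 * (size K)%:R * x 0 i * inorm2 x ^+ (size K).+1)).
  by rewrite s0; ring.
by rewrite exprS; ring.
Qed.

(** Every summand of the recursion carries a factor |x|^2 or x_i. One power of |x| is all that is
    needed to pass from the non-integrable |x|^-N to a locally integrable function. *)
Lemma log_numerator_le I : exists2 q : V -> R, continuous q &
  forall x, `|log_numerator I x| <= q x * enorm x.
Proof.
case: I => [|i [|j J]].
- exists (cst 0) => [|x]; first exact: cst_continuous.
  by rewrite /= normr0 mul0r.
- exists (cst 1) => [|x]; first exact: cst_continuous.
  by rewrite /= mul1r coord_le_enorm.
set K := j :: J; have sP := smooth_on_log_numerator K.
have cP := smooth_continuous sP; have cdP := smooth_continuous (smooth_on_partial i sP).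
exists ((enorm \* (Num.norm \o partial i (log_numerator K))) \+
        (cst (2 * (size K)%:R) \* (Num.norm \o log_numerator K))) => x.
  apply: continuousD; apply: continuousM.
  - exact: continuous_enorm.
  - by apply: continuous_comp; [exact: cdP|exact: norm_continuous].
  - exact: cst_continuous.
  - by apply: continuous_comp; [exact: cP|exact: norm_continuous].
rewrite -[log_numerator (i :: K) x]/(enorm2 x * partial i (log_numerator K) x +
  - 2 * (size K)%:R * (x 0 i * log_numerator K x)).
rewrite /= mulrDl; apply: le_trans (ler_normD _ _) _; apply: lerD.
  by rewrite normrM ger0_norm ?enorm2_ge0// -sqr_enorm expr2 mulrAC.
rewrite !normrM normrN !normr_nat -!mulrA; do 2 apply: ler_wpM2l => //.
by rewrite mulrC; apply: ler_wpM2l => //; exact: coord_le_enorm.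
Qed.

Lemma measurable_enorm_inv : measurable_fun [set: V] (fun x => (enorm x)^-1 ^+ N).
Proof.
apply: measurable_funX; apply: (measurableT_comp (@measurable_invr R)).
by apply: continuous_measurable_rV; exact: continuous_enorm.
Qed.

Lemma weakly_singular_log I (S : V -> R) :
  (forall x, x != 0 -> S x = log_numerator I x * (enorm x)^-1 ^+ N) ->
  weakly_singular S.
Proof.
move=> SE; split.
  apply: (measurable_punctured SE); apply: measurable_funM.
    exact: continuous_measurable_rV (smooth_continuous (smooth_on_log_numerator I)).
  exact: measurable_enorm_inv.
have [q cq Pq] := log_numerator_le I; exists q => // x x0.
have e0 : 0 <= (enorm x)^-1 ^+ N by rewrite exprn_ge0// invr_ge0 enorm_ge0.
by rewrite SE// normrM (ger0_norm e0) mulrA; exact: ler_wpM2r.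
Qed.

End log_numerator.

(** * The regularised tensor and its limit *)

Section regularized_kernel.
Context {R : realType} {n : nat}.
Local Notation N := n.+1.
Local Notation V := 'rV[R]_N.
Implicit Types (x : V) (eps : R).
Local Notation muN := (lebesgue_measure_rV N).

Lemma partial_inormX eps i k x : 0 < eps ->
  partial i (fun y => inorm eps y ^+ k) x = - k%:R * x 0 i * inorm eps x ^+ k.+2.
Proof.
move=> e0; elim: k => [|k IH].
  rewrite oppr0 !mul0r; exact: derive_cst.
have -> : (fun y : V => inorm eps y ^+ k.+1) = inorm eps \* (fun y => inorm eps y ^+ k).
  by apply/funext => y; rewrite exprS.
refine (etrans (partialM i (smooth_on_inorm e0 openT) (smooth_on_inormX k e0 openT)
  (I : setT x)) _).
by rewrite IH partial_inorm// -natr1 !exprS; ring.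
Qed.

Lemma eulerf_inormX eps k x : 0 < eps ->
  eulerf (fun y => inorm eps y ^+ k) x = - k%:R * enorm2 x * inorm eps x ^+ k.+2.
Proof.
move=> e0; rewrite /eulerf /enorm2 mulr_sumr mulr_suml; apply: eq_bigr => i _.
by rewrite partial_inormX//; ring.
Qed.

Lemma radial_inormX eps k i x : 0 < eps ->
  enorm2 x * partial i (fun y => inorm eps y ^+ k) x =
  x 0 i * eulerf (fun y => inorm eps y ^+ k) x.
Proof. by move=> e0; rewrite eulerf_inormX// partial_inormX//; ring. Qed.

Lemma sqr_inorm eps x : 0 < eps -> inorm eps x ^+ 2 * (eps + enorm2 x) = 1.
Proof.
move=> e0; have s0 : 0 < eps + enorm2 x by rewrite ltr_wpDr// enorm2_ge0.
by rewrite exprVn sqr_sqrtr ?mulVf ?gt_eqF// ltW.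
Qed.

(** With z = (eps + |x|^2)^(-1/2), differentiating the coordinates gives N z^N and differentiating
    z^N gives - N |x|^2 z^(N + 2). For the exponent N the two combine to N eps z^(N + 2). *)
Lemma euler_adjf_inormN eps : 0 < eps ->
  euler_adjf (fun y : V => inorm eps y ^+ N) = (fun x => - kernel eps x).
Proof.
move=> e0; apply/funext => x; rewrite /euler_adjf; congr (- _).
have E (i : 'I_N) : partial i (fun y => y 0 i * inorm eps y ^+ N) x =
    inorm eps x ^+ N - N%:R * inorm eps x ^+ N.+2 * x 0 i ^+ 2.
  refine (etrans (partialM i (smooth_on_coord i openT) (smooth_on_inormX N e0 openT)
    (I : setT x)) _).
  rewrite partial_inormX// partial_coord eqxx mulr1.
  by move: (inorm eps x ^+ N) (inorm eps x ^+ N.+2) (N%:R : R) => a b c; ring.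
under eq_bigr do rewrite E.
rewrite sumrB sumr_const card_ord -mulr_sumr -/(enorm2 x).
rewrite -(mulr_natr (inorm eps x ^+ N)) /kernel -(addn2 N) exprD; move: (sqr_inorm x e0).
move: (inorm eps x ^+ N) (N%:R : R) (inorm eps x ^+ 2) => a c z zE.
by rewrite -[a * c]mulr1 -zE; ring.
Qed.

Lemma inorm_le eps x : 0 <= eps -> x != 0 -> inorm eps x <= (enorm x)^-1.
Proof.
move=> e0 x0; have s0 := enorm2_gt0 x0.
by rewrite lef_pV2 ?posrE ?sqrtr_gt0 ?ltr_wpDl// ler_wsqrtr// lerDr.
Qed.

Lemma inorm_cvg x : x != 0 -> inorm m.+1%:R^-1 x @[m --> \oo] --> (enorm x)^-1.
Proof.
move=> x0; have s0 := enorm2_gt0 x0.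
apply: cvgV; first by rewrite gt_eqF// sqrtr_gt0.
have H : m.+1%:R^-1 + enorm2 x @[m --> \oo] --> enorm2 x.
  rewrite -[X in _ --> X]add0r; apply: cvgD; last exact: cvg_cst.
  exact: (@cvg_harmonic R).
exact: (continuous_cvg _ (@sqrt_continuous R (enorm2 x)) H).
Qed.

(** Dominated convergence, the modulus of the limit being itself the majorant because [inorm eps x]
    is at most |x|^-1. *)
Lemma regularized_cvg (P S psi : V -> R) : continuous P -> weakly_singular S ->
  (forall x, x != 0 -> S x = P x * (enorm x)^-1 ^+ N) -> test psi ->
  \int[muN]_x (P x * inorm m.+1%:R^-1 x ^+ N * psi x) @[m --> \oo] -->
  \int[muN]_x (S x * psi x).
Proof.
move=> cP sS SE tpsi; have [cpsi _] := test_compactly_supported tpsi.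
pose F m x := P x * inorm m.+1%:R^-1 x ^+ N * psi x.
have e0 m : 0 < m.+1%:R^-1 :> R by rewrite invr_gt0.
have cF m : continuous (F m).
  move=> x; apply: (@continuousM _ _ (fun x => P x * inorm m.+1%:R^-1 x ^+ N) psi).
    apply: (@continuousM _ _ P (fun x => inorm m.+1%:R^-1 x ^+ N)); first exact: cP.
    exact: continuous_inormX.
  exact: cpsi.
have iS := weakly_singular_integrable_test sS tpsi.
have mF m : measurable_fun setT (EFin \o F m).
  by apply/measurable_EFinP; exact: continuous_measurable_rV.
have mS : measurable_fun setT (EFin \o (S \* psi)) by case/integrableP: iS.
have Fcvg : {ae muN, forall x, setT x -> (EFin \o F m) x @[m --> \oo] --> (EFin \o (S \* psi)) x}.
  apply: ae_punctured => x x0 _; apply: cvg_EFin; first exact: nearW.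
  apply: cvgM; last exact: cvg_cst.
  rewrite SE//; apply: cvgM; first exact: cvg_cst.
  exact: (continuous_cvg _ (@exprn_continuous R N (enorm x)^-1) (inorm_cvg x0)).
pose G x := `|S x * psi x|.
have Fle : {ae muN, forall x m, setT x -> (`|(EFin \o F m) x| <= (EFin \o G) x)%E}.
  apply: ae_punctured => x x0 m _; rewrite lee_fin /F /G SE// !normrM.
  apply: ler_wpM2r => //; apply: ler_wpM2l => //.
  rewrite !normrX; apply: lerXn2r; rewrite ?nnegrE//.
  rewrite !ger0_norm ?invr_ge0 ?enorm_ge0 ?inorm_ge0//.
  by apply: inorm_le => //; exact: ltW.
have [_ _ H] := dominated_convergence measurableT mF mS Fcvg (integrable_normR iS) Fle.
apply: fine_cvg; rewrite fineK//; exact: integrable_fin_num.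
Qed.

End regularized_kernel.

(** * The divergence of the singular tensor *)

Lemma distribution_partialsE (R : realType) (N : nat) (s : seq 'I_N)
    (S : @distribution R N) phi :
  distribution_partials s S phi = (-1) ^+ size s * S (partials (rev s) phi).
Proof.
elim: s phi => [|i s IH] phi; first by rewrite mul1r.
rewrite [LHS]/(- distribution_partials s S (partial i phi)) IH.
by rewrite exprS mulN1r mulNr rev_cons /partials foldr_rcons.
Qed.

Lemma cvg_bigsum (R : realType) (J : Type) (r : seq J) (F : J -> nat -> R) (l : J -> R) :
  (forall j, F j m @[m --> \oo] --> l j) ->
  \sum_(j <- r) F j m @[m --> \oo] --> \sum_(j <- r) l j.
Proof.
move=> Fl; elim: r => [|j r IH].
  rewrite big_nil; under eq_fun do rewrite big_nil; exact: cvg_cst.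
rewrite big_cons; under eq_fun do rewrite big_cons; exact: cvgD.
Qed.

Section divergence.
Context {R : realType} {n k : nat}.
Hypothesis k0 : (0 < k)%N.
Local Notation N := n.+1.
Local Notation V := 'rV[R]_N.
Local Notation log := (@log_enorm R N).
Implicit Types (x : V) (eps : R) (phi : V -> R).
Local Notation muN := (lebesgue_measure_rV N).

(** If the set defining [ell] has an element, evaluation at one nonzero vector identifies it with
    [l]. If it is empty, then [l], which is nonnegative, must be 0, the default value of [xget]. *)
Lemma ell_eq (l : R) : (forall x, x != 0 ->
    enorm2 x ^+ k * (\sum_(I : k.-tuple 'I_N) partials I log x ^+ 2) = l) ->
  ell R N k = l.
Proof.
move=> Hl.
have nrm x : tensor_norm (nabla k log x) ^+ 2 = \sum_(I : k.-tuple 'I_N) partials I log x ^+ 2.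
  by rewrite sqr_sqrtr//; apply: sumr_ge0 => I _; exact: sqr_ge0.
have e0 : const_mx 1 != 0 :> V.
  by apply/eqP => /matrixP /(_ 0 0); rewrite !mxE; exact/eqP/oner_neq0.
have enk x : enorm x ^+ (2 * k) = enorm2 x ^+ k by rewrite exprM sqr_enorm.
have uniq (l' : R) : (forall x : V, x != 0 ->
    tensor_norm (nabla k log x) ^+ 2 = l' * enorm x ^- (2 * k)) -> l' = l.
  move=> /(_ _ e0); rewrite nrm enk -(Hl _ e0) => ->.
  by rewrite mulrC mulfVK// expf_neq0// gt_eqF// enorm2_gt0.
have l0 : 0 <= l.
  rewrite -(Hl _ e0) mulr_ge0 ?exprn_ge0 ?enorm2_ge0//.
  by apply: sumr_ge0 => I _; exact: sqr_ge0.
rewrite /ell; case: xgetP => [y _ [_ /uniq]//|none].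
move: l0; rewrite le_eqVlt => /predU1P[//|l0]; case: (none l); split=> // x x0.
by rewrite nrm enk -(Hl x x0) mulrC mulKf// expf_neq0// gt_eqF// enorm2_gt0.
Qed.

(** The factor |x|^(2k) clears exactly the denominator of the k-th derivatives, leaving the same
    singular factor |x|^-N for every [k]. *)
Lemma nabla_log_singular (I : k.-tuple 'I_N) x : x != 0 ->
  enorm x ^ ((2 * k)%:Z - N%:Z) * nabla k log x I =
  log_numerator I x * (enorm x)^-1 ^+ N.
Proof.
move=> x0; have r0 : enorm x != 0 by rewrite gt_eqF// enorm_gt0.
have s0 : enorm2 x ^+ k != 0 by rewrite expf_neq0// gt_eqF// enorm2_gt0.
have I0 : (I : seq _) != [::] by rewrite -size_eq0 size_tuple -lt0n.
rewrite /nabla partials_log// size_tuple expfzDr//.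
rewrite -[enorm x ^ (2 * k)%:Z]/(enorm x ^+ (2 * k)) exprM sqr_enorm.
rewrite -exprnN /inorm2 !exprVn; move: s0; move: (enorm2 x ^+ k) (enorm x ^- N) => s r s0.
by field.
Qed.

(** The innermost of the j + 1 operators E' acts on the regularised power and gives minus the
    kernel; the other j pass to [phi] as Euler operators. *)
Lemma Rintegral_iter_regularized j eps phi : 0 < eps -> test phi ->
  \int[muN]_x (iter j.+1 euler_adjf (fun y => inorm eps y ^+ N) x * phi x) =
  - \int[muN]_x (kernel eps x * iter j eulerf phi x).
Proof.
move=> e0 tphi; have sW := smooth_on_inormX N e0 (@openT V).
rewrite iterSr Rintegral_iter_euler_adjf//; last exact: smooth_euler_adjf.
rewrite euler_adjf_inormN// -[RHS]mulN1r -RintegralZl//; last first.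
  by apply: integrable_testM; [exact: continuous_kernel|exact: test_iter_eulerf].
by apply: eq_Rintegral => x _; rewrite mulNr mulN1r.
Qed.

Lemma iter_eulerf0 j phi : (0 < j)%N -> iter j eulerf phi 0 = 0.
Proof.
by case: j => // j _; apply: big1 => i _; rewrite mxE mul0r.
Qed.

(** As the regularised tensor is smooth, the derivatives can be moved back from [phi], and the
    expansion applies to the integrand. The sum on the right is reindexed from degree 1 since p_0 =
    0. *)
Lemma divergence_regularized (p : {poly int}) eps phi : 0 < eps -> test phi ->
  p`_0 = 0 ->
  (forall g x, smooth_on punctured g ->
    (forall i x, x != 0 -> enorm2 x * partial i g x = x 0 i * eulerf g x) ->
    x != 0 ->
    2 ^+ k * ((-1) ^+ k * \sum_(I : k.-tuple 'I_N)
      partials I (fun y => enorm2 y ^+ k * g y * partials I log y) x) =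
    \sum_(i < size p) iter i euler_adjf g x *~ p`_i) ->
  2 ^+ k * (\sum_(I : k.-tuple 'I_N)
    \int[muN]_x (log_numerator I x * inorm eps x ^+ N * partials (rev I) phi x)) =
  - \sum_(i < (size p).-1) (\int[muN]_x (kernel eps x * iter i eulerf phi x)) *~ p`_i.+1.
Proof.
move=> e0 tphi p0 Hp; pose W (y : V) := inorm eps y ^+ N.
have sW : smooth_on setT W := smooth_on_inormX N e0 openT.
have sP (I : k.-tuple 'I_N) : smooth_on setT (log_numerator I \* W).
  exact: smooth_onM openT (smooth_on_log_numerator I) sW.
have sdP (I : k.-tuple 'I_N) := smooth_on_partials I (sP I).
have sE i := smooth_iter_euler_adjf i sW.
pose F (I : k.-tuple 'I_N) x := partials I (log_numerator I \* W) x * phi x.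
have iF I : muN.-integrable setT (EFin \o F I).
  exact: integrable_testM (smooth_continuous (sdP I)) tphi.
pose G i x := iter i euler_adjf W x * phi x.
have iG i : muN.-integrable setT (EFin \o (fun x => G i x * (p`_i)%:~R)).
  by apply: integrableZrR; exact: integrable_testM (smooth_continuous (sE i)) tphi.
transitivity (2 ^+ k * ((-1) ^+ k * \int[muN]_x (\sum_(I : k.-tuple 'I_N) F I x))).
  congr (_ * _); rewrite Rintegral_sumR// mulr_sumr; apply: eq_bigr => I _.
  rewrite (Rintegral_partials I (sP I) tphi) size_tuple mulrA -exprMn mulrNN mulr1.
  by rewrite expr1n mul1r.
rewrite -RintegralZl//; last exact: integrable_sumR.
rewrite -RintegralZl//; last by apply: integrableZlR; exact: integrable_sumR.
transitivity (\int[muN]_x (\sum_(i < size p) G i x * (p`_i)%:~R)).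
  (* The expansion is known off the origin only, and the origin is a null set. *)
  apply: eq_Rintegral_punctured.
  - move=> x x0; transitivity (2 ^+ k * ((-1) ^+ k * \sum_(I : k.-tuple 'I_N)
      partials I (fun y => enorm2 y ^+ k * W y * partials I log y) x) * phi x).
      rewrite -!mulrA mulr_suml; congr (_ * (_ * _)); apply: eq_bigr => I _.
      rewrite /F; congr (_ * _).
      apply: (eq_on_partials I (@open_punctured R n) _ x0) => y /set_mem y0.
      have s0 : enorm2 y ^+ k != 0 by rewrite expf_neq0// gt_eqF// enorm2_gt0.
      have I0 : (I : seq _) != [::] by rewrite -size_eq0 size_tuple -lt0n.
      rewrite partials_log// size_tuple /inorm2 exprVn /=.
      by move: (W y) (log_numerator I y) => w q; field.
    rewrite Hp//; last 2 first.
    + exact: smooth_on_subset sW.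
    + by move=> i y _; exact: radial_inormX.
    by rewrite mulr_suml; apply: eq_bigr => i _; rewrite /G -mulrzr mulrAC.
  - apply: measurable_funM => //; apply: measurable_funM => //.
    by apply/measurable_EFinP; case/integrableP: (integrable_sumR (index_enum _) iF).
  - have := @integrable_sumR _ _ R muN _ (index_enum 'I_(size p))
      (fun i x => G i x * (p`_i)%:~R) (fun i => iG i).
    by case/integrableP => /measurable_EFinP.
rewrite Rintegral_sumR//.
have Gint i : muN.-integrable setT (EFin \o G i).
  exact: integrable_testM (smooth_continuous (sE i)) tphi.
under eq_bigr do rewrite RintegralZr//.
case: (size p) => [|m]; first by rewrite !big_ord0 oppr0.
rewrite big_ord_recl p0 mulr0 add0r -sumrN; apply: eq_bigr => i _.
by rewrite [X in X * _](Rintegral_iter_regularized i e0 tphi) mulNr mulrzr.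
Qed.

Lemma divergence_log_singular (p : {poly int}) (S : k.-tuple 'I_N -> V -> R) phi :
  p`_0 = 0 ->
  (forall g x, smooth_on punctured g ->
    (forall i x, x != 0 -> enorm2 x * partial i g x = x 0 i * eulerf g x) ->
    x != 0 ->
    2 ^+ k * ((-1) ^+ k * \sum_(I : k.-tuple 'I_N)
      partials I (fun y => enorm2 y ^+ k * g y * partials I log y) x) =
    \sum_(i < size p) iter i euler_adjf g x *~ p`_i) ->
  (forall I x, x != 0 -> S I x = log_numerator I x * (enorm x)^-1 ^+ N) ->
  test phi ->
  2 ^+ k * (\sum_(I : k.-tuple 'I_N) \int[muN]_x (S I x * partials (rev I) phi x)) =
  - (p`_1)%:~R * omega R N * phi 0.
Proof.
move=> p0 Hp SE tphi.
(* This one sequence, with eps = 1/(m + 1), has two limits: one by dominated convergence on the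
   tensor, the other by concentration of the kernels. *)
pose lhs (m : nat) := 2 ^+ k * (\sum_(I : k.-tuple 'I_N) \int[muN]_x
  (log_numerator I x * inorm m.+1%:R^-1 x ^+ N * partials (rev I) phi x)).
have cvg1 : lhs m @[m --> \oo] -->
    2 ^+ k * (\sum_(I : k.-tuple 'I_N) \int[muN]_x (S I x * partials (rev I) phi x)).
  apply: cvgM; first exact: cvg_cst.
  apply: cvg_bigsum => I; apply: regularized_cvg.
  - exact: smooth_continuous (smooth_on_log_numerator I).
  - exact: weakly_singular_log (SE I).
  - exact: SE.
  - exact: test_partials.
have cvg2 : lhs m @[m --> \oo] -->
    - \sum_(i < (size p).-1) (omega R N * iter i eulerf phi 0) * (p`_i.+1)%:~R.
  have -> : lhs = (fun m => - \sum_(i < (size p).-1)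
      (\int[muN]_x (kernel m.+1%:R^-1 x * iter i eulerf phi x)) * (p`_i.+1)%:~R).
    apply/funext => m; rewrite /lhs (@divergence_regularized p)//.
    by congr (- _); apply: eq_bigr => i _; rewrite mulrzr.
  apply: cvgN; apply: cvg_bigsum => i; apply: cvgM; last exact: cvg_cst.
  apply: kernel_approximates_delta => //.
  exact: test_compactly_supported (test_iter_eulerf i tphi).
have -> := cvg_unique (@Rhausdorff R) cvg1 cvg2.
rewrite mulNr mulNr; congr (- _); case E: (size p).-1 => [|m].
  (* If [p] has size at most 1, the sum is empty and p_1 is the default coefficient 0. *)
  by rewrite big_ord0 nth_default ?mul0r// -subn_eq0 subn1 E.
rewrite big_ord_recl big1 ?addr0 => [|i _]; first by rewrite mulrC mulrA.
by rewrite iter_eulerf0// mulr0 mul0r.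
Qed.

(** The signs of the k distributional derivatives cancel [(-1) ^+ k], and the factor 2^k is the one
    by which [ell] differs from p_1. *)
Lemma distribution_div_log_singular (T : V -> tensor R N k) :
  (forall I x, x != 0 -> T x I = log_numerator I x * (enorm x)^-1 ^+ N) ->
  eq_distribution (distribution_scale ((-1) ^+ k) (distribution_div T))
    (distribution_scale (- (ell R N k * omega R N)) delta0).
Proof.
move=> TE phi /test_functionP tphi.
have [p [p0 p1 Hp]] := @log_expansion R n k k0.
have k2 : 2 ^+ k != 0 :> R by rewrite expf_neq0// pnatr_eq0.
have -> : ell R N k = (p`_1)%:~R / 2 ^+ k.
  apply: ell_eq => x x0; rewrite -(p1 x x0) -mulrA [RHS]mulrC mulKf//.
have H := @divergence_log_singular p (fun I x => T x I) phi p0 Hp TE tphi.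
rewrite /distribution_scale /delta0.
transitivity (\sum_(I : k.-tuple 'I_N) \int[muN]_x (T x I * partials (rev I) phi x)).
  rewrite /distribution_div mulr_sumr; apply: eq_bigr => I _.
  rewrite distribution_partialsE size_tuple mulrA -exprMn mulrNN mulr1 expr1n mul1r.
  by [].
apply: (mulfI k2); rewrite H; field.
exact: k2.
Qed.

End divergence.

Theorem theorem3p1 (R : realType) (N k : nat) (hN : (0 < N)%N) (hk : (0 < k)%N) :
  let T : 'rV[R]_N -> tensor R N k := fun x I =>
    enorm x ^ ((2 * k)%:Z - N%:Z) * nabla k (@log_enorm R N) x I in
  (forall I : k.-tuple 'I_N, locally_integrable_rV (fun x => T x I)) /\
  eq_distribution
    (distribution_scale ((-1) ^+ k) (distribution_div T))
    (distribution_scale (- (ell R N k * omega R N)) delta0).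
Proof.
case: N hN => // n _ T; split=> [I|].
  apply: weakly_singular_locally_integrable; apply: weakly_singular_log => x.
  exact: nabla_log_singular.
by apply: (distribution_div_log_singular hk) => I x; exact: nabla_log_singular.
Qed.
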